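(* Let $j\ge1$ and $m$ be coprime integers, and suppose $j(\omega_1\gamma+\eta_1\beta)=i\pi m$, so that the function $f(z)=\kappa\,\dfrac{\sigma(z+\alpha+\beta)}{\sigma(z+\alpha)}e^{\gamma z}$, $\kappa=e^{\gamma\alpha}/\sigma(\beta)$, satisfies $f(z+2\omega_1j)=f(z)$. Let $P_n(z)$ be the Laurent biorthogonal polynomials with moments $c_k=f(wk)$, $k\in\mathbb Z$, and $Q_n(z)$ their biorthogonal partners. Define $$z_s=\exp\left(\frac{i\pi sw}{j\omega_1}\right),\quad s\in\mathbb Z,$$ and weights $A_s=0$ if $s\not\equiv m \pmod j$, while for $s=m+jk$, $k\in\mathbb Z$, $$A_s=\frac{2\pi i\,R_0\,\exp\left(-\frac{i\pi\alpha_0k}{\omega_1}\right)h^{-2\nu k}}{1-e^{-i\pi\beta/\omega_1}\,h^{-2k}},\qquad R_0=\frac{\kappa\,\sigma(\beta)}{2\omega_1}\exp\left(\frac{\alpha\beta\eta_1}{\omega_1}\right),\qquad h=\exp\left(\frac{i\pi\omega_3}{\omega_1}\right).$$ Then the polynomials $P_n$ are biorthogonal on the unit circle with respect to the point measure with masses $A_s$ at $z_s$: for all $n,m'\ge0$, $$\sum_{s=-\infty}^{\infty}A_s\,P_n(z_s)\,Q_{m'}(1/z_s)=h_n\,\delta_{nm'},\qquad h_n=\frac{\Delta_{n+1}}{\Delta_n},$$ and this measure is a dense point measure: the points $z_s$ carrying nonzero mass are pairwise distinct and dense in $|z|=1$.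
   Context: $\sigma,\zeta$ denote the Weierstrass sigma and zeta functions of the lattice $\Lambda=2\omega_1\mathbb Z+2\omega_3\mathbb Z$ with $\omega_1>0$ and $\omega_3\in i\mathbb R_{>0}$ (so $0<h<1$); $\eta_1=\zeta(\omega_1)$. The parameter $w$ is real with $wN_1\ne\omega_1N_2$ for all integers $(N_1,N_2)\ne(0,0)$. The parameter $\alpha$ has the form $\alpha=-\alpha_0-2\nu\omega_3$ with real $0\le\alpha_0<2\omega_1$ and $0<\nu<1$; $\beta,\gamma\in\mathbb C$. Nondegeneracy: $\beta+n\alpha\notin\Lambda$ and $\beta+n(\alpha+w)\notin\Lambda$ for all integers $n\ge0$. Explicitly the moments are $c_k=e^{\gamma wk+\gamma\alpha}\frac{\sigma(wk+\beta+\alpha)}{\sigma(wk+\alpha)\sigma(\beta)}$. Toeplitz determinants: $\Delta_0=1$, $\Delta_n=\det(c_{k-i})_{i,k=0,\dots,n-1}$; they are nonzero because $w$ is real with $wN_1\ne\omega_1N_2$ for all integers $(N_1,N_2)\ne(0,0)$, $\alpha=-\alpha_0-2\nu\omega_3$ with $\alpha_0$ real and $0<\nu<1$ (so $\alpha\notin w\mathbb Z+\Lambda$), and $\beta+n\alpha\notin\Lambda$ for all integers $n\ge0$. The monic polynomials $P_n$, $Q_n$ ($P_0=Q_0=1$) are $$P_n(z)=\frac1{\Delta_n}\begin{vmatrix} c_0&c_1&\dots&c_n\\ c_{-1}&c_0&\dots&c_{n-1}\\ \vdots&\vdots&&\vdots\\ c_{1-n}&c_{2-n}&\dots&c_1\\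 1&z&\dots&z^n\end{vmatrix},\qquad Q_n(z)=\frac1{\Delta_n}\begin{vmatrix} c_0&c_{-1}&\dots&c_{-n}\\ c_{1}&c_0&\dots&c_{1-n}\\ \vdots&\vdots&&\vdots\\ c_{n-1}&c_{n-2}&\dots&c_{-1}\\ 1&z&\dots&z^n\end{vmatrix}.$$ *)

(* Defs.v *)
From HB Require Import structures.
From mathcomp Require Import all_boot all_order all_algebra.
From mathcomp Require Import all_classical all_reals all_analysis.
From mathcomp Require Import complex.

Set Implicit Arguments.
Unset Strict Implicit.
Unset Printing Implicit Defensive.

Import Order.TTheory GRing.Theory Num.Theory.
Import numFieldNormedType.Exports.

Local Open Scope ring_scope.
Local Open Scope complex_scope.
Local Open Scope classical_set_scope.

(* R[i]^o is R[i] seen as a normed module over itself; it carries the usual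
   topology of the complex plane and is used below wherever a limit is taken. *)

Section ComplexAnalysis.
Variable R : realType.
Implicit Types z l : R[i].

Definition cexp z : R[i] :=
  (expR (complex.Re z))%:C
  * (cos (complex.Im z) +i* sin (complex.Im z)).

(* sum over all s in Z of a s is l: the partial sums over -M <= s < N tend
   to l as M and N tend to infinity independently. *)
Definition is_bilateral_sum (a : int -> R[i]) l : Prop :=
  (fun MN : nat * nat => \sum_(0 <= k < MN.1) a (- (k.+1)%:Z)
                         + \sum_(0 <= k < MN.2) a k%:Z : R[i]^o)
    @ filter_prod \oo \oo --> (l : R[i]^o).

End ComplexAnalysis.

Section Weierstrass.
Variables (R : realType) (omega1 omega3 : R[i]).
Implicit Types z : R[i].

(* omega1 and omega3 are half-periods. *)
Definition lattice_pt (p q : int) : R[i] :=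
  2 * omega1 * p%:~R + 2 * omega3 * q%:~R.

Definition lattice : set R[i] :=
  [set z | exists p q : int, z = lattice_pt p q].

(* The point with coordinates (p - N, q - N); as p and q range over
   0, ..., 2N these exhaust the square [-N, N] x [-N, N]. The product and the
   series below converge absolutely, so the exhaustion is immaterial. *)
Definition box_pt (N p q : nat) : R[i] := lattice_pt (p%:Z - N%:Z) (q%:Z - N%:Z).

Definition sigma_factor z (l : R[i]) : R[i] :=
  (1 - z / l) * cexp (z / l + z ^+ 2 / (2 * l ^+ 2)).

Definition weierstrass_sigma z : R[i] :=
  z * lim ((fun N : nat =>
    \prod_(p < N.*2.+1) \prod_(q < N.*2.+1 | box_pt N p q != 0)
      sigma_factor z (box_pt N p q) : R[i]^o) @ \oo).

Definition zeta_term z (l : R[i]) : R[i] := (z - l)^-1 + l^-1 + z / l ^+ 2.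

Definition weierstrass_zeta z : R[i] :=
  z^-1 + lim ((fun N : nat =>
    \sum_(p < N.*2.+1) \sum_(q < N.*2.+1 | box_pt N p q != 0)
      zeta_term z (box_pt N p q) : R[i]^o) @ \oo).

Definition eta1 : R[i] := weierstrass_zeta omega1.

End Weierstrass.

Section BiorthogonalPolynomials.
Variables (F : fieldType) (c : int -> F).

Definition toeplitz_det (n : nat) : F :=
  \det (\matrix_(i < n, k < n) c (k%:Z - i%:Z)).

Definition lbp (n : nat) : {poly F} :=
  (toeplitz_det n)^-1 *: \det (\matrix_(i < n.+1, k < n.+1)
    if (i < n)%N then (c (k%:Z - i%:Z))%:P else 'X^k).

Definition lbp_partner (n : nat) : {poly F} :=
  (toeplitz_det n)^-1 *: \det (\matrix_(i < n.+1, k < n.+1)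
    if (i < n)%N then (c (i%:Z - k%:Z))%:P else 'X^k).

End BiorthogonalPolynomials.

Section EllipticMoments.
Variables (R : realType) (omega1 : R) (omega3 : R[i]).
Variables (alpha beta gamma : R[i]).

Let sigma := weierstrass_sigma omega1%:C omega3.

Definition kappa : R[i] := cexp (gamma * alpha) / sigma beta.

Definition elliptic_f (z : R[i]) : R[i] :=
  kappa * (sigma (z + alpha + beta) / sigma (z + alpha)) * cexp (gamma * z).

Definition elliptic_moment (w : R) (k : int) : R[i] :=
  elliptic_f (w%:C * k%:~R).

End EllipticMoments.

Section PointMeasure.
Variables (R : realType) (omega1 : R) (omega3 : R[i]).

Definition mass_pt (w : R) (j s : int) : R[i] :=
  cexp ('i * pi%:C * s%:~R * w%:C / (j%:~R * omega1%:C)).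

(* exp(i pi omega3 / omega1) is a positive real number, since omega3 / omega1
   lies on the positive imaginary axis; it is taken here as an element of R so
   that its real powers are those of powR. *)
Definition nome : R := complex.Re (cexp ('i * pi%:C * omega3 / omega1%:C)).

Variables (alpha0 nu : R) (alpha beta gamma : R[i]).

Definition mass_R0 : R[i] :=
  kappa omega1 omega3 alpha beta gamma * weierstrass_sigma omega1%:C omega3 beta
  / (2 * omega1%:C)
  * cexp (alpha * beta * eta1 omega1%:C omega3 / omega1%:C).

(* The mass A_s at s = m + j k. *)
Definition mass_at (k : int) : R[i] :=
  2 * pi%:C * 'i * mass_R0
  * cexp (- ('i * pi%:C * alpha0%:C * k%:~R / omega1%:C))
  * (nome `^ (- (2 * nu * k%:~R)))%:C
  / (1 - cexp (- ('i * pi%:C * beta / omega1%:C))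
         * (nome ^ (- (2 * k)))%:C).

Definition mass (j m s : int) : R[i] :=
  if (s == m %[mod j])%Z then mass_at ((s - m) %/ j)%Z else 0.

End PointMeasure.

(* Main.v *)
(* Grouping the lattice points of a square box by rows parallel to omega1 and
   evaluating each row with Euler's sine product gives
     sigma(z) = exp(eta1 z^2 / (2 omega1) + i pi z / (2 omega1))
                * omega1 / (i pi) * theta(x) / (q; q)^2,  x = exp(-i pi z / omega1),
   where q = h^2, theta(x) = (x; q) (q / x; q), and eta1 is read off from the
   same grouping of the series for zeta(omega1), whose rows telescope.
   A finite partial fraction identity, passed to the limit, yields
     theta(x y) (q; q)^2 / (theta(x) theta(y)) = sum_k x^k / (1 - y q^k)
   for |q| < |x| < 1, where k runs over all integers. On the real
   line this is a Fourier series of f, and it says that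
   c_n = sum_s A_s z_s^n for every integer n. Biorthogonality is then the
   determinantal orthogonality of P_n and Q_n for the moments c_n. As w is not
   commensurable with omega1, the points carrying mass are distinct and dense. *)

Require Import Defs.
From HB Require Import structures.
From mathcomp Require Import all_boot all_order all_algebra.
From mathcomp Require Import all_classical all_reals all_analysis.
From mathcomp Require Import complex.
From mathcomp Require Import zify ring lra.

Import Order.TTheory GRing.Theory Num.Theory.
Import numFieldNormedType.Exports.

Local Open Scope ring_scope.
Local Open Scope complex_scope.
Local Open Scope classical_set_scope.

Set Implicit Arguments.
Unset Strict Implicit.
Unset Printing Implicit Defensive.

(** * Complex limits *)

(** Sigma and zeta are defined by square boxes, the theta product comes from rows; exchanging the
    two limits needs a bound on each row that is uniform in its length. Pairing [l] with [- l]
    supplies it: what remains is of order |l|^-4, the n-th row contributes at most a constant over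
    (n + 1)^2, and Tannery's theorem applies. The Gaussian factor of sigma carries the row-wise
    Eisenstein sum of weight 2; zeta(omega1) yields the same sum, so eta1 enters without being
    evaluated. On the line of the moments |x| = h^(2 nu), so 0 < nu < 1 says |q| < |x| < 1, and both
    halves of the series converge geometrically. The period condition turns exp((gamma + eta1 beta /
    omega1) z) into exp(i pi m z / (j omega1)), so the term of index k oscillates with frequency m +
    j k: this is the origin of the support of A_s. The arguments of these points modulo 2 pi are, up
    to translation and scaling, the subgroup of the reals generated by w and 2 omega1. *)

Section ComplexModulus.
Variable R : realType.
Implicit Types (x y z : R[i]).

Definition cabs z : R := Normc.normc z.

Lemma cabsE z : `|z| = (cabs z)%:C. Proof. by []. Qed.

Lemma cabs_ge0 z : 0 <= cabs z.
Proof. by case: z => a b; exact: sqrtr_ge0. Qed.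

Lemma cabsM x y : cabs (x * y) = cabs x * cabs y.
Proof. exact: Normc.normcM. Qed.

Lemma cabsD x y : cabs (x + y) <= cabs x + cabs y.
Proof. exact: le_normcD. Qed.

Lemma cabsN x : cabs (- x) = cabs x.
Proof. exact: normcN. Qed.

Lemma cabsBC x y : cabs (x - y) = cabs (y - x).
Proof. by rewrite -cabsN opprB. Qed.

Lemma cabs0 : cabs 0 = 0. Proof. exact: Normc.normc0. Qed.

Lemma cabs1 : cabs 1 = 1. Proof. exact: Normc.normc1. Qed.

Lemma cabsV x : cabs x^-1 = (cabs x)^-1.
Proof. exact: Normc.normcV. Qed.

Lemma cabsX x n : cabs (x ^+ n) = cabs x ^+ n.
Proof. by elim: n => [|n IH]; rewrite ?expr0 ?cabs1 // !exprS cabsM IH. Qed.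

Lemma cabs_eq0 x : (cabs x == 0) = (x == 0).
Proof.
by apply/eqP/eqP => [/Normc.eq0_normc //|->]; exact: cabs0.
Qed.

Lemma cabs_gt0 x : (0 < cabs x) = (x != 0).
Proof. by rewrite lt_def cabs_ge0 cabs_eq0 andbT. Qed.

Lemma cabs_real (a : R) : cabs a%:C = `|a|.
Proof. by rewrite /cabs /= expr0n addr0 sqrtr_sqr. Qed.

Lemma cabs_nat n : cabs n%:R = n%:R.
Proof. by rewrite -[n%:R](rmorph_nat (real_complex R)) cabs_real normr_nat. Qed.

Lemma sqr_cabs z : cabs z ^+ 2 = complex.Re z ^+ 2 + complex.Im z ^+ 2.
Proof. by case: z => a b; rewrite sqr_sqrtr // addr_ge0 ?sqr_ge0. Qed.

Lemma cabs_ge_Re z : `|complex.Re z| <= cabs z.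
Proof.
rewrite -(@ler_pXn2r _ 2) ?nnegrE ?cabs_ge0 // sqr_cabs real_normK ?num_real //.
by rewrite lerDl sqr_ge0.
Qed.

Lemma cabs_ge_Im z : `|complex.Im z| <= cabs z.
Proof.
rewrite -(@ler_pXn2r _ 2) ?nnegrE ?cabs_ge0 // sqr_cabs real_normK ?num_real //.
by rewrite lerDr sqr_ge0.
Qed.

Lemma cabs_le_ReIm z : cabs z <= `|complex.Re z| + `|complex.Im z|.
Proof.
rewrite -(@ler_pXn2r _ 2) ?nnegrE ?cabs_ge0 ?addr_ge0 // sqr_cabs sqrrD.
rewrite !real_normK ?num_real // -addrA [_ *+ 2 + _]addrC addrA lerDl.
by rewrite mulrn_wge0 // mulr_ge0.
Qed.

Lemma cabsB_ge x y : cabs x - cabs y <= cabs (x - y).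
Proof. by rewrite lerBlDr (le_trans _ (cabsD _ _)) // subrK. Qed.

Lemma cabs_sum I (r : seq I) (P : pred I) (F : I -> R[i]) :
  cabs (\sum_(i <- r | P i) F i) <= \sum_(i <- r | P i) cabs (F i).
Proof.
elim/big_ind2: _ => [|x a y b ha hb|//]; first by rewrite cabs0.
by rewrite (le_trans (cabsD _ _)) ?lerD.
Qed.

Lemma cabs_prod I (r : seq I) (P : pred I) (F : I -> R[i]) :
  cabs (\prod_(i <- r | P i) F i) = \prod_(i <- r | P i) cabs (F i).
Proof.
by elim/big_ind2: _ => [|x a y b <- <-|//]; rewrite ?cabs1 ?cabsM.
Qed.

End ComplexModulus.

Section ComplexLimits.
Variable R : realType.
Implicit Types (u v : nat -> R[i]) (l m : R[i]) (e : nat -> R).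

(** The norm of [R[i]] takes its values in [R[i]]; measuring distances by the real [cabs] gives
    access to squeezing and to dominated real series. [ccvg_cvg] returns to the topology of
    [R[i]^o]. *)
Definition ccvg u l : Prop := (fun n => cabs (u n - l)) @ \oo --> (0 : R).

Lemma ccvg_majorant e u l :
  (forall n, cabs (u n - l) <= e n) -> e @ \oo --> (0 : R) -> ccvg u l.
Proof.
move=> h he; apply: (squeeze_cvgr _ (cvg_cst 0) he).
by apply: nearW => n; rewrite h cabs_ge0.
Qed.

Lemma ccvgP u l : ccvg u l <->
  forall e : R, 0 < e -> \forall n \near \oo, cabs (u n - l) < e.
Proof.
split => [/cvgrPdist_lt h e e0|h].
  near=> n; have : `|0 - cabs (u n - l)| < e by near: n; exact: h.
  by rewrite sub0r normrN ger0_norm ?cabs_ge0.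
apply/cvgrPdist_lt => e e0; near=> n.
rewrite sub0r normrN ger0_norm ?cabs_ge0 //.
by near: n; exact: h.
Unshelve. all: by end_near. Qed.

Lemma ccvg_cst l : ccvg (fun=> l) l.
Proof. by apply: (@ccvg_majorant (fun=> 0)) => [n|]; [rewrite subrr cabs0|exact: cvg_cst]. Qed.

Lemma ccvg_eq u v l : u =1 v -> ccvg u l -> ccvg v l.
Proof. by move=> h; rewrite /ccvg; under eq_fun do rewrite h. Qed.

Lemma ccvg_near u v l : (\forall n \near \oo, u n = v n) -> ccvg u l -> ccvg v l.
Proof.
move=> h /ccvgP hu; apply/ccvgP => e e0; near=> n.
by have <- : u n = v n by [near: n]; near: n; exact: hu.
Unshelve. all: by end_near. Qed.

Lemma ccvgD u v l m : ccvg u l -> ccvg v m -> ccvg (fun n => u n + v n) (l + m).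
Proof.
move=> hu hv; apply: ccvg_majorant; last first.
  by rewrite -[0]addr0; exact: cvgD hu hv.
by move=> n /=; rewrite opprD addrACA cabsD.
Qed.

Lemma ccvgN u l : ccvg u l -> ccvg (fun n => - u n) (- l).
Proof. by rewrite /ccvg => hu; under eq_fun do rewrite -opprD cabsN. Qed.

Lemma ccvgB u v l m : ccvg u l -> ccvg v m -> ccvg (fun n => u n - v n) (l - m).
Proof. by move=> hu hv; apply: ccvgD hu (ccvgN hv). Qed.

Lemma ccvgM u v l m : ccvg u l -> ccvg v m -> ccvg (fun n => u n * v n) (l * m).
Proof.
move=> hu hv.
apply: (@ccvg_majorant (fun n => cabs (u n - l) * cabs (v n - m)
   + (cabs l * cabs (v n - m) + cabs m * cabs (u n - l)))).
  move=> n; rewrite -!cabsM.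
  have -> : u n * v n - l * m
      = (u n - l) * (v n - m) + (l * (v n - m) + m * (u n - l)) by ring.
  by apply: le_trans (cabsD _ _) _; rewrite lerD2l cabsD.
rewrite [X in _ --> X](_ : 0 = 0 * 0 + (cabs l * 0 + cabs m * 0) :> R); last by ring.
by apply: cvgD; [exact: cvgM|apply: cvgD; apply: cvgMr].
Qed.

Lemma ccvgZ u l m : ccvg u l -> ccvg (fun n => m * u n) (m * l).
Proof. exact/ccvgM/ccvg_cst. Qed.

Lemma ccvg_unique u l m : ccvg u l -> ccvg u m -> l = m.
Proof.
move=> /ccvgP hl /ccvgP hm; apply/eqP; rewrite -subr_eq0 -cabs_eq0.
apply/negP => /negP; rewrite cabs_eq0 -cabs_gt0 => d0.
near \oo => n.
have h1 : cabs (u n - l) < cabs (l - m) / 2 by near: n; apply: hl; lra.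
have h2 : cabs (u n - m) < cabs (l - m) / 2 by near: n; apply: hm; lra.
have := cabsD (u n - m) (l - u n); have -> : u n - m + (l - u n) = l - m by ring.
rewrite (cabsBC l (u n)); lra.
Unshelve. all: by end_near. Qed.

Lemma ccvg_bounded u l : ccvg u l -> exists2 K : R, 0 < K & forall n, cabs (u n) <= K.
Proof.
move=> /ccvgP/(_ 1 ltr01) [N _ hN].
exists (1 + cabs l + \sum_(n < N) cabs (u n)) => [|n].
  rewrite -addrA ltr_pwDl // addr_ge0 ?cabs_ge0 //.
  by apply: sumr_ge0 => *; exact: cabs_ge0.
have S0 : 0 <= \sum_(n < N) cabs (u n) by apply: sumr_ge0 => *; exact: cabs_ge0.
case: (ltnP n N) => nN.
  rewrite (bigD1 (Ordinal nN)) //= addrCA lerDl !addr_ge0 ?cabs_ge0 //.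
  by apply: sumr_ge0 => *; exact: cabs_ge0.
have := hN n nN; have := cabsB_ge (u n) l; rewrite /=; lra.
Qed.

(** Beyond some index the modulus exceeds half that of the limit, and the finitely many earlier
    terms have a positive minimum. This keeps denominators such as [1 - y * q ^+ n] uniformly away
    from 0. *)
Lemma ccvg_bounded_below u l : ccvg u l -> l != 0 ->
  (forall n, u n != 0) -> exists2 c : R, 0 < c & forall n, c <= cabs (u n).
Proof.
move=> /ccvgP hu l0 u0; have a0 : 0 < cabs l / 2 by rewrite divr_gt0 ?cabs_gt0.
have [N _ hN] := hu _ a0.
have [c c0 hc] : exists2 c : R, 0 < c & forall n, (n < N)%N -> c <= cabs (u n).
  elim: N {hN} => [|N [c c0 IH]]; first by exists 1.
  exists (Num.min c (cabs (u N))); first by rewrite lt_min c0 cabs_gt0 u0.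
  move=> n; rewrite ltnS leq_eqVlt => /orP[/eqP->|/IH h]; rewrite ge_min ?lexx ?orbT //.
  by rewrite h.
exists (Num.min c (cabs l / 2)) => [|n]; first by rewrite lt_min c0.
case: (ltnP n N) => nN; rewrite ge_min; first by rewrite hc.
have := hN n nN; have := cabsB_ge l (u n); rewrite cabsBC /= => h1 h2.
by apply/orP; right; lra.
Qed.

Lemma ccvgV u l : ccvg u l -> l != 0 -> ccvg (fun n => (u n)^-1) l^-1.
Proof.
move=> hu l0; have a0 : 0 < cabs l by rewrite cabs_gt0.
move/ccvgP: (hu) => hu'.
apply: (squeeze_cvgr _ (cvg_cst 0) (h := fun n => cabs (u n - l) * (2 / cabs l ^+ 2))); last first.
  by rewrite -[0](mul0r (2 / cabs l ^+ 2)); apply: cvgMl.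
near=> n; rewrite cabs_ge0 /=.
have h1 : cabs (u n - l) < cabs l / 2 by near: n; apply: hu'; lra.
have h2 : cabs l / 2 <= cabs (u n).
  have := cabsB_ge l (u n); rewrite cabsBC; lra.
have un0 : u n != 0 by rewrite -cabs_gt0; lra.
have -> : (u n)^-1 - l^-1 = - (u n - l) / (u n * l) by field; rewrite un0 l0.
rewrite cabsM cabsN cabsV cabsM ler_wpM2l ?cabs_ge0 //.
rewrite -[2]invrK -invfM lef_pV2 ?posrE ?mulr_gt0 ?invr_gt0 ?exprn_gt0 //; last by lra.
by rewrite expr2 mulrA ler_pM2r // mulrC.
Unshelve. all: by end_near. Qed.

Lemma ccvg_comp u l (f : nat -> nat) : ccvg u l -> f @ \oo --> \oo ->
  ccvg (fun n => u (f n)) l.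
Proof. by move=> hu hf; exact: cvg_comp hf hu. Qed.

Lemma ccvg_subseq u l (f : nat -> nat) : ccvg u l -> (forall n, (n <= f n)%N) ->
  ccvg (fun n => u (f n)) l.
Proof.
move=> hu hf; apply: ccvg_comp hu _; apply/cvgnyPge => A; near=> n.
by apply: leq_trans (hf n); near: n; exact: nbhs_infty_ge.
Unshelve. all: by end_near. Qed.

Lemma ccvg_shift u l k : ccvg u l -> ccvg (fun n => u (n - k)%N) l.
Proof.
move=> hu; apply: ccvg_comp hu _; apply/cvgnyPge => A; near=> n.
have : (A + k <= n)%N by near: n; exact: nbhs_infty_ge.
by rewrite leqNgt => h; rewrite leqNgt; apply: contra h; lia.
Unshelve. all: by end_near. Qed.

Lemma ccvg_ReIm u l :
  (fun n => complex.Re (u n)) @ \oo --> complex.Re l ->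
  (fun n => complex.Im (u n)) @ \oo --> complex.Im l -> ccvg u l.
Proof.
move=> hr hi; apply: (@ccvg_majorant (fun n =>
  `|complex.Re (u n) - complex.Re l| + `|complex.Im (u n) - complex.Im l|)).
  by move=> n; apply: le_trans (cabs_le_ReIm _) _; rewrite !raddfB.
have aux (g : nat -> R) a : g @ \oo --> a -> (fun n => `|g n - a|) @ \oo --> (0 : R).
  move=> h; rewrite -(normr0 R) -(subrr a).
  by apply: cvg_norm; apply: cvgB h (cvg_cst _).
by rewrite -[0]addr0; apply: cvgD; exact: aux.
Qed.

Lemma ccvg_series u (M : nat -> R) : (forall k, cabs (u k) <= M k) ->
  cvgn (series M) -> exists l, ccvg (fun n => \sum_(k < n) u k) l.
Proof.
move=> hu hM.
have key (g : R[i] -> R) : (forall z, `|g z| <= cabs z) -> cvgn (series (fun k => g (u k))).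
  move=> hg; apply: normed_cvg; apply: (series_le_cvg _ _ _ hM) => n //=.
    by apply: le_trans (hu n); exact: cabs_ge0.
  exact: le_trans (hg _) (hu n).
have /cvg_ex[/= a ha] := key (fun z => complex.Re z) (@cabs_ge_Re R).
have /cvg_ex[/= b hb] := key (fun z => complex.Im z) (@cabs_ge_Im R).
exists (Complex a b); apply: ccvg_ReIm => /=.
  under eq_fun do rewrite raddf_sum -(big_mkord xpredT (fun k => complex.Re (u k))).
  exact: ha.
under eq_fun do rewrite raddf_sum -(big_mkord xpredT (fun k => complex.Im (u k))).
exact: hb.
Qed.

Lemma ccvg_sum (I : Type) (r : seq I) (u : I -> nat -> R[i]) (l : I -> R[i]) :
  (forall i, ccvg (u i) (l i)) ->
  ccvg (fun n => \sum_(i <- r) u i n) (\sum_(i <- r) l i).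
Proof.
move=> h; elim: r => [|i r IH].
  by rewrite big_nil; under eq_fun do rewrite big_nil; exact: ccvg_cst.
by rewrite big_cons; under eq_fun do rewrite big_cons; exact: ccvgD.
Qed.

Lemma ccvg_prod (I : Type) (r : seq I) (u : I -> nat -> R[i]) (l : I -> R[i]) :
  (forall i, ccvg (u i) (l i)) ->
  ccvg (fun n => \prod_(i <- r) u i n) (\prod_(i <- r) l i).
Proof.
move=> h; elim: r => [|i r IH].
  by rewrite big_nil; under eq_fun do rewrite big_nil; exact: ccvg_cst.
by rewrite big_cons; under eq_fun do rewrite big_cons; exact: ccvgM.
Qed.

(** Dominated convergence for sums whose length grows with the index: beyond some rank [K] the
    majorant makes both tails small, and below it only finitely many termwise limits are
    involved. *)
Lemma ccvg_tannery (u : nat -> nat -> R[i]) (v : nat -> R[i]) (M : nat -> R) l :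
  (forall n k, (k < n)%N -> cabs (u n k) <= M k) -> cvgn (series M) ->
  (forall k, ccvg (fun n => u n k) (v k)) ->
  ccvg (fun n => \sum_(k < n) v k) l ->
  ccvg (fun n => \sum_(k < n) u n k) l.
Proof.
move=> hu hM huv hl.
have M0 k : 0 <= M k by apply: le_trans (hu k.+1 k _); rewrite ?cabs_ge0.
have hv k : cabs (v k) <= M k.
  apply/ler_addgt0Pl => e e0; have /ccvgP/(_ _ e0) huk := huv k.
  near \oo => n.
  have h1 : cabs (u n k - v k) < e by near: n.
  have h2 : cabs (u n k) <= M k by apply: hu; near: n; exact: nbhs_infty_gt.
  have := cabsB_ge (v k) (u n k); rewrite (cabsBC (v k)); lra.
suff h0 : ccvg (fun n => \sum_(k < n) (u n k - v k)) 0.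
  rewrite -[l]add0r; apply: (ccvg_eq _ (ccvgD h0 hl)) => n.
  by rewrite -big_split /=; apply: eq_bigr => k _; rewrite subrK.
apply/ccvgP => e e0.
have /cvg_ex[/= S hS] := hM.
(* With [e / 8], any block of [M] beyond [K] is at most [e / 4]; the tails of [u] and [v] together
   cost [e / 2], the head [e / 4]. *)
have [K _ hK] : \forall n \near \oo, `|S - series M n| < e / 8.
  by move/cvgrPdist_lt : hS => /(_ (e / 8)); apply; lra.
have hK' n : (K <= n)%N -> \sum_(K <= k < n) M k <= e / 4.
  move=> Kn; have := hK K (leqnn K); have := hK n Kn.
  rewrite -(sub_series_geq M Kn) /= !ltr_norml; lra.
(* [K.+1] instead of [K] keeps the quotient positive when [K = 0]. *)
have d0 : 0 < e / (4 * K.+1%:R) by rewrite divr_gt0 // mulr_gt0 ?ltr0n.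
have fin d L : 0 < d ->
    \forall n \near \oo, forall k, (k < L)%N -> cabs (u n k - v k) < d.
  move=> d_gt0; elim: L => [|L IH]; first exact: nearW.
  near=> n => k; rewrite ltnS leq_eqVlt => /orP[/eqP->|].
    by near: n; have /ccvgP := huv L; exact.
  by move: k; near: n; exact: IH.
near=> n; rewrite subr0.
have Kn : (K <= n)%N by near: n; exact: nbhs_infty_ge.
rewrite -(big_mkord xpredT (fun k => u n k - v k)) (big_cat_nat (n := K)) //=.
apply: le_lt_trans (cabsD _ _) _.
have h1 : cabs (\sum_(0 <= k < K) (u n k - v k)) <= e / 4.
  apply: le_trans (cabs_sum _ _ _) _; rewrite big_mkord.
  apply: (@le_trans _ _ (\sum_(k < K) e / (4 * K.+1%:R))).
    apply: ler_sum => k _; apply/ltW.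
    have : forall k, (k < K)%N -> cabs (u n k - v k) < e / (4 * K.+1%:R).
      by near: n; exact: fin.
    exact.
  rewrite sumr_const card_ord -[_ *+ K]mulr_natr.
  have -> : e / (4 * K.+1%:R) * K%:R = e / 4 * (K%:R / K.+1%:R).
    by field; rewrite ?natr1 ?nat1r pnatr_eq0.
  rewrite ler_piMr //; first by rewrite divr_ge0 // ltW.
  by rewrite ler_pdivrMr ?ltr0n // mul1r ler_nat.
have h2 : cabs (\sum_(K <= k < n) (u n k - v k)) <= e / 2.
  apply: le_trans (cabs_sum _ _ _) _.
  apply: (@le_trans _ _ (\sum_(K <= k < n) (M k + M k))).
    rewrite !big_nat; apply: ler_sum => k /andP[_ kn].
    by apply: le_trans (cabsD _ _) _; rewrite cabsN lerD ?hu.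
  have := hK' _ Kn; rewrite big_split /=; lra.
lra.
Unshelve. all: by end_near. Qed.

End ComplexLimits.

(** * Infinite products, by reduction to series *)

Section InfiniteProducts.
Variable R : realType.
Implicit Types (u v : nat -> R[i]) (M : nat -> R) (l : R[i]).

(** Turns a product into a series, so that domination and convergence carry over to infinite
    products. *)
Lemma prod1D_telescope (F : comPzRingType) (u : nat -> F) n :
  \prod_(k < n) (1 + u k) = 1 + \sum_(k < n) u k * \prod_(i < k) (1 + u i).
Proof.
elim: n => [|n IH]; first by rewrite !big_ord0 addr0.
by rewrite big_ord_recr big_ord_recr /= addrA -IH mulrDr mulr1 [u n * _]mulrC.
Qed.

Lemma is_cvg_series_scale (C : R) M : cvgn (series M) -> cvgn (series (fun k => C * M k)).
Proof. exact: is_cvg_seriesZ. Qed.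

Lemma series_le_sup M n : (forall k, 0 <= M k) -> cvgn (series M) ->
  \sum_(k < n) M k <= limn (series M).
Proof.
move=> M0 hM; rewrite -(big_mkord xpredT M).
apply: (nondecreasing_cvgn_le _ hM); apply: nondecreasing_series => *; exact: M0.
Qed.

Lemma cabs_prod1D_le u M n : (forall k, (k < n)%N -> cabs (u k) <= M k) ->
  (forall k, 0 <= M k) -> cvgn (series M) ->
  cabs (\prod_(k < n) (1 + u k)) <= expR (limn (series M)).
Proof.
move=> hu M0 hM; rewrite cabs_prod.
apply: le_trans (_ : expR (\sum_(k < n) M k) <= _); last first.
  by rewrite ler_expR series_le_sup.
rewrite expR_sum; apply: ler_prod => k _; rewrite cabs_ge0 /=.
apply: le_trans (expR_ge1Dx _); apply: le_trans (cabsD _ _) _.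
by rewrite cabs1 lerD2l hu.
Qed.

(** In the telescoped series the k-th term is [u n k] times a partial product, and partial products
    are bounded by [expR] of the total of the majorant; [ccvg_tannery] then applies. *)
Lemma ccvg_prod_tannery (u : nat -> nat -> R[i]) v M l :
  (forall n k, (k < n)%N -> cabs (u n k) <= M k) -> cvgn (series M) ->
  (forall k, ccvg (fun n => u n k) (v k)) ->
  ccvg (fun n => \prod_(k < n) (1 + v k)) l ->
  ccvg (fun n => \prod_(k < n) (1 + u n k)) l.
Proof.
move=> hu hM huv.
have M0 k : 0 <= M k by apply: le_trans (hu k.+1 k _); rewrite ?cabs_ge0.
have -> : l = 1 + (l - 1) by ring.
move=> hl; under eq_fun do rewrite prod1D_telescope.
apply: ccvgD (ccvg_cst _) _.
apply: (@ccvg_tannery _ (fun n k => u n k * \prod_(i < k) (1 + u n i))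
  (fun k => v k * \prod_(i < k) (1 + v i))
  (fun k => expR (limn (series M)) * M k)).
- move=> n k kn; rewrite cabsM mulrC ler_pM ?cabs_ge0 ?hu //.
  by apply: cabs_prod1D_le => // i ik; apply: hu; exact: ltn_trans kn.
- exact: is_cvg_series_scale.
- move=> k; apply: ccvgM => //; apply: ccvg_prod => i.
  by apply: ccvgD => //; exact: ccvg_cst.
- apply: (ccvg_eq (u := fun n => \prod_(k < n) (1 + v k) - 1)).
    by move=> n; rewrite prod1D_telescope addrC addKr.
  have -> : l - 1 = 1 + (l - 1) - 1 by ring.
  exact: ccvgB hl (ccvg_cst _).
Qed.

Lemma ccvg_inf_prod u M : (forall k, cabs (u k) <= M k) -> cvgn (series M) ->
  exists l, ccvg (fun n => \prod_(k < n) (1 + u k)) l.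
Proof.
move=> hu hM.
have M0 k : 0 <= M k by apply: le_trans (hu k); rewrite ?cabs_ge0.
have [k|l hl] := @ccvg_series _ (fun k => u k * \prod_(i < k) (1 + u i))
  (fun k => expR (limn (series M)) * M k) _
  (is_cvg_series_scale hM).
  by rewrite cabsM mulrC ler_pM ?cabs_ge0 ?hu // cabs_prod1D_le.
exists (1 + l); under eq_fun do rewrite prod1D_telescope.
exact: ccvgD (ccvg_cst _) hl.
Qed.

(** A tail product is at least 1 minus the tail of the majorant, hence at least 1/2 from some rank
    on, and the head is a finite product of nonzero factors. *)
Lemma inf_prod_neq0 u M l : (forall k, cabs (u k) <= M k) -> cvgn (series M) ->
  (forall k, 1 + u k != 0) -> ccvg (fun n => \prod_(k < n) (1 + u k)) l -> l != 0.
Proof.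
move=> hu hM u0 hl.
have M0 k : 0 <= M k by apply: le_trans (hu k); rewrite ?cabs_ge0.
have /cvg_ex[/= S hS] := hM.
have [K _ hK] : \forall n \near \oo, `|S - series M n| < 1 / 4.
  by move/cvgrPdist_lt : hS => /(_ (1 / 4)); apply; lra.
have hK' n : (K <= n)%N -> \sum_(K <= k < n) M k <= 1 / 2.
  move=> Kn; have := hK K (leqnn K); have := hK n Kn.
  rewrite -(sub_series_geq M Kn) /= !ltr_norml; lra.
have tail n : (K <= n)%N ->
    1 - \sum_(K <= k < n) M k <= cabs (\prod_(K <= k < n) (1 + u k)).
  elim: n => [|n IH].
    by rewrite leqn0 => /eqP->; rewrite !big_geq // cabs1 subr0.
  rewrite leq_eqVlt => /orP[/eqP<-|]; first by rewrite !big_geq // cabs1 subr0.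
  rewrite ltnS => Kn; have := hK' n.+1 (leqW Kn); have := IH Kn.
  rewrite !big_nat_recr //= cabsM.
  have : 1 - M n <= cabs (1 + u n).
    have := cabsB_ge 1 (- u n); rewrite opprK cabsN cabs1.
    have := hu n; lra.
  have : 0 <= \sum_(K <= k < n) M k by exact: sumr_ge0.
  have := M0 n.
  set s := \sum_(_ <= _ < _) _; set p := cabs _; set a := cabs _; set m := M n.
  move=> m0 s0 h1 h2 h3; have : (1 - m) * (1 - s) <= p * a.
    by apply: ler_pM => //; lra.
  nra.
apply/negP => /eqP l0; rewrite {}l0 in hl.
set c := cabs (\prod_(0 <= k < K) (1 + u k)).
have c0 : 0 < c by rewrite cabs_gt0 prodf_seq_neq0; apply/allP => k _; exact: u0.
move/ccvgP : hl => /(_ (c / 2)) []; first by rewrite divr_gt0.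
move=> N _ /(_ (maxn K N) (leq_maxr _ _)) /=.
rewrite subr0 -(big_mkord xpredT (fun k => 1 + u k)).
rewrite (big_cat_nat (n := K)) ?leq_maxl //= cabsM -/c.
have := tail _ (leq_maxl K N); have := hK' _ (leq_maxl K N).
set s := \sum_(_ <= _ < _) _; set a := cabs _ => h1 h2.
rewrite mulrC ltr_pdivlMr // => h3; nra.
Qed.

Lemma cvg_series_inv_sqr : cvgn (series (fun k => (k.+1%:R ^+ 2)^-1 : R)).
Proof.
apply: nondecreasing_is_cvgn.
  by apply: nondecreasing_series => n _ _; rewrite invr_ge0 exprn_ge0.
exists 2 => _ [n _ <-]; rewrite /series /=.
(* The induction step for this bound asks for [1 / a ^ 2 <= 2 / (a * (a + 1))] with [a = n + 1],
   that is [1 <= a]. *)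
suff : \sum_(0 <= k < n) (k.+1%:R ^+ 2)^-1 <= 2 - 2 / n.+1%:R :> R.
  by move=> /le_trans; apply; rewrite gerBl divr_ge0.
elim: n => [|n IH]; first by rewrite big_geq // divr1 subrr.
rewrite big_nat_recr //=; apply: le_trans (lerD IH (lexx _)) _.
rewrite -[n.+2%:R]natr1; set a : R := n.+1%:R.
have a1 : 1 <= a by rewrite ler1n.
rewrite -subr_ge0 [leRHS](_ : _ = (a - 1) / (a ^+ 2 * (a + 1))).
  by rewrite divr_ge0 ?mulr_ge0 ?sqr_ge0 //; lra.
by field; apply/andP; split; rewrite gt_eqF //; lra.
Qed.

End InfiniteProducts.

(** * Passage to the limits used in the definitions *)

Section Bridge.
Variable R : realType.

Lemma ccvg_cvg (u : nat -> R[i]) (l : R[i]) : ccvg u l ->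
  (u : nat -> R[i]^o) @ \oo --> (l : R[i]^o).
Proof.
move=> /ccvgP h.
apply/(@cvgrPdist_lt R[i] R[i]^o) => e; rewrite ltcE /= => /andP[/eqP ei er].
have {}h := h _ er.
apply: filterS h => n /= h.
rewrite -normrN opprB cabsE ltcE /= ei eqxx /=.
exact: h.
Qed.

Definition climit (u : nat -> R[i]) : R[i] := lim ((u : nat -> R[i]^o) @ \oo).

Lemma ccvg_climit (u : nat -> R[i]) (l : R[i]) : ccvg u l -> climit u = l.
Proof. by move=> /ccvg_cvg h; rewrite /climit; exact: (cvg_lim (@norm_hausdorff _ _) h). Qed.

Lemma climitP (u : nat -> R[i]) : (exists l, ccvg u l) -> ccvg u (climit u).
Proof. by move=> [l hl]; rewrite (ccvg_climit hl). Qed.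

End Bridge.

(** * The complex exponential *)

Section ComplexExponential.
Variable R : realType.
Implicit Types (z w : R[i]).

Lemma cexpD z w : cexp (z + w) = cexp z * cexp w.
Proof.
case: z w => [a b] [c d]; rewrite /cexp /= expRD cosD sinD.
by apply/eqP; rewrite eq_complex /=; apply/andP; split; apply/eqP; ring.
Qed.

Lemma cexp0 : cexp 0 = 1 :> R[i].
Proof. by rewrite /cexp /= expR0 cos0 sin0 mul1r. Qed.

Lemma cexp_neq0 z : cexp z != 0.
Proof.
apply/eqP => h; have := cexp0; rewrite -(subrr z) cexpD h mul0r => /esym/eqP.
by rewrite oner_eq0.
Qed.

Lemma cexpN z : cexp (- z) = (cexp z)^-1.
Proof.
by apply: (mulfI (cexp_neq0 z)); rewrite -cexpD subrr cexp0 divff // cexp_neq0.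
Qed.

Lemma cexpB z w : cexp (z - w) = cexp z / cexp w.
Proof. by rewrite cexpD cexpN. Qed.

Lemma cexpMn z n : cexp (z * n%:R) = cexp z ^+ n.
Proof.
elim: n => [|n IH]; first by rewrite mulr0 cexp0 expr0.
by rewrite -natr1 mulrDr mulr1 cexpD IH exprSr.
Qed.

Lemma cexpMz z (n : int) : cexp (z * n%:~R) = cexp z ^ n.
Proof.
case: n => n; first by rewrite -exprnP -cexpMn.
by rewrite NegzE mulrNz mulrN cexpN -exprnN -cexpMn.
Qed.

Lemma cexp_sum I (r : seq I) (P : pred I) (F : I -> R[i]) :
  cexp (\sum_(i <- r | P i) F i) = \prod_(i <- r | P i) cexp (F i).
Proof. exact: (big_morph _ cexpD cexp0). Qed.

Lemma cabs_cexp z : cabs (cexp z) = expR (complex.Re z).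
Proof.
rewrite /cexp cabsM cabs_real ger0_norm ?expR_ge0 //.
by rewrite /cabs /= cos2Dsin2 sqrtr1 mulr1.
Qed.

Lemma cexp_real (a : R) : cexp a%:C = (expR a)%:C.
Proof. by rewrite /cexp /= cos0 sin0 mulr1. Qed.

Lemma cexp_i (a : R) : cexp ('i * a%:C) = Complex (cos a) (sin a).
Proof.
have -> : 'i * a%:C = Complex 0 a.
  by apply/eqP; rewrite eq_complex /=; apply/andP; split; apply/eqP; ring.
by rewrite /cexp /= expR0 mul1r.
Qed.

Lemma cexp_ipi : cexp ('i * pi%:C) = -1 :> R[i].
Proof.
by rewrite cexp_i cospi sinpi; apply/eqP; rewrite eq_complex /= oppr0 !eqxx.
Qed.

Lemma cexp_2ipi : cexp (2 * ('i * pi%:C)) = 1 :> R[i].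
Proof. by rewrite mulrC cexpMn cexp_ipi sqrrN expr1n. Qed.

Lemma cexp_2ipiMz (n : int) : cexp (2 * ('i * pi%:C) * n%:~R) = 1 :> R[i].
Proof. by rewrite cexpMz cexp_2ipi exp1rz. Qed.

Lemma sin_gt0_eq0 (a : R) : 0 <= a < pi -> sin a = 0 -> a = 0.
Proof.
move=> /andP[a0 api] sa; apply/eqP; rewrite eq_le a0 andbT leNgt; apply/negP => h.
by have := @sin_gt0_pi R a; rewrite h api sa ltxx => /(_ isT).
Qed.

(** After reduction modulo 2 pi, [cos b = 1] forces [sin (b / 2) = 0] by the duplication formula,
    and [b / 2] lies in [[0, pi)], where the sine vanishes only at 0. *)
Lemma cexp_i_eq1 (a : R) : cexp ('i * a%:C) = 1 -> exists n : int, a = 2 * pi * n%:~R.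
Proof.
have pi0 : 0 < 2 * pi :> R by rewrite mulr_gt0 ?pi_gt0.
move=> h; pose n := Num.floor (a / (2 * pi)); exists n.
pose b := a - 2 * pi * n%:~R.
have hb : 0 <= b < 2 * pi.
  have := floor_le_tmp (a / (2 * pi)); have := floorD1_gt (a / (2 * pi)).
  rewrite -/n intrD ltr_pdivrMr // ler_pdivlMr // /b; nra.
have cb : cexp ('i * b%:C) = 1.
  rewrite /b rmorphB /= mulrBr cexpB h.
  have -> : 'i * (2 * pi * n%:~R)%:C = 2 * ('i * pi%:C) * n%:~R :> R[i].
    by rewrite !rmorphM /= rmorph_int rmorph_nat; ring.
  by rewrite cexp_2ipiMz divr1.
have : sin (b / 2) = 0.
  move: cb; rewrite cexp_i => /eqP; rewrite eq_complex /= => /andP[/eqP cb _].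
  have : cos (b / 2 *+ 2) = 1 by rewrite -mulr_natr divfK.
  rewrite cos_mulr2n cos2sin2 => h1; apply/eqP; rewrite -sqrf_eq0; apply/eqP; lra.
move/sin_gt0_eq0 => hb0; have : b / 2 = 0 by apply: hb0; lra.
rewrite /b; lra.
Qed.

Lemma sin_MVT (x : R) : 0 <= x -> exists2 c, 0 <= c <= x & sin x = cos c * x.
Proof.
rewrite le_eqVlt => /orP[/eqP<-|x0]; first by exists 0; rewrite ?lexx // sin0 mulr0.
have [c] := @MVT R sin cos 0 x x0 (fun y _ => is_derive_sin y)
  (continuous_subspaceT (@continuous_sin R)).
rewrite in_itv /= sin0 !subr0 => /andP[h1 h2] ->; exists c => //.
by rewrite !ltW.
Qed.

Lemma normr_sin_le (x : R) : `|sin x| <= `|x|.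
Proof.
wlog x0 : x / 0 <= x => [h|].
  by case: (leP 0 x) => [/h//|x0]; have := h (- x); rewrite sinN !normrN; apply; lra.
have [c _ ->] := sin_MVT x0; rewrite normrM ler_piMl //; exact: cos_max.
Qed.

Lemma one_sub_cos_le (x : R) : 0 <= 1 - cos x <= x ^+ 2 / 2.
Proof.
rewrite subr_ge0 cos_le1 /=.
have {1}-> : x = x / 2 *+ 2 by rewrite -mulr_natr divfK.
rewrite cos_mulr2n cos2sin2.
have := normr_sin_le (x / 2); rewrite -(@ler_pXn2r _ 2) ?nnegrE // !real_normK ?num_real //.
rewrite expr_div_n; lra.
Qed.

Lemma sin_sub_le (x : R) : `|x| <= 1 -> `|sin x - x| <= x ^+ 2.
Proof.
wlog x0 : x / 0 <= x => [h|].
  case: (leP 0 x) => [/h//|x0] x1; have := h (- x).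
  by rewrite sinN normrN sqrrN -opprD normrN; apply=> //; lra.
rewrite ger0_norm // => x1; have [c /andP[c0 cx] ->] := sin_MVT x0.
have /andP[h1 h2] := one_sub_cos_le c.
rewrite -normrN ger0_norm; first nra.
nra.
Qed.

(** A weak Jordan inequality, enough to dominate the finite sine products: duplication and the mean
    value theorem write [sin x] as [x * cos c * cos (x / 2)], with both angles at most pi/4. *)
Lemma sin_ge_half (x : R) : 0 <= x <= pi / 2 -> x / 2 <= sin x.
Proof.
move=> /andP[x0 xpi]; have x20 : 0 <= x / 2 by lra.
have cosge y : 0 <= y <= x / 2 -> 1 / 2 <= cos y ^+ 2 /\ 0 <= cos y.
  move=> /andP[y0 yx]; have h1 : 0 <= cos (y *+ 2).
    apply: cos_ge0_pihalf; rewrite -mulr_natr; lra.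
  have h2 : 0 <= cos y by apply: cos_ge0_pihalf; lra.
  by move: h1; rewrite cos_mulr2n; lra.
have {2}-> : x = x / 2 *+ 2 by rewrite -mulr_natr divfK.
rewrite sin_mulr2n.
have [c /andP[c0 cx] ->] := sin_MVT x20.
have [h1 h2] := cosge c (introT andP (conj c0 cx)).
have [|h3 h4] := cosge (x / 2); first by rewrite x20 lexx.
have : 1 / 2 <= cos c * cos (x / 2).
  rewrite -(@ler_pXn2r _ 2) ?nnegrE ?mulr_ge0 ?divr_ge0 // exprMn.
  have : 1 / 2 * (1 / 2) <= cos c ^+ 2 * cos (x / 2) ^+ 2 by apply: ler_pM => //; lra.
  lra.
rewrite -mulr_natr; nra.
Qed.

(** Both bounds come from [1 + x <= expR x], the upper one after replacing [x] by [- x] and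
    inverting. *)
Lemma expR_sub_le (x : R) : `|x| <= 1 / 2 -> 0 <= expR x - 1 - x <= 2 * x ^+ 2.
Proof.
rewrite ler_norml => /andP[h1 h2]; have := expR_ge1Dx x; have := expR_ge1Dx (- x).
rewrite expRN; set e := expR x => h3 h4.
have e0 : 0 < e by exact: expR_gt0.
have : (1 - x) * e <= 1 by rewrite -ler_pdivlMr // div1r.
move=> h5; apply/andP; split; first lra.
nra.
Qed.

Lemma sqr_le_norm (x c : R) : `|x| <= c -> x ^+ 2 <= c ^+ 2.
Proof.
move=> h; rewrite -[x ^+ 2]real_normK ?num_real //.
by apply: lerXn2r; rewrite ?nnegrE // (le_trans _ h).
Qed.

Lemma cexp_sub_le_small z : cabs z <= 1 / 2 -> cabs (cexp z - 1 - z) <= 6 * cabs z ^+ 2.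
Proof.
case: z => x y; set z := Complex x y => hz.
have hx : `|x| <= cabs z := cabs_ge_Re z.
have hy : `|y| <= cabs z := cabs_ge_Im z.
apply: le_trans (cabs_le_ReIm _) _; rewrite /= oppr0 addr0 mul0r !subr0 mul0r addr0.
have /andP[e1 e2] := expR_sub_le (le_trans hx hz).
have /andP[c1 c2] := one_sub_cos_le y.
have s1 := normr_sin_le y; have s2 : `|sin y - y| <= y ^+ 2 by apply: sin_sub_le; lra.
have xx : x ^+ 2 <= cabs z ^+ 2 by exact: sqr_le_norm.
have yy : y ^+ 2 <= cabs z ^+ 2 by exact: sqr_le_norm.
have hE : `|expR x - 1| <= 2 * `|x|.
  have -> : expR x - 1 = (expR x - 1 - x) + x by ring.
  apply: le_trans (ler_normD _ _) _; rewrite ger0_norm //.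
  have := real_normK (num_real x); have := normr_ge0 x; nra.
have hE2 : 0 <= expR x <= 2.
  by have := ler_norm (expR x - 1); have := expR_ge0 x; lra.
have hr : `|expR x * cos y - 1 - x| <= 3 * cabs z ^+ 2.
  have -> : expR x * cos y - 1 - x = (expR x - 1 - x) - expR x * (1 - cos y) by ring.
  apply: le_trans (ler_normB _ _) _; rewrite !ger0_norm ?mulr_ge0 ?expR_ge0 //.
  have := ler_pM (expR_ge0 x) c1 (proj2 (andP hE2)) c2; nra.
have hi : `|expR x * sin y - y| <= 3 * cabs z ^+ 2.
  have -> : expR x * sin y - y = (expR x - 1) * sin y + (sin y - y) by ring.
  apply: le_trans (ler_normD _ _) _; rewrite normrM.
  have : `|expR x - 1| * `|sin y| <= 2 * `|x| * `|y| by exact: ler_pM.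
  have := normr_ge0 x; have := normr_ge0 y; nra.
apply: le_trans (lerD hr hi) _; rewrite -mulrDl ler_wpM2r ?sqr_ge0 //; lra.
Qed.

(** For small [z] this is the quadratic Taylor estimate. Beyond modulus 1/2 the left side is bounded
    by a constant depending on [W], and [cabs z ^+ 2 >= 1/4] accounts for the factor 4. *)
Lemma cexp_sub_le (W : R) : exists2 C, 0 < C &
  forall z, cabs z <= W -> cabs (cexp z - 1 - z) <= C * cabs z ^+ 2.
Proof.
exists (6 + 4 * (expR `|W| + 1 + `|W|)) => [|z zW].
  by have := expR_ge0 `|W|; have := normr_ge0 W; lra.
have E0 := expR_ge0 `|W|; have W0 := normr_ge0 W; have z0 := cabs_ge0 z.
have zW' := le_trans zW (ler_norm W).
case: (leP (cabs z) (1 / 2)) => hz.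
  apply: le_trans (cexp_sub_le_small hz) _; rewrite ler_wpM2r ?sqr_ge0 //; lra.
apply: (@le_trans _ _ (expR `|W| + 1 + `|W|)).
  apply: le_trans (cabsD _ _) _; rewrite cabsN; apply: lerD => //.
  apply: le_trans (cabsD _ _) _; rewrite cabsN cabs1 lerD2r cabs_cexp ler_expR.
  by apply: le_trans zW'; apply: le_trans (cabs_ge_Re z); exact: ler_norm.
set K := expR `|W| + 1 + `|W|; have K0 : 0 <= K by rewrite /K; lra.
have c4 : 1 / 4 <= cabs z ^+ 2 by nra.
apply: le_trans (_ : 4 * K * (1 / 4) <= _); first by lra.
by apply: ler_pM => //; lra.
Qed.

End ComplexExponential.

(** * Euler's product for the sine *)

Section SineProduct.
Variable R : realType.
Implicit Types (a u z w : R[i]).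

Lemma ccvg_inv_odd (c : R[i]) : ccvg (fun N => c / N.*2.+1%:R) 0.
Proof.
apply: (@ccvg_majorant _ (fun N => cabs c * N.+1%:R^-1)) => [N|].
  rewrite subr0 cabsM cabsV cabs_nat ler_wpM2l ?cabs_ge0 //.
  by rewrite lef_pV2 ?posrE ?ltr0n // ler_nat ltnS -addnn leq_addr.
by rewrite -(mulr0 (cabs c)); apply: cvgMr; exact: cvg_harmonic.
Qed.

Lemma ccvg_cexp_sub1 a :
  ccvg (fun N => N.*2.+1%:R * (cexp (a / N.*2.+1%:R) - 1)) a.
Proof.
have [C C0 hC] := cexp_sub_le (cabs a).
apply: (@ccvg_majorant _ (fun N => C * cabs a ^+ 2 * N.+1%:R^-1)) => [N|]; last first.
  by rewrite -(mulr0 (C * cabs a ^+ 2)); apply: cvgMr; exact: cvg_harmonic.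
set n := N.*2.+1; have n0 : (n%:R : R[i]) != 0 by rewrite pnatr_eq0.
have n0' : (0 : R) < n%:R by rewrite ltr0n.
have -> : n%:R * (cexp (a / n%:R) - 1) - a = n%:R * (cexp (a / n%:R) - 1 - a / n%:R).
  by field.
have := hC (a / n%:R); rewrite !cabsM cabsV cabs_nat exprMn exprVn => h.
apply: le_trans (ler_wpM2l _ (h _)) _; first exact: ltW.
  by rewrite ler_piMr ?cabs_ge0 // invf_le1 // ler1n.
have -> : n%:R * (C * (cabs a ^+ 2 / n%:R ^+ 2)) = C * cabs a ^+ 2 * n%:R^-1.
  by field; exact: lt0r_neq0.
apply: ler_wpM2l; first by rewrite mulr_ge0 ?sqr_ge0 // ltW.
by rewrite lef_pV2 ?posrE ?ltr0n // ler_nat ltnS -addnn leq_addr.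
Qed.

Lemma ccvg_cexp_inv_odd a : ccvg (fun N => cexp (a / N.*2.+1%:R)) 1.
Proof.
have h := ccvgM (ccvg_inv_odd 1) (ccvg_cexp_sub1 a).
rewrite [X in ccvg _ X](_ : 1 = 0 * a + 1); last by ring.
apply: (ccvg_eq _ (ccvgD h (ccvg_cst 1))) => N.
have n0 : (N.*2.+1%:R : R[i]) != 0 by rewrite pnatr_eq0.
by rewrite /= mulrA divfK // mul1r subrK.
Qed.

Lemma cexp_primitive_root n : (0 < n)%N ->
  n.-primitive_root (cexp (2 * ('i * pi%:C) / n%:R) : R[i]).
Proof.
move=> n0; have n0' : (n%:R : R[i]) != 0 by rewrite pnatr_eq0 -lt0n.
rewrite /primitive_root_of_unity n0 /=; apply/forallP => i; apply/eqP.
rewrite unity_rootE -cexpMn; apply/eqP/eqP => [h|->]; last first.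
  by rewrite divfK // cexp_2ipi.
have : cexp ('i * (2 * pi * (i.+1%:R / n%:R))%:C) = 1 :> R[i].
  rewrite -h; congr cexp; rewrite !rmorphM /= fmorphV !rmorph_nat; ring.
move=> /cexp_i_eq1 [k] /(mulfI (lt0r_neq0 _)).
rewrite mulr_gt0 ?pi_gt0 // => /(_ isT) hk.
have nR : (0 : R) < n%:R by rewrite ltr0n.
have : i.+1%:R = k%:~R * n%:R :> R by rewrite -hk divfK // lt0r_neq0.
rewrite !pmulrn -intrM => /eqP; rewrite eqr_int => /eqP.
have il := ltn_ord i; case: k {hk} => [[|[|k]]|k] hk; nia.
Qed.

Lemma prod_reflect (F : comPzRingType) (g : nat -> F) N :
  \prod_(1 <= i < N.*2.+1) g i = \prod_(k < N) (g k.+1 * g (N.*2.+1 - k.+1)%N).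
Proof.
rewrite big_split /= -addnn big_add1 /= (big_cat_nat (n := N)) ?leq_addr //=.
rewrite big_mkord; congr (_ * _).
rewrite -[X in \prod_(X <= _ < _) _]add0n big_addn addnK big_mkord (reindex_inj rev_ord_inj) /=.
apply: eq_bigr => k _; congr g; have := ltn_ord k; lia.
Qed.

(* Factorization of [w ^ n - 1] over the [n]-th roots of unity, each root being
   paired with its inverse. *)
Lemma sine_product_finite (N : nat) (w : R[i]) (n := N.*2.+1)
    (zeta := cexp (2 * ('i * pi%:C) / n%:R) : R[i])
    (D := fun k : nat => (1 - zeta ^+ k.+1) * (1 - zeta ^- k.+1)) : w != 0 ->
  (forall k, (k < N)%N -> D k != 0) ->
  w ^+ n - 1 = n%:R * (w - 1) * w ^+ N
               * \prod_(k < N) (1 + ((w - 1) * (1 - w^-1)) / D k).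
Proof.
move=> w0 D0.
have zp : n.-primitive_root zeta by exact: cexp_primitive_root.
have z0 : zeta != 0 by exact: cexp_neq0.
have zn k : (k < N)%N -> zeta ^+ (n - k.+1) = zeta ^- k.+1.
  move=> kN; apply: (mulIf (expf_neq0 k.+1 z0)).
  rewrite mulVf ?expf_neq0 // -exprD subnK ?(prim_expr_order zp) //; rewrite /n; lia.
have E : \prod_(1 <= i < n) ('X - (zeta ^+ i)%:P) = \sum_(i < n) 'X^i :> {poly R[i]}.
  have X1 : 'X - 1 != 0 :> {poly R[i]} by rewrite -[1]/(1%:P) polyXsubC_eq0.
  apply: (mulfI X1); rewrite -subrX1 -(factor_Xn_sub_1 zp) [RHS]big_ltn //.
have H x : \prod_(1 <= i < n) (x - zeta ^+ i) = \sum_(i < n) x ^+ i.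
  have := congr1 (fun p => p.[x]) E.
  rewrite horner_prod horner_sum.
  under eq_bigr do rewrite hornerXsubC; move=> ->.
  by apply: eq_bigr => i _; rewrite hornerXn.
(* At 1 the factorization evaluates the product of the [D k] to [n], which is where the factor [n]
   of the statement comes from. *)
have := H 1; rewrite prod_reflect => H1.
have PD : \prod_(k < N) D k = n%:R.
  rewrite (eq_bigr (fun k : 'I_N => (1 - zeta ^+ k.+1) * (1 - zeta ^+ (N.*2.+1 - k.+1)))).
    by rewrite H1; under eq_bigr do rewrite expr1n; rewrite sumr_const card_ord.
  by move=> k _; rewrite /D -zn.
rewrite subrX1 -H prod_reflect.
rewrite (eq_bigr (fun k : 'I_N => w * D k * (1 + ((w - 1) * (1 - w^-1)) / D k))).
  by rewrite big_split big_split prodr_const card_ord PD /=; ring.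
move=> k _; rewrite -/n zn //.
have [d Dk d0] : exists2 d, D k = d & d != 0 by exists (D k); rewrite // D0.
have -> : w * D k * (1 + (w - 1) * (1 - w^-1) / D k) = w * (D k + (w - 1) * (1 - w^-1)).
  by rewrite Dk; field; rewrite d0 w0.
rewrite /D {d Dk d0}.
have zk0 : zeta ^+ k.+1 != 0 by rewrite expf_neq0.
by field; rewrite w0 zk0.
Qed.

(** This is sin(pi z) / pi, normalized to have derivative 1 at 0. *)
Definition sinpi z : R[i] :=
  (cexp ('i * pi%:C * z) - cexp (- ('i * pi%:C * z))) / (2 * ('i * pi%:C)).

Lemma ipi_neq0 : 'i * pi%:C != 0 :> R[i].
Proof.
rewrite -cabs_gt0 cabsM cabs_real mulr_gt0 ?normr_gt0 ?gt_eqF ?pi_gt0 //.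
by rewrite /cabs /= expr0n expr1n add0r sqrtr1.
Qed.

(** In [sine_product_finite] take [w = exp(2 pi i u / n)] with [n = 2 N + 1]. Multiplied by [n ^ 2],
    numerators and denominators of the factors tend to [(2 pi i u) ^ 2] and [4 pi ^ 2 (k + 1) ^ 2],
    and [sin_ge_half] gives a majorant in [1 / (k + 1) ^ 2]. *)
Lemma sine_product u :
  ccvg (fun N => u * \prod_(k < N) (1 - u ^+ 2 / k.+1%:R ^+ 2)) (sinpi u).
Proof.
pose I : R[i] := 2 * ('i * pi%:C).
have I0 : I != 0 by rewrite mulf_neq0 ?pnatr_eq0 // ipi_neq0.
pose n N := N.*2.+1.
have n0 N : (n N)%:R != 0 :> R[i] by rewrite pnatr_eq0.
pose w N := cexp (I * u / (n N)%:R).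
pose D N k := (1 - cexp (I / (n N)%:R) ^+ k.+1) * (1 - cexp (I / (n N)%:R) ^- k.+1).
pose v N := (w N - 1) * (1 - (w N)^-1).
pose t N k := v N / D N k.
have w0 N : w N != 0 by exact: cexp_neq0.
have DE N k : D N k = (2 * (1 - cos (2 * pi * k.+1%:R / (n N)%:R)))%:C.
  rewrite /D -cexpMn -cexpN.
  have -> : I / (n N)%:R * k.+1%:R = 'i * (2 * pi * k.+1%:R / (n N)%:R)%:C.
    by rewrite /I !rmorphM /= fmorphV !rmorph_nat; ring.
  set x := 2 * pi * _ / _; have -> : - ('i * x%:C) = 'i * (- x)%:C by rewrite rmorphN mulrN.
  rewrite !cexp_i cosN sinN.
  by apply/eqP; rewrite eq_complex /=; have := cos2Dsin2 x => h; apply/andP; split;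
    apply/eqP; lra.
(* [D N k] is [4 sin^2(pi (k + 1) / n)], with an angle at most pi/2 because [k < N]. *)
have Dge N k : (k < N)%N -> k.+1%:R ^+ 2 <= (n N)%:R ^+ 2 * cabs (D N k).
  move=> kN; have nR : (0 : R) < (n N)%:R by rewrite ltr0n.
  pose y := pi * k.+1%:R / (n N)%:R : R.
  have y0 : 0 <= y by rewrite divr_ge0 ?mulr_ge0 ?pi_ge0.
  have y2 : y <= pi / 2.
    rewrite /y -mulrA ler_wpM2l ?pi_ge0 // ler_pdivrMr // mulrC ler_pdivlMr ?ltr0n //.
    by rewrite -natrM ler_nat /n; lia.
  have := sin_ge_half (introT andP (conj y0 y2)) => sy.
  have sy0 : 0 <= sin y by lra.
  rewrite DE cabs_real.
  have -> : 2 * pi * k.+1%:R / (n N)%:R = y *+ 2 by rewrite /y -mulr_natr; ring.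
  rewrite cos_mulr2n cos2sin2.
  have -> : 2 * (1 - ((1 - sin y ^+ 2) *+ 2 - 1)) = 4 * sin y ^+ 2 by ring.
  rewrite ger0_norm ?mulr_ge0 ?sqr_ge0 //.
  have ny : (n N)%:R * y = pi * k.+1%:R by rewrite /y mulrC divfK // gt_eqF.
  have h : k.+1%:R <= (n N)%:R * (2 * sin y).
    apply: le_trans (_ : (n N)%:R * y <= _); last by apply: ler_wpM2l; [exact: ltW|lra].
    by rewrite ny ler_peMl //; have := @pi_ge2 R; lra.
  rewrite [leRHS](_ : _ = ((n N)%:R * (2 * sin y)) ^+ 2); last by ring.
  by apply: lerXn2r; rewrite ?nnegrE // (le_trans _ h).
have D0 N k : (k < N)%N -> D N k != 0.
  move=> kN; rewrite -cabs_gt0; have := Dge N k kN.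
  have : 0 < k.+1%:R ^+ 2 :> R by rewrite exprn_gt0 ?ltr0n.
  have := cabs_ge0 (D N k); rewrite [in X in X -> _]le_eqVlt => /orP[/eqP<-|//].
  by rewrite mulr0; lra.
have cvgW : ccvg (fun N => (n N)%:R * (w N - 1)) (I * u).
  exact: ccvg_cexp_sub1.
have cvgV : ccvg (fun N => (n N)%:R * ((w N)^-1 - 1)) (- (I * u)).
  apply: (ccvg_eq _ (ccvg_cexp_sub1 (- (I * u)))) => N.
  by rewrite /w mulNr cexpN.
have cvgv : ccvg (fun N => (n N)%:R ^+ 2 * v N) ((I * u) ^+ 2).
  have -> : (I * u) ^+ 2 = - (I * u * - (I * u)) by ring.
  by apply: (ccvg_eq _ (ccvgN (ccvgM cvgW cvgV))) => N; rewrite /v; ring.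
have cvgD k : ccvg (fun N => (n N)%:R ^+ 2 * D N k) (- (I * k.+1%:R) ^+ 2).
  have h := ccvg_cexp_sub1 (I * k.+1%:R); have h' := ccvg_cexp_sub1 (- (I * k.+1%:R)).
  have -> : - (I * k.+1%:R) ^+ 2 = I * k.+1%:R * - (I * k.+1%:R) by ring.
  apply: (ccvg_eq _ (ccvgM h h')) => N.
  rewrite /D -cexpMn mulNr cexpN [I * _ / _]mulrAC -/(n N).
  by set e := cexp _; set q := (n N)%:R; ring.
have cvgt k : ccvg (t^~ k) (- (u ^+ 2 / k.+1%:R ^+ 2)).
  have k0 : k.+1%:R != 0 :> R[i] by rewrite pnatr_eq0.
  have Ik : - (I * k.+1%:R) ^+ 2 != 0 by rewrite oppr_eq0 expf_neq0 // mulf_neq0.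
  have -> : - (u ^+ 2 / k.+1%:R ^+ 2) = (I * u) ^+ 2 * (- (I * k.+1%:R) ^+ 2)^-1.
    by field; rewrite ?I0 ?nat1r ?natr1 ?k0.
  apply: (ccvg_eq _ (ccvgM cvgv (ccvgV (cvgD k) Ik))) => N.
  by rewrite /t invfM mulrACA divff ?mul1r // expf_neq0.
have [K K0 hK] := ccvg_bounded cvgv.
have scale (q x y : R[i]) : q != 0 -> q * x / (q * y) = x / y.
  by move=> q0; rewrite -mulf_div divff // mul1r.
have tM N k : (k < N)%N -> cabs (t N k) <= K * (k.+1%:R ^+ 2)^-1.
  move=> kN; have -> : t N k = ((n N)%:R ^+ 2 * v N) / ((n N)%:R ^+ 2 * D N k).
    by rewrite scale ?expf_neq0.
  rewrite cabsM cabsV; apply: ler_pM => //; rewrite ?invr_ge0 ?cabs_ge0 //.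
  rewrite lef_pV2 ?posrE ?exprn_gt0 ?ltr0n //.
    by rewrite cabsM cabsX cabs_nat Dge.
  by rewrite cabs_gt0 mulf_neq0 ?expf_neq0 // D0.
have sM : cvgn (series (fun k => K * (k.+1%:R ^+ 2)^-1 : R)).
  by apply: is_cvg_series_scale; exact: cvg_series_inv_sqr.
have [||l hl] := @ccvg_inf_prod _ (fun k => - (u ^+ 2 / k.+1%:R ^+ 2))
  (fun k => cabs u ^+ 2 * (k.+1%:R ^+ 2)^-1).
- by move=> k; rewrite cabsN cabsM cabsV !cabsX cabs_nat.
- by apply: is_cvg_series_scale; exact: cvg_series_inv_sqr.
have hl' := ccvg_prod_tannery tM sM cvgt hl.
suff -> : sinpi u = u * l by apply: ccvgZ.
(* [w N ^+ N] has exponent [2 pi i u N / (2 N + 1)], which tends to [i pi u]. *)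
have cvgN : ccvg (fun N => w N ^+ N) (cexp (I / 2 * u)).
  have h := ccvgZ (cexp (I / 2 * u)) (ccvg_cexp_inv_odd (- (I / 2 * u))).
  rewrite mulr1 in h; apply: (ccvg_eq _ h) => N; rewrite -cexpD /w -cexpMn.
  congr cexp; have := n0 N; rewrite /n -addnn -natr1 natrD => h0.
  by field; rewrite ?h0.
have h := ccvgM (ccvgM cvgW cvgN) hl'.
have E : I * u * cexp (I / 2 * u) * l = cexp (I * u) - 1.
  apply: ccvg_unique h (ccvg_eq _ (ccvg_cst _)) => N.
  rewrite -(sine_product_finite (w0 N)) => [|k kN]; last exact: D0.
  by rewrite /w -cexpMn mulrC mulrA mulfVK // mulrC.
have I2 : I / 2 = 'i * pi%:C by rewrite /I mulrC mulKf // pnatr_eq0.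
have e0 := cexp_neq0 ('i * pi%:C * u).
rewrite /sinpi -/I cexpN; apply: (mulfI e0); apply: (mulfI I0).
rewrite [RHS](_ : _ = I * u * cexp (I / 2 * u) * l); last by rewrite I2; ring.
rewrite E -[in cexp (I * u)](divfK (_ : 2 != 0) I) ?pnatr_eq0 // I2.
rewrite [_ * 2 * u]mulrAC cexpMn; field.
by rewrite e0 I0.
Qed.

End SineProduct.

(** * Partial fractions and theta functions *)

Section PartialFractions.
Variable F : fieldType.

Lemma size_sub_monic (p r : {poly F}) n : p \is monic -> r \is monic ->
  size p = n.+1 -> size r = n.+1 -> (size (p - r)%R <= n)%N.
Proof.
move=> /monicP lp /monicP lr sp sr; apply/leq_sizeP => i.
rewrite leq_eqVlt => /orP[/eqP<-|ni]; rewrite coefB.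
  by move: lp lr; rewrite !lead_coefE sp sr /= => -> ->; rewrite subrr.
by rewrite !nth_default ?subrr // ?sp ?sr.
Qed.

(** Clearing denominators leaves a polynomial of degree below [n], since the leading terms of the
    two monic products cancel; it vanishes at the [n] distinct nodes [b k], hence is 0. *)
Lemma partial_fractions n (b c : 'I_n -> F) (y : F) :
  injective b -> (forall i, y != b i) ->
  \prod_i ((y - c i) / (y - b i)) =
  1 + \sum_k (\prod_i (b k - c i)) / (\prod_(i | i != k) (b k - b i)) / (y - b k).
Proof.
move=> binj yb.
pose r k := (\prod_i (b k - c i)) / (\prod_(i | i != k) (b k - b i)).
pose mon (d : 'I_n -> F) : {poly F} := \prod_i ('X - (d i)%:P).
pose L k : {poly F} := \prod_(i | i != k) ('X - (b i)%:P).
pose P := mon c - mon b - \sum_k r k *: L k.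
have sm d : size (mon d) = n.+1.
  by rewrite /mon -big_enum /= size_prod_XsubC size_enum_ord.
have sL k : (size (L k) <= n)%N.
  have Lm : L k \is monic by rewrite /L monic_prod_XsubC.
  have := sm b; rewrite /mon (bigD1 k) //= -/(L k) size_monicM ?monicXsubC ?monic_neq0 //.
  by rewrite size_XsubC => -[<-]; rewrite add0n.
have sP : (size P <= n)%N.
  rewrite /P (leq_trans (size_polyD _ _)) // geq_max; apply/andP; split.
    by apply: size_sub_monic; rewrite ?sm //; apply: monic_prod_XsubC.
  rewrite size_polyN (leq_trans (size_sum _ _ _)) //; apply/bigmax_leqP => k _.
  exact: leq_trans (size_scale_leq _ _) (sL k).
have hmon d x : (mon d).[x] = \prod_i (x - d i).
  by rewrite horner_prod; apply: eq_bigr => i _; rewrite hornerXsubC.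
have hL k x : (L k).[x] = \prod_(i | i != k) (x - b i).
  by rewrite horner_prod; apply: eq_bigr => i _; rewrite hornerXsubC.
have Lk0 k : \prod_(i | i != k) (b k - b i) != 0.
  apply/prodf_neq0 => i ik; rewrite subr_eq0; apply: contra ik => /eqP/binj->.
  by rewrite eqxx.
have hP x : P.[x] = \prod_i (x - c i) - \prod_i (x - b i)
    - \sum_k r k * \prod_(i | i != k) (x - b i).
  rewrite /P !hornerE !hmon horner_sum; congr (_ - _); apply: eq_bigr => k _.
  by rewrite hornerZ hL.
have P0 : P = 0.
  apply: (@roots_geq_poly_eq0 _ P [seq b i | i <- enum 'I_n]).
  - apply/allP => _ /mapP[k _ ->]; rewrite /root hP; apply/eqP.
    have -> : \prod_i (b k - b i) = 0 by rewrite (bigD1 k) //= subrr mul0r.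
    rewrite subr0 [\sum_i _](bigD1 k) //= [\sum_(i | _) _]big1 => [|i ik].
      by rewrite addr0 /r divfK // subrr.
    by rewrite (bigD1 k) /= ?subrr ?mul0r ?mulr0 // eq_sym.
  - by rewrite map_inj_uniq ?enum_uniq.
  - by rewrite size_map size_enum_ord.
have B0 : \prod_i (y - b i) != 0 by apply/prodf_neq0 => i _; rewrite subr_eq0.
have := hP y; rewrite P0 horner0 => /esym/eqP; rewrite subr_eq0 => /eqP.
move=> /(canRL (subrK _)) h.
rewrite prodf_div h mulrDl divff // addrC; congr (_ + _).
rewrite mulr_suml; apply: eq_bigr => k _; rewrite /r -!mulrA; congr (_ * (_ * _)).
rewrite [\prod_i _](bigD1 k) //= invfM mulrCA divff ?mulr1 //.
by apply/prodf_neq0 => i _; rewrite subr_eq0.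
Qed.

(** Poles at [(a i)^-1], zeros at [(a i)^-1 / x]; the constant [x ^+ n] is the value at [y]
    infinite. *)
Lemma partial_fractions_ratio n (a : 'I_n -> F) (x y : F) : x != 0 ->
  injective a -> (forall i, a i != 0) -> (forall i, 1 - y * a i != 0) ->
  \prod_i ((1 - x * y * a i) / (1 - y * a i)) = x ^+ n +
  \sum_k (1 - x) * \prod_(i | i != k) ((1 - x * (a i / a k)) / (1 - a i / a k))
    / (1 - y * a k).
Proof.
move=> x0 ainj a0 ya.
have yb i : y != (a i)^-1.
  by apply: contra (ya i) => /eqP->; rewrite mulVf // subrr.
have binj : injective (fun i => (a i)^-1) by move=> i k /invr_inj/ainj.
have := partial_fractions (fun i => (a i)^-1 / x) binj yb.
have -> : \prod_i ((1 - x * y * a i) / (1 - y * a i))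
   = x ^+ n * \prod_i ((y - (a i)^-1 / x) / (y - (a i)^-1)).
  have -> : x ^+ n = \prod_(i < n) x by rewrite prodr_const card_ord.
  rewrite -big_split; apply: eq_bigr => i _ /=.
  have := ya i; have := a0 i; move: (a i) => d d0 yd.
  have d1 : y * d - 1 != 0 by rewrite -oppr_eq0 opprB.
  by field; rewrite d0 x0 yd d1.
move=> ->; rewrite mulrDr mulr1; congr (_ + _).
rewrite mulr_sumr; apply: eq_bigr => k _.
have ak := a0 k; have yk := ya k.
have yk' : y * a k - 1 != 0 by rewrite -oppr_eq0 opprB.
have -> : \prod_(i | i != k) ((1 - x * (a i / a k)) / (1 - a i / a k))
    = (\prod_(i < n | i != k) x) * (\prod_(i | i != k) ((a k)^-1 - (a i)^-1 / x))
      / \prod_(i | i != k) ((a k)^-1 - (a i)^-1).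
  rewrite -big_split -prodf_div /=; apply: eq_bigr => i ik.
  have ai := a0 i; have aik : a k - a i != 0.
    by rewrite subr_eq0; apply: contra ik => /eqP/ainj->.
  have aki : a i - a k != 0 by rewrite -oppr_eq0 opprB.
  by field; rewrite ai ak x0 aik mulN1r aki.
have -> : x ^+ n = \prod_(i < n) x by rewrite prodr_const card_ord.
rewrite [\prod_(i < n) x](bigD1 k) //= [\prod_i _](bigD1 k) //=.
move: (\prod_(i | _) _) (\prod_(i | _) _) (\prod_(i | _) _) => P1 P2 P3.
move: P1^-1 => P1'.
by field; rewrite yk ak yk' x0.
Qed.

End PartialFractions.

(** * Theta products and their partial fractions *)

Section Theta.
Variables (R : realType) (q : R[i]).
Hypotheses (q_neq0 : q != 0) (q_lt1 : cabs q < 1).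
Implicit Types (x y a : R[i]).

Lemma cvg_series_geom (C r : R) : 0 <= r < 1 -> cvgn (series (fun k => C * r ^+ k)).
Proof.
move=> /andP[r0 r1]; have := @is_cvg_geometric_series R C r.
by rewrite ger0_norm // => /(_ r1).
Qed.

Lemma ccvg_expr : ccvg (fun n => q ^+ n) 0.
Proof.
apply: (@ccvg_majorant _ (fun n => cabs q ^+ n)) => [n|]; first by rewrite subr0 cabsX.
by apply: cvg_expr; rewrite ger0_norm ?cabs_ge0.
Qed.

Lemma expq_neq1 n : q ^+ n.+1 != 1.
Proof.
apply/eqP => h; have := cabsX q n.+1; rewrite h cabs1 => /esym/eqP.
by rewrite lt_eqF // exprn_ilt1 ?cabs_ge0.
Qed.

(** In standard notation the infinite product [(a q; q)]: exponents start at 1, so that [qpoch 1] is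
    [(q; q)] and [theta] has its factor [1 - x] written apart. *)
Definition qpoch a : R[i] := climit (fun n => \prod_(k < n) (1 - a * q ^+ k.+1)).

Lemma qpoch_majorant a k : cabs (- (a * q ^+ k.+1)) <= cabs a * cabs q * cabs q ^+ k.
Proof. by rewrite cabsN cabsM cabsX exprS mulrA. Qed.

Let geom_q (C : R) : cvgn (series (fun k => C * cabs q ^+ k)).
Proof. by apply: cvg_series_geom; rewrite cabs_ge0. Qed.

Lemma qpochP a : ccvg (fun n => \prod_(k < n) (1 - a * q ^+ k.+1)) (qpoch a).
Proof.
by apply: climitP; apply: ccvg_inf_prod (qpoch_majorant a) _; exact: geom_q.
Qed.

Lemma qpoch_neq0 a : (forall k, a * q ^+ k.+1 != 1) -> qpoch a != 0.
Proof.
move=> ha; apply: inf_prod_neq0 (qpoch_majorant a) _ _ (qpochP a); first exact: geom_q.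
by move=> k; rewrite subr_eq0 eq_sym.
Qed.

Lemma qpoch1_neq0 : qpoch 1 != 0.
Proof. by apply: qpoch_neq0 => k; rewrite mul1r expq_neq1. Qed.

Definition theta x : R[i] := (1 - x) * qpoch x * qpoch x^-1.

Let qratio x n := \prod_(k < n) ((1 - x * q ^+ k.+1) / (1 - q ^+ k.+1)).

Let qratio_cvg x : ccvg (qratio x) (qpoch x / qpoch 1).
Proof.
have h := qpochP 1; apply: (ccvg_eq _ (ccvgM (qpochP x) (ccvgV h qpoch1_neq0))) => n.
by rewrite /qratio prodf_div; congr (_ / _); apply: eq_bigr => k _; rewrite mul1r.
Qed.

Let theta_part x n := (1 - x) * \prod_(k < n) ((1 - x * q ^+ k.+1) * (1 - q ^+ k.+1 / x)).

Let theta_part_cvg x : ccvg (theta_part x) (theta x).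
Proof.
rewrite /theta -mulrA; apply: ccvgZ.
apply: (ccvg_eq _ (ccvgM (qpochP x) (qpochP x^-1))) => n.
by rewrite -big_split; apply: eq_bigr => k _; rewrite /= [x^-1 * _]mulrC.
Qed.

Lemma theta_neq0 x : x != 0 -> (forall n : int, x * q ^ n != 1) -> theta x != 0.
Proof.
move=> x0 hx; rewrite /theta !mulf_neq0 //.
- by have := hx 0; rewrite expr0z mulr1 subr_eq0 eq_sym.
- by apply: qpoch_neq0 => k; exact: (hx k.+1%:Z).
apply: qpoch_neq0 => k; have := hx (- k.+1%:Z); rewrite -exprnN; apply: contra => /eqP h.
by rewrite -invr_eq1 invfM invrK h.
Qed.

Lemma expqz_eq1 (n : int) : q ^ n = 1 -> n = 0.
Proof.
case: n => [[//|n]|n] h; first by have := expq_neq1 n; rewrite exprnP h eqxx.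
have := expq_neq1 n; rewrite -[q ^+ n.+1]invrK -[q ^- n.+1]/(q ^ Negz n) h invr1.
by rewrite eqxx.
Qed.

Lemma annulus_neq1 x : cabs q < cabs x < 1 -> forall n : int, x * q ^ n != 1.
Proof.
move=> /andP[qx x1] n; apply/eqP => /(congr1 (@cabs R)); rewrite cabsM cabs1 => h.
have x0 : 0 < cabs x by rewrite (le_lt_trans _ qx) ?cabs_ge0.
have qle m : cabs q ^+ m <= 1 by rewrite exprn_ile1 ?cabs_ge0 // ltW.
case: n h => n; rewrite -?exprnP.
  rewrite cabsX => h; have := qle n.
  have : 0 <= cabs q ^+ n by rewrite exprn_ge0 ?cabs_ge0.
  by nra.
rewrite NegzE -exprnN cabsV cabsX => h.
have q0' : 0 < cabs q by rewrite cabs_gt0.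
have : cabs x = cabs q ^+ n.+1.
  by rewrite -[LHS](mulfK (_ : cabs q ^+ n.+1 != 0)) ?gt_eqF ?exprn_gt0 // mulrAC h mul1r.
move=> xq; move: qx; rewrite xq exprS ltNge => /negP; apply.
by apply: ler_piMr; rewrite ?cabs_ge0.
Qed.

Let prod_exclude (G : int -> R[i]) n k : (k < n)%N ->
  \prod_(i < n | (i : nat) != k) G (i%:Z - k%:Z)
  = (\prod_(m < k) G (- (m.+1)%:Z)) * \prod_(m < n - k.+1) G (m.+1)%:Z.
Proof.
move=> kn; rewrite -(big_mkord (fun i => i != k) (fun i => G (i%:Z - k%:Z))).
rewrite (big_cat_nat (n := k)) ?(ltnW kn) //= [X in _ * X]big_ltn_cond //= eqxx /=.
congr (_ * _).
  rewrite big_nat_cond (eq_bigl (fun i => (0 <= i < k)%N)) => [|i]; last first.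
    by rewrite andbC; case: (ltngtP i k); rewrite ?andbF.
  rewrite -big_nat big_mkord (reindex_inj rev_ord_inj) /=.
  by apply: eq_bigr => i _; congr G; have := ltn_ord i; lia.
rewrite big_nat_cond (eq_bigl (fun i => (k.+1 <= i < n)%N)) => [|i]; last first.
  by case: (ltngtP i k); rewrite ?andbF ?andbT.
rewrite -big_nat -[X in \prod_(X <= _ < _) _]add0n big_addn big_mkord.
by apply: eq_bigr => i _; congr G; lia.
Qed.

(** This is [partial_fractions_ratio] at the nodes [q ^ -N, ..., q ^ N]. Pairing the exponents [m]
    and [- m] turns the left side into truncated theta products, each pair giving up one factor [x];
    the coefficients depend only on differences of exponents and split into two [qratio] factors
    around the node [k]. *)
Lemma theta_ratio_finite x y N : x != 0 -> y != 0 -> (forall n : int, y * q ^ n != 1) ->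
  x ^+ N * theta_part (x * y) N = theta_part y N * (x ^+ N.*2.+1 +
   \sum_(k < N.*2.+1) (1 - x) * (x ^+ k * qratio x^-1 k * qratio x (N.*2 - k))
     / (1 - y * q ^ (k%:Z - N%:Z))).
Proof.
move=> x0 y0 yq.
pose a (i : 'I_N.*2.+1) := q ^ (i%:Z - N%:Z).
have a0 i : a i != 0 by exact: expfz_neq0.
have aa i k : a i / a k = q ^ (i%:Z - k%:Z).
  by rewrite /a invr_expz -expfzDr //; congr (q ^ _); ring.
have ainj : injective a.
  move=> i k h; have := aa i k; rewrite h divff // => /esym/expqz_eq1 h'.
  by apply: val_inj => /=; lia.
have ya i : 1 - y * a i != 0 by rewrite subr_eq0 eq_sym yq.
have qn0 m : q ^+ m != 0 by rewrite expf_neq0.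
have ql m : q ^+ m.+1 - 1 != 0 by rewrite subr_eq0 expq_neq1.
have ql' m : 1 - q ^+ m.+1 != 0 by rewrite subr_eq0 eq_sym expq_neq1.
have yp m : 1 - y * q ^+ m != 0 by rewrite subr_eq0 eq_sym exprnP yq.
have ym m : 1 - y * q ^- m != 0 by rewrite subr_eq0 eq_sym exprnN yq.
have ym' m : 1 - q ^+ m / y != 0.
  apply: contra (ym m); rewrite subr_eq0 => /eqP h.
  have {1}-> : y = q ^+ m by rewrite -[LHS]mul1r h divfK.
  by rewrite divff ?subrr.
have ty0 : theta_part y N != 0.
  rewrite mulf_neq0 //; first by have := yp 0%N; rewrite expr0 mulr1.
  by apply/prodf_neq0 => k _; rewrite mulf_neq0.
have := partial_fractions_ratio x0 ainj a0 ya.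
pose G m := (1 - x * y * q ^ m) / (1 - y * q ^ m).
have NN : (N < N.*2.+1)%N by lia.
have -> : \prod_i ((1 - x * y * a i) / (1 - y * a i))
    = x ^+ N * theta_part (x * y) N / theta_part y N.
  rewrite (bigD1 (Ordinal NN)) //= (eq_bigl (fun i : 'I_N.*2.+1 => (i : nat) != N)) //.
  rewrite (prod_exclude G NN) /a /= subrr expr0z !mulr1.
  have -> : (N.*2.+1 - N.+1 = N)%N by lia.
  rewrite /theta_part; have -> : x ^+ N = \prod_(i < N) x by rewrite prodr_const card_ord.
  set P1 := \prod_(k < N) (_ * _); set P2 := \prod_(k < N) (_ * _).
  have -> : (\prod_(m < N) G (- m.+1%:Z)) * (\prod_(m < N) G m.+1%:Z)
      = ((\prod_(i < N) x) * P1) / P2; last by rewrite mulf_div; congr (_ / _); ring.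
  rewrite /P1 /P2 -!big_split -prodf_div /=; apply: eq_bigr => m _; rewrite /G.
  rewrite -exprnN -exprnP; have := ym m.+1; have := ym' m.+1; have := yp m.+1.
  have := qn0 m.+1; move: (q ^+ m.+1) => d d0 h1 h2 h3.
  have yd : y - d != 0.
    by apply: contra h2; rewrite subr_eq0 => /eqP<-; rewrite divff ?subrr.
  have dy : d - y != 0 by rewrite -oppr_eq0 opprB.
  by field; rewrite y0 yd h1 x0 d0 dy.
move=> h; rewrite -[LHS](divfK ty0) h mulrC; congr (_ * (_ + _)).
apply: eq_bigr => k _; congr (_ * _ / _).
under eq_bigr do rewrite aa.
pose H m := (1 - x * q ^ m) / (1 - q ^ m).
rewrite (eq_bigl (fun i : 'I_N.*2.+1 => (i : nat) != k)) // (prod_exclude H (ltn_ord k)).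
have -> : (N.*2.+1 - k.+1 = N.*2 - k)%N by lia.
congr (_ * _).
have -> : x ^+ k = \prod_(i < k) x by rewrite prodr_const card_ord.
rewrite -big_split /=; apply: eq_bigr => m _; rewrite /H -exprnN.
have := ql m; have := ql' m; have := qn0 m.+1; move: (q ^+ m.+1) => d d0 h1 h2.
by field; rewrite h1 x0 d0 h2.
Qed.

Let qratio_bounded x : exists2 C : R, 0 < C & forall n, cabs (qratio x n) <= C.
Proof. exact: ccvg_bounded (qratio_cvg x). Qed.

Let qratio_theta x : (1 - x) * (qpoch x / qpoch 1) * (qpoch x^-1 / qpoch 1) * qpoch 1 ^+ 2
  = theta x.
Proof. by rewrite /theta; field; exact: qpoch1_neq0. Qed.

Let sum_centered (V : nmodType) (f : nat -> V) N : \sum_(k < N.*2.+1) f k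
  = \sum_(k < N.+1) f (N + k)%N + \sum_(k < N) f (N - k.+1)%N.
Proof.
rewrite -(big_mkord xpredT f) (big_cat_nat (n := N)); [|by []|by lia].
rewrite addrC; congr (_ + _); first by rewrite big_mkord (reindex_inj rev_ord_inj).
rewrite -[X in \big[_/_]_(X <= _ < _) _]add0n big_addn big_mkord.
have -> : (N.*2.+1 - N = N.+1)%N by lia.
by apply: eq_bigr => k _; rewrite addnC.
Qed.

(** Terms of nonnegative index decay like |x|^k and, once numerator and denominator are multiplied
    by a power of [q], the others like (|q| / |x|)^k; the two sides of the annulus make both ratios
    less than 1. *)
Lemma theta_terms_le x y :
  cabs q < cabs x < 1 -> y != 0 -> (forall n : int, y * q ^ n != 1) ->
  exists C r : R, 0 <= r < 1 /\ forall k,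
    cabs (x ^+ k / (1 - y * q ^+ k)) <= C * r ^+ k /\
    cabs (x ^- k.+1 / (1 - y * q ^- k.+1)) <= C * r ^+ k.
Proof.
move=> /andP[qx x1] y0 yq.
have x0 : x != 0 by rewrite -cabs_gt0 (le_lt_trans _ qx) ?cabs_ge0.
have xgt0 : 0 < cabs x by rewrite cabs_gt0.
have qn0 m : q ^+ m != 0 by rewrite expf_neq0.
have yp m : 1 - y * q ^+ m != 0 by rewrite subr_eq0 eq_sym exprnP yq.
have ym m : 1 - y * q ^- m != 0 by rewrite subr_eq0 eq_sym exprnN yq.
have [c1 c10 hc1] : exists2 c, 0 < c & forall n, c <= cabs (1 - y * q ^+ n).
  apply: (ccvg_bounded_below (l := 1) _ (oner_neq0 _) yp).
  rewrite -[X in ccvg _ X]subr0 -(mulr0 y).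
  by apply: ccvgB (ccvg_cst _) _; exact: ccvgZ ccvg_expr.
have [c2 c20 hc2] : exists2 c, 0 < c & forall n, c <= cabs (q ^+ n - y).
  have yN : - y != 0 by rewrite oppr_eq0.
  have hy : ccvg (fun n => q ^+ n - y) (- y).
    by rewrite -[X in ccvg _ X]add0r; apply: ccvgB ccvg_expr (ccvg_cst _).
  apply: (ccvg_bounded_below hy yN) => n.
  by apply: contra (ym n); rewrite !subr_eq0 => /eqP<-; rewrite divff.
pose r2 := cabs q / cabs x.
have r20 : 0 <= r2 by rewrite divr_ge0 ?cabs_ge0.
have r21 : r2 < 1 by rewrite /r2 ltr_pdivrMr // mul1r.
(* The factor [r2] in [C] absorbs the extra power in the exponent [k.+1] of the second family. *)
pose C := Num.max c1^-1 (c2^-1 * r2); pose r := Num.max (cabs x) r2.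
have C0 : 0 <= C by rewrite /C le_max invr_ge0 ltW.
exists C, r; split; first by rewrite /r le_max cabs_ge0 gt_max x1 r21.
move=> k; split.
  rewrite cabsM cabsX cabsV mulrC; apply: ler_pM; rewrite ?invr_ge0 ?exprn_ge0 ?cabs_ge0 //.
    by rewrite /C le_max lef_pV2 ?posrE ?cabs_gt0 ?hc1.
  by apply: lerXn2r; rewrite ?nnegrE ?cabs_ge0 // /r le_max ?cabs_ge0 ?lexx.
have -> : x ^- k.+1 / (1 - y * q ^- k.+1) = (q / x) ^+ k.+1 / (q ^+ k.+1 - y).
  rewrite expr_div_n; have := ym k.+1; have := qn0 k.+1.
  have : x ^+ k.+1 != 0 by rewrite expf_neq0.
  move: (x ^+ k.+1) (q ^+ k.+1) => X Q X0 Q0 h.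
  have h' : Q - y != 0.
    by apply: contra h; rewrite !subr_eq0 => /eqP<-; rewrite divff.
  by field; rewrite ?X0 ?Q0 ?h ?h'.
rewrite cabsM cabsX cabsM !cabsV -/r2 mulrC [r2 ^+ _]exprS mulrA.
apply: ler_pM; rewrite ?mulr_ge0 ?invr_ge0 ?exprn_ge0 ?cabs_ge0 //.
  rewrite /C le_max; apply/orP; right; apply: ler_wpM2r => //.
  by rewrite lef_pV2 ?posrE // (lt_le_trans c20).
by apply: lerXn2r; rewrite ?nnegrE // /r le_max ?r20 ?lexx orbT.
Qed.

(* Ramanujan's 1psi1 summation in the case b = aq: partial fractions in [y]
   of the finite products over the nodes [q ^ -N, ..., q ^ N], then [N] tends
   to infinity by dominated convergence. *)
Lemma theta_partial_fractions x y :
  cabs q < cabs x < 1 -> y != 0 -> (forall n : int, y * q ^ n != 1) ->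
  exists G1 G2,
    [/\ ccvg (fun n => \sum_(k < n) x ^+ k / (1 - y * q ^+ k)) G1,
        ccvg (fun n => \sum_(k < n) x ^- k.+1 / (1 - y * q ^- k.+1)) G2 &
        theta (x * y) * qpoch 1 ^+ 2 = theta y * theta x * (G1 + G2)].
Proof.
move=> qx1 y0 yq; have [B [r [r01 hB]]] := theta_terms_le qx1 y0 yq.
have {qx1} /andP[qx x1] := qx1.
have x0 : x != 0 by rewrite -cabs_gt0 (le_lt_trans _ qx) ?cabs_ge0.
have yp m : 1 - y * q ^+ m != 0 by rewrite subr_eq0 eq_sym exprnP yq.
have ym m : 1 - y * q ^- m != 0 by rewrite subr_eq0 eq_sym exprnN yq.
pose g1 k := x ^+ k / (1 - y * q ^+ k).
pose g2 k := x ^- k.+1 / (1 - y * q ^- k.+1).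
have hg1 k : cabs (g1 k) <= B * r ^+ k by exact: (hB k).1.
have hg2 k : cabs (g2 k) <= B * r ^+ k by exact: (hB k).2.
have sr C : cvgn (series (fun k => C * r ^+ k)) by exact: cvg_series_geom.
have [G1 hG1] := ccvg_series hg1 (sr _).
have [G2 hG2] := ccvg_series hg2 (sr _).
exists G1, G2; split=> //.
pose A x := qpoch x / qpoch 1.
pose u N k := g1 k * (qratio x^-1 (N + k) * qratio x (N - k)).
pose v N k := g2 k * (qratio x^-1 (N - k.+1) * qratio x (N + k.+1)).
have cvgU k : ccvg (u^~ k) (g1 k * (A x^-1 * A x)).
  apply: ccvgZ; apply: ccvgM; last exact: ccvg_shift (qratio_cvg x).
  by apply: (ccvg_subseq (qratio_cvg x^-1)) => n; exact: leq_addr.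
have cvgV k : ccvg (v^~ k) (g2 k * (A x^-1 * A x)).
  apply: ccvgZ; apply: ccvgM; first exact: ccvg_shift (qratio_cvg x^-1).
  by apply: (ccvg_subseq (qratio_cvg x)) => n; exact: leq_addr.
have [C C0 hC] := qratio_bounded x; have [C' C'0 hC'] := qratio_bounded x^-1.
have uM N k : cabs (u N k) <= (C' * C * B) * r ^+ k.
  rewrite cabsM mulrC -[leRHS]mulrA; apply: ler_pM; rewrite ?cabs_ge0 //.
  by rewrite cabsM; apply: ler_pM; rewrite ?cabs_ge0.
have vM N k : cabs (v N k) <= (C' * C * B) * r ^+ k.
  rewrite cabsM mulrC -[leRHS]mulrA; apply: ler_pM; rewrite ?cabs_ge0 //.
  by rewrite cabsM; apply: ler_pM; rewrite ?cabs_ge0.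
have sumU : ccvg (fun N => \sum_(k < N.+1) u N k) (A x^-1 * A x * G1).
  (* [ccvg_tannery] wants [n] terms at stage [n], whereas this half has [N.+1] terms at stage [N];
     hence the predecessor. *)
  have h : ccvg (fun n => \sum_(k < n) u n.-1 k) (A x^-1 * A x * G1).
    apply: (@ccvg_tannery _ (fun n k => u n.-1 k) (fun k => g1 k * (A x^-1 * A x))
      (fun k => (C' * C * B) * r ^+ k)) => //.
    - by move=> k; apply: (ccvg_eq _ (ccvg_shift 1 (cvgU k))) => n; rewrite subn1.
    - apply: (ccvg_eq _ (ccvgZ (A x^-1 * A x) hG1)) => n.
      by rewrite mulr_sumr; apply: eq_bigr => k _; rewrite mulrC.
  by apply: (ccvg_subseq h) => n; exact: leqnSn.
have sumV : ccvg (fun N => \sum_(k < N) v N k) (A x^-1 * A x * G2).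
  apply: (@ccvg_tannery _ v (fun k => g2 k * (A x^-1 * A x))
      (fun k => (C' * C * B) * r ^+ k)) => //.
  apply: (ccvg_eq _ (ccvgZ (A x^-1 * A x) hG2)) => n.
  by rewrite mulr_sumr; apply: eq_bigr => k _; rewrite mulrC.
(* The value at [y] infinite, [x ^+ N.*2.+1], divided by the [x ^+ N] of the left side, vanishes in
   the limit because |x| < 1. *)
have xN : ccvg (fun N => x ^+ N.+1) 0.
  apply: (@ccvg_majorant _ (fun N => cabs x * cabs x ^+ N)) => [N|].
    by rewrite subr0 cabsX exprS.
  rewrite -(mulr0 (cabs x)); apply: cvgMr.
  by apply: cvg_expr; rewrite ger0_norm ?cabs_ge0.
have split N : theta_part (x * y) N = theta_part y N * (x ^+ N.+1
    + (1 - x) * (\sum_(k < N.+1) u N k + \sum_(k < N) v N k)).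
  have xN0 : x ^+ N != 0 by rewrite expf_neq0.
  apply: (mulfI xN0); rewrite theta_ratio_finite // mulrCA; congr (_ * _).
  have -> : x ^+ N.*2.+1 = x ^+ N * x ^+ N.+1 by rewrite -exprD addnS addnn.
  rewrite [RHS]mulrDr; congr (_ + _).
  pose Fk k := (1 - x) * (x ^+ k * qratio x^-1 k * qratio x (N.*2 - k))
     / (1 - y * q ^ (k%:Z - N%:Z)).
  rewrite (sum_centered Fk) mulrDr mulrDr; congr (_ + _).
    rewrite mulr_sumr mulr_sumr; apply: eq_bigr => k _; rewrite /Fk /u /g1.
    have -> : (N.*2 - (N + k) = N - k)%N by rewrite -addnn subnDl.
    have -> : (N + k)%N%:Z - N%:Z = k%:Z by rewrite PoszD addrC addKr.
    by rewrite -exprnP exprD; field; rewrite yp.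
  rewrite mulr_sumr mulr_sumr; apply: eq_bigr => k _; rewrite /Fk /v /g2.
  have kN := ltn_ord k.
  have -> : (N.*2 - (N - k.+1) = N + k.+1)%N.
    by rewrite -addnn -addnBA ?leq_subr // subKn.
  have -> : (N - k.+1)%N%:Z - N%:Z = - (k.+1)%:Z.
    by rewrite -subzn // addrAC subrr add0r.
  rewrite -exprnN.
  have -> : x ^+ N = x ^+ (N - k.+1) * x ^+ k.+1 by rewrite -exprD subnK.
  have := ym k.+1; move: (1 - y * _) => d d0.
  have := expf_neq0 k.+1 x0; move: (x ^+ k.+1) => X X0.
  by field; rewrite d0 X0.
have h := ccvgM (theta_part_cvg y) (ccvgD xN (ccvgZ (1 - x) (ccvgD sumU sumV))).
have -> : theta (x * y) = theta y * (0 + (1 - x) * (A x^-1 * A x * G1 + A x^-1 * A x * G2)).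
  apply: ccvg_unique (theta_part_cvg _) _; apply: (ccvg_eq _ h) => N.
  by rewrite split.
by rewrite -(qratio_theta x) -/(A x) -/(A x^-1); ring.
Qed.

End Theta.

(** * The Weierstrass sigma function *)

Section CenteredBigop.
Variables (T : Type) (idx : T) (op : Monoid.com_law idx).

(** An abstract law lets one rearrangement serve both the product for sigma and the series for
    zeta(omega1). *)
Lemma big_centered (h : nat -> T) N : \big[op/idx]_(p < N.*2.+1) h p
  = op (h N) (\big[op/idx]_(k < N) op (h (N + k.+1)%N) (h (N - k.+1)%N)).
Proof.
rewrite -(big_mkord xpredT h) (big_cat_nat (n := N)); [|by []|by lia].
rewrite big_mkord (reindex_inj rev_ord_inj) /= big_ltn; last by lia.
rewrite -[X in \big[_/_]_(X <= _ < _) _]add0n big_addn big_mkord.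
have -> : (N.*2.+1 - N.+1 = N)%N by lia.
rewrite big_split /= Monoid.mulmCA; congr (op _ _); rewrite Monoid.mulmC.
by congr (op _ _); apply: eq_bigr => k _; congr h; rewrite addnC addSnnS.
Qed.

Lemma big_centered_int (f : int -> T) N : \big[op/idx]_(p < N.*2.+1) f (p%:Z - N%:Z)
  = op (f 0) (\big[op/idx]_(k < N) op (f (k.+1)%:Z) (f (- (k.+1)%:Z))).
Proof.
rewrite (big_centered (fun p => f (p%:Z - N%:Z))) subrr; congr (op _ _).
apply: eq_bigr => k _; have kN := ltn_ord k; congr (op (f _) (f _)); lia.
Qed.

Lemma big_centered_opp (f : int -> T) N :
  \big[op/idx]_(p < N.*2.+1) f (p%:Z - N%:Z)
  = \big[op/idx]_(p < N.*2.+1) f (- (p%:Z - N%:Z)).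
Proof.
rewrite (reindex_inj rev_ord_inj) /=; apply: eq_bigr => p _; congr f.
by have := ltn_ord p; lia.
Qed.

(* Pairing each lattice point with its opposite will leave terms of order
   [|l| ^ -4], so that the square box can be exhausted row by row. *)
Lemma big_box (g : int -> int -> T) N :
  \big[op/idx]_(p < N.*2.+1) \big[op/idx]_(q < N.*2.+1 |
      (p%:Z - N%:Z != 0) || (q%:Z - N%:Z != 0)) g (p%:Z - N%:Z) (q%:Z - N%:Z)
  = op (\big[op/idx]_(k < N) op (g (k.+1)%:Z 0) (g (- (k.+1)%:Z) 0))
       (\big[op/idx]_(n < N) \big[op/idx]_(p < N.*2.+1)
          op (g (p%:Z - N%:Z) (n.+1)%:Z) (g (- (p%:Z - N%:Z)) (- (n.+1)%:Z))).
Proof.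
pose G (p q : int) := if (p != 0) || (q != 0) then g p q else idx.
rewrite (eq_bigr (fun p : 'I_N.*2.+1 =>
    \big[op/idx]_(q < N.*2.+1) G (p%:Z - N%:Z) (q%:Z - N%:Z))); last first.
  by move=> p _; rewrite big_mkcond.
rewrite exchange_big /=.
rewrite (big_centered_int (fun q => \big[op/idx]_(p < N.*2.+1) G (p%:Z - N%:Z) q)).
congr (op _ _).
  rewrite (big_centered_int (fun p => G p 0)) {1}/G !eqxx /= Monoid.mul1m.
  by apply: eq_bigr => k _; rewrite /G.
apply: eq_bigr => n _; rewrite [X in op _ X](big_centered_opp (fun p => G p _)).
by rewrite -big_split; apply: eq_bigr => p _ /=; rewrite /G oppr_eq0 !orbT.
Qed.

End CenteredBigop.

Section WeierstrassFactor.
Variable R : realType.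
Implicit Types (w : R[i]).

(** The Weierstrass primary factor of genus 1; two opposite factors of sigma multiply to it, with
    [w = z ^ 2 / l ^ 2]. *)
Definition wfactor w : R[i] := (1 - w) * cexp w.

Lemma wfactor_sub1_le (W : R) : exists2 C, 0 < C &
  forall w, cabs w <= W -> cabs (wfactor w - 1) <= C * cabs w ^+ 2.
Proof.
have [C C0 hC] := cexp_sub_le W.
exists ((1 + `|W|) * C + 1) => [|w wW].
  by rewrite addr_gt0 // mulr_gt0 // ltr_pwDl.
have -> : wfactor w - 1 = (1 - w) * (cexp w - 1 - w) - w ^+ 2 by rewrite /wfactor; ring.
apply: le_trans (cabsD _ _) _; rewrite cabsN cabsX [leRHS]mulrDl mul1r lerD2r cabsM -mulrA.
apply: ler_pM; rewrite ?cabs_ge0 ?hC //.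
apply: le_trans (cabsD _ _) _; rewrite cabsN cabs1 lerD2l.
exact: le_trans (ler_norm _).
Qed.

(** The product differs from 1 by at most [exp s - 1], where [s] is the sum of the deviations, and
    [exp s - 1 <= s * exp s]. *)
Lemma cabs_prod_sub1_le I (r : seq I) (a : I -> R[i]) (S : R) :
  \sum_(i <- r) cabs (a i - 1) <= S ->
  cabs (\prod_(i <- r) a i - 1) <= S * expR S.
Proof.
have key : cabs (\prod_(i <- r) a i - 1) <= expR (\sum_(i <- r) cabs (a i - 1)) - 1.
  elim: r => [|i r IH]; first by rewrite !big_nil expR0 !subrr cabs0.
  rewrite !big_cons expRD.
  set p := \prod_(_ <- _) _ in IH *; set s := \sum_(_ <- _) _ in IH *.
  have -> : a i * p - 1 = (a i - 1) * (p - 1) + ((a i - 1) + (p - 1)) by ring.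
  have h := expR_ge1Dx (cabs (a i - 1)).
  apply: le_trans (cabsD _ _) _; rewrite cabsM.
  have := cabsD (a i - 1) (p - 1).
  have h0 := cabs_ge0 (a i - 1); have h1 := cabs_ge0 (p - 1).
  have : (1 + cabs (a i - 1)) * (1 + cabs (p - 1)) <= expR (cabs (a i - 1)) * expR s.
    by apply: ler_pM; rewrite ?addr_ge0 // -lerBrDl.
  lra.
have S0 : 0 <= \sum_(i <- r) cabs (a i - 1) by apply: sumr_ge0 => *; exact: cabs_ge0.
move=> hS; apply: le_trans key _; set s := \sum_(_ <- _) _ in hS S0 *.
apply: (@le_trans _ _ (s * expR s)).
  have := expR_ge1Dx (- s); rewrite expRN => h.
  have e0 : 0 < expR s by exact: expR_gt0.
  have : (1 - s) * expR s <= 1 by rewrite -ler_pdivlMr // div1r.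
  lra.
by apply: ler_pM => //; rewrite ?expR_ge0 // ler_expR.
Qed.

Lemma ccvg_le (u : nat -> R[i]) l (M : R) : ccvg u l ->
  (\forall n \near \oo, cabs (u n) <= M) -> cabs l <= M.
Proof.
move=> /ccvgP hu hM; apply/ler_addgt0Pl => e e0; near \oo => n.
have h1 : cabs (u n - l) < e by near: n; exact: hu.
have h2 : cabs (u n) <= M by near: n.
have := cabsB_ge l (u n); rewrite (cabsBC l); lra.
Unshelve. all: by end_near. Qed.

End WeierstrassFactor.

(** * Uniform bounds on the rows of the lattice *)

Section LatticeRows.
Variables (R : realType) (t : R).
Hypothesis t_gt0 : 0 < t.
Implicit Types (u z : R[i]) (n p N : nat).

(** Lattice points in units of [2 * omega1], with [t = omega3 / (i omega1)]. Rows start at height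
    [n.+1]: the row through 0 is treated apart. *)
Definition rowpt (p : int) n : R[i] := p%:~R + 'i * t%:C * n.+1%:R.

Lemma rowptE (p : int) n : rowpt p n = Complex p%:~R (t * n.+1%:R).
Proof.
rewrite /rowpt -[p%:~R](rmorph_int (real_complex R)).
rewrite -[n.+1%:R](rmorph_nat (real_complex R)).
by apply/eqP; rewrite eq_complex /=; apply/andP; split; apply/eqP; ring.
Qed.

Lemma sqr_cabs_rowpt (p : int) n :
  cabs (rowpt p n) ^+ 2 = p%:~R ^+ 2 + t ^+ 2 * n.+1%:R ^+ 2.
Proof. by rewrite sqr_cabs rowptE /= exprMn. Qed.

Lemma cabs_rowpt_ge (p : int) n : t <= cabs (rowpt p n).
Proof.
apply: le_trans (cabs_ge_Im _); rewrite rowptE /=.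
apply: le_trans (ler_norm _).
by apply: ler_peMr; rewrite ?ler1n // ltW.
Qed.

Lemma rowpt_neq0 (p : int) n : rowpt p n != 0.
Proof. by rewrite -cabs_gt0 (lt_le_trans t_gt0) ?cabs_rowpt_ge. Qed.

Lemma rowpt_quartic_ge0 n : t ^+ 4 * n.+1%:R ^+ 2 <= cabs (rowpt 0 n) ^+ 4.
Proof.
rewrite [leRHS](exprM (cabs _) 2 2) sqr_cabs_rowpt mulr0z expr0n add0r exprMn -!exprM.
by apply: ler_wpM2l; [exact/exprn_ge0/ltW|apply: ler_weXn2l; rewrite ?ler1n].
Qed.

(** From [(a + b) ^ 2 >= 2 a b]. The bound separates [p] from [n], so a whole row can be summed with
    [1 / (n + 1) ^ 2] in front; at [p = 0] it is void and [rowpt_quartic_ge0] takes over. *)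
Lemma rowpt_quartic_ge (p : int) n :
  2 * t ^+ 2 * p%:~R ^+ 2 * n.+1%:R ^+ 2 <= cabs (rowpt p n) ^+ 4.
Proof.
rewrite [leRHS](exprM (cabs _) 2 2) sqr_cabs_rowpt.
set a := p%:~R ^+ 2; set b := n.+1%:R ^+ 2.
have a0 : 0 <= a by exact: sqr_ge0.
have b0 : 0 <= b by exact: sqr_ge0.
have := sqr_ge0 a; have := sqr_ge0 (t ^+ 2 * b); lra.
Qed.

Lemma rowpt_quartic_gt0 (p : int) n : 0 < cabs (rowpt p n) ^+ 4.
Proof. by rewrite exprn_gt0 // cabs_gt0 rowpt_neq0. Qed.

(** Uniform in the length of the row and summable in [n]: the source of the majorants for both sigma
    and zeta. *)
Lemma row_majorant : exists2 C : R, 0 < C & forall n N,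
  \sum_(p < N.*2.+1) (cabs (rowpt (p%:Z - N%:Z) n) ^+ 4)^-1 <= C / n.+1%:R ^+ 2.
Proof.
pose S : R := limn (series (fun k => (k.+1%:R ^+ 2)^-1 : R)).
have hS N : \sum_(k < N) (k.+1%:R ^+ 2)^-1 <= S.
  by apply: series_le_sup => [k|]; [rewrite invr_ge0 sqr_ge0|exact: cvg_series_inv_sqr].
have S0 : 0 <= S by have := hS 0%N; rewrite big_ord0.
have t4 : 0 < t ^+ 4 by exact: exprn_gt0.
have t2 : 0 < 2 * t ^+ 2 by rewrite mulr_gt0 ?exprn_gt0.
exists ((t ^+ 4)^-1 + 2 * (2 * t ^+ 2)^-1 * S) => [|n N].
  by rewrite ltr_pwDl ?invr_gt0 ?mulr_ge0 ?invr_ge0 ?(ltW t2).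
have n0 : 0 < n.+1%:R ^+ 2 :> R by rewrite exprn_gt0.
rewrite (big_centered_int _ (fun p : int => (cabs (rowpt p n) ^+ 4)^-1)) mulrDl; apply: lerD.
  rewrite -invfM lef_pV2 ?posrE ?rowpt_quartic_gt0 ?rowpt_quartic_ge0 //.
  exact: mulr_gt0.
apply: (@le_trans _ _ (\sum_(k < N) 2 * (2 * t ^+ 2)^-1 / n.+1%:R ^+ 2 * (k.+1%:R ^+ 2)^-1)).
  apply: ler_sum => k _; have k0 : 0 < k.+1%:R ^+ 2 :> R by rewrite exprn_gt0.
  have h (s : int) : s%:~R ^+ 2 = k.+1%:R ^+ 2 :> R -> (cabs (rowpt s n) ^+ 4)^-1
      <= (2 * t ^+ 2)^-1 / n.+1%:R ^+ 2 * (k.+1%:R ^+ 2)^-1.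
    move=> sk; rewrite -!invfM lef_pV2 ?posrE ?rowpt_quartic_gt0 //; last first.
      by rewrite mulr_gt0 // mulr_gt0.
    by apply: le_trans (rowpt_quartic_ge s n); rewrite sk mulrAC.
  have h1 := h k.+1%:Z (erefl _); have h2 := h (- k.+1%:Z).
  rewrite mulrNz sqrrN in h2; have {}h2 := h2 (erefl _).
  by apply: (le_trans (lerD h1 h2)); rewrite -mulr2n -[_ *+ 2]mulr_natl !mulrA.
rewrite -mulr_sumr [leRHS]mulrAC; apply: ler_wpM2l; last exact: hS.
by rewrite divr_ge0 ?(ltW n0) // divr_ge0 ?(ltW t2).
Qed.

End LatticeRows.

(** * The sigma product along one row *)

Section RowLimits.
Variables (R : realType) (t : R).
Hypothesis t_gt0 : 0 < t.
Implicit Types (u z b : R[i]) (n N : nat).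
Local Notation ipi := ('i * pi%:C : R[i]).
Local Notation row := (rowpt t).

Definition nomesq : R[i] := cexp (2 * (ipi * ('i * t%:C))).

Lemma nomesqE : nomesq = (expR (- (2 * pi * t)))%:C.
Proof.
rewrite /nomesq -cexp_real; congr cexp.
have -> : 2 * (ipi * ('i * t%:C)) = 2 * pi%:C * t%:C * 'i ^+ 2 by ring.
by rewrite sqr_i mulrN1 rmorphN !rmorphM rmorph_nat.
Qed.

Lemma nomesq_neq0 : nomesq != 0. Proof. exact: cexp_neq0. Qed.

Lemma nomesq_lt1 : cabs nomesq < 1.
Proof.
rewrite nomesqE cabs_real ger0_norm ?expR_ge0 // -expR0 ltr_expR oppr_lt0.
by rewrite !mulr_gt0 ?pi_gt0.
Qed.

Lemma nomesqX n : nomesq ^+ n = cexp (2 * (ipi * ('i * t%:C * n%:R))).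
Proof. by rewrite -cexpMn; congr cexp; ring. Qed.

Lemma sinpiE b : sinpi b = cexp (ipi * b) * (1 - cexp (- (2 * (ipi * b)))) / (2 * ipi).
Proof.
rewrite /sinpi; congr (_ / _); rewrite mulrBr mulr1 -cexpD; congr (_ - cexp _); ring.
Qed.

Lemma sinpiE' b : sinpi b = - (cexp (- (ipi * b)) * (1 - cexp (2 * (ipi * b)))) / (2 * ipi).
Proof.
rewrite /sinpi; congr (_ / _); rewrite mulrBr mulr1 -cexpD opprB; congr (cexp _ - _); ring.
Qed.

Let sinprod b N := b * \prod_(k < N) (1 - b ^+ 2 / k.+1%:R ^+ 2).

Let prod_shift b N : \prod_(p < N.*2.+1) ((p%:Z - N%:Z)%:~R + b)
  = sinprod b N * \prod_(k < N) (- k.+1%:R ^+ 2).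
Proof.
rewrite (big_centered_int _ (fun p : int => p%:~R + b)) mulr0z add0r /sinprod.
rewrite -mulrA -big_split /=; congr (_ * _); apply: eq_bigr => k _ /=.
rewrite mulrNz; have k0 : k.+1%:R != 0 :> R[i] by rewrite pnatr_eq0.
by rewrite -pmulrn; move: (_%:R) k0 => c c0; field.
Qed.

(** Factor [1 - u ^ 2 / v ^ 2] as [(v - u) (v + u) / v ^ 2]; the product of [p + b] over |p| <= N is
    the truncated sine product at [b], up to a factor independent of [b]. *)
Lemma row_sine_ratio u n N : \prod_(p < N.*2.+1) (1 - u ^+ 2 / row (p%:Z - N%:Z) n ^+ 2)
  = sinprod ('i * t%:C * n.+1%:R - u) N * sinprod ('i * t%:C * n.+1%:R + u) N
    / sinprod ('i * t%:C * n.+1%:R) N ^+ 2.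
Proof.
set a := 'i * t%:C * n.+1%:R.
pose f := \prod_(k < N) (- k.+1%:R ^+ 2) : R[i].
have f0 : f != 0.
  by apply/prodf_neq0 => k _; rewrite oppr_eq0 expf_neq0 // pnatr_eq0.
have -> : sinprod (a - u) N * sinprod (a + u) N / sinprod a N ^+ 2
    = (sinprod (a - u) N * f) * (sinprod (a + u) N * f) / (sinprod a N * f) ^+ 2.
  by rewrite [in RHS]exprMn [in RHS]mulrACA -[f * f]expr2 -[RHS]mulf_div divff ?mulr1 ?expf_neq0.
rewrite [(_ * f) ^+ 2]expr2 -!prod_shift -!big_split /= -prodf_div; apply: eq_bigr => p _.
have v0 := rowpt_neq0 t_gt0 (p%:Z - N%:Z) n.
rewrite !addrA -/(row (p%:Z - N%:Z) n); move: (row _ _) v0 => v v0.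
by field.
Qed.

(** With [a = i t (n + 1)] the limit is [sin pi(a - u) sin pi(a + u) / sin^2 pi a]; in exponentials
    the prefactors cancel, and [exp(2 pi i a)] is [nomesq ^+ n.+1]. *)
Lemma ccvg_row_sine u n (x := cexp (- (2 * (ipi * u)))) :
  ccvg (fun N => \prod_(p < N.*2.+1) (1 - u ^+ 2 / row (p%:Z - N%:Z) n ^+ 2))
    ((1 - x * nomesq ^+ n.+1) * (1 - x^-1 * nomesq ^+ n.+1) / (1 - nomesq ^+ n.+1) ^+ 2).
Proof.
set a := 'i * t%:C * n.+1%:R.
have Q : nomesq ^+ n.+1 = cexp (2 * (ipi * a)) by exact: nomesqX.
have Q1 := expq_neq1 nomesq_lt1 n.
have I0 := @ipi_neq0 R.
have sE b : sinprod b =1 (fun N => b * \prod_(k < N) (1 - b ^+ 2 / k.+1%:R ^+ 2)) by [].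
have s0 : sinpi a != 0.
  rewrite sinpiE' -Q; apply: mulf_neq0; last by rewrite invr_eq0 mulf_neq0 ?pnatr_eq0.
  by rewrite oppr_eq0 mulf_neq0 ?cexp_neq0 // subr_eq0 eq_sym.
have -> : (1 - x * nomesq ^+ n.+1) * (1 - x^-1 * nomesq ^+ n.+1) / (1 - nomesq ^+ n.+1) ^+ 2
    = sinpi (a - u) * sinpi (a + u) / sinpi a ^+ 2.
  rewrite !sinpiE' !Q.
  have -> : cexp (2 * (ipi * (a - u))) = x * cexp (2 * (ipi * a)).
    by rewrite /x -cexpD; congr cexp; ring.
  have -> : cexp (2 * (ipi * (a + u))) = x^-1 * cexp (2 * (ipi * a)).
    by rewrite /x -cexpN -cexpD; congr cexp; ring.
  have -> : cexp (- (ipi * (a - u))) = cexp (- (ipi * a)) * cexp (ipi * u).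
    by rewrite -cexpD; congr cexp; ring.
  have -> : cexp (- (ipi * (a + u))) = cexp (- (ipi * a)) / cexp (ipi * u).
    by rewrite -cexpN -cexpD; congr cexp; ring.
  have Q0 : 1 - cexp (2 * (ipi * a)) != 0 by rewrite -Q subr_eq0 eq_sym.
  have := cexp_neq0 (- (ipi * a)); have := cexp_neq0 (ipi * u).
  set E1 := cexp (ipi * u); set E2 := cexp (- _); set Qa := cexp _ in Q0 *.
  rewrite -/E2; move: E1 E2 Qa Q0 => E1 E2 Qa Q0 h1 h2.
  have x0 : x != 0 by exact: cexp_neq0.
  have J0 : 2 * ipi != 0 :> R[i] by rewrite mulf_neq0 ?pnatr_eq0.
  clearbody x; move: (2 * ipi) J0 => J J0.
  by field; rewrite J0 Q0 h2 x0 h1.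
under eq_fun do rewrite row_sine_ratio.
apply: ccvgM; first by apply: ccvgM; exact: sine_product.
apply: ccvgV; last by rewrite expf_neq0.
by rewrite expr2; apply: ccvgM; exact: sine_product.
Qed.

Definition rowprod u n N : R[i] :=
  \prod_(p < N.*2.+1) wfactor (u ^+ 2 / row (p%:Z - N%:Z) n ^+ 2).

Definition rowsum n N : R[i] := \sum_(p < N.*2.+1) (row (p%:Z - N%:Z) n ^+ 2)^-1.

Lemma rowsum_cvg n : exists e, ccvg (rowsum n) e.
Proof.
pose f (p : int) := (row p n ^+ 2)^-1.
have hf (p : int) k : p%:~R ^+ 2 = k.+1%:R ^+ 2 :> R -> cabs (f p) <= (k.+1%:R ^+ 2)^-1.
  move=> pk; have k0 : 0 < k.+1%:R ^+ 2 :> R by rewrite exprn_gt0.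
  rewrite cabsV cabsX lef_pV2 ?posrE ?exprn_gt0 ?cabs_gt0 ?rowpt_neq0 //.
  by rewrite sqr_cabs_rowpt pk lerDl mulr_ge0 ?sqr_ge0.
have [||S hS] := @ccvg_series R (fun k => f k.+1%:Z + f (- k.+1%:Z))
    (fun k => 2 * (k.+1%:R ^+ 2)^-1).
- move=> k; apply: le_trans (cabsD _ _) _.
  by rewrite mulr_natl mulr2n lerD // hf // mulrNz sqrrN.
- by apply: is_cvg_series_scale; exact: cvg_series_inv_sqr.
exists (f 0 + S); apply: (ccvg_eq _ (ccvgD (ccvg_cst (f 0)) hS)) => N.
by rewrite /rowsum (big_centered_int _ f).
Qed.

Definition rowsum_lim n : R[i] := climit (rowsum n).

Lemma rowsumP n : ccvg (rowsum n) (rowsum_lim n).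
Proof. exact: (climitP (rowsum_cvg n)). Qed.

Lemma ccvg_cexp (v : nat -> R[i]) l : ccvg v l -> ccvg (fun n => cexp (v n)) (cexp l).
Proof.
move=> hv; have [C C0 hC] := cexp_sub_le (1 : R).
suff h : ccvg (fun n => cexp (v n - l)) 1.
  rewrite -[cexp l]mulr1; apply: (ccvg_eq _ (ccvgZ (cexp l) h)) => n.
  by rewrite -cexpD addrC subrK.
have hd : ccvg (fun n => v n - l) 0 by rewrite -(subrr l); apply: ccvgB hv (ccvg_cst _).
move/ccvgP : (hd) => small.
apply: (squeeze_cvgr _ (cvg_cst 0)
  (h := fun n => C * cabs (v n - l) ^+ 2 + cabs (v n - l))); last first.
  have hd' : (fun n => cabs (v n - l)) @ \oo --> (0 : R).
    by move: hd; rewrite /ccvg; under eq_fun do rewrite subr0.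
  rewrite -[0]addr0 -{1}(mulr0 C) -{1}(mulr0 0); apply: cvgD => //.
  by apply: cvgMr; under eq_fun do rewrite expr2; exact: cvgM.
near=> n; rewrite cabs_ge0 andTb.
have -> : cexp (v n - l) - 1 = (cexp (v n - l) - 1 - (v n - l)) + (v n - l) by ring.
apply: le_trans (cabsD _ _) _; rewrite lerD2r; apply: hC.
have : cabs (v n - l - 0) < 1 by near: n; apply: small.
by rewrite subr0 => /ltW.
Unshelve. all: by end_near. Qed.

Lemma ccvg_rowprod u n (x := cexp (- (2 * (ipi * u)))) :
  ccvg (rowprod u n)
    ((1 - x * nomesq ^+ n.+1) * (1 - x^-1 * nomesq ^+ n.+1) / (1 - nomesq ^+ n.+1) ^+ 2
     * cexp (u ^+ 2 * rowsum_lim n)).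
Proof.
apply: (ccvg_eq _ (ccvgM (ccvg_row_sine u n) (ccvg_cexp (ccvgZ (u ^+ 2) (rowsumP n))))) => N.
by rewrite /rowsum mulr_sumr cexp_sum -big_split.
Qed.

(** Each factor deviates from 1 by a term of order |v|^-4, and [row_majorant] sums these deviations
    uniformly in [N]. *)
Lemma rowprod_sub1_le u : exists2 C, 0 < C &
  forall n N, cabs (rowprod u n N - 1) <= C * (n.+1%:R ^+ 2)^-1.
Proof.
(* Every row point has modulus at least [t], so this radius covers all the arguments
   [u ^ 2 / v ^ 2]. *)
have [C1 C10 hC1] := wfactor_sub1_le (cabs u ^+ 2 / t ^+ 2).
have [C C0 hC] := row_majorant t_gt0.
pose B := C1 * cabs u ^+ 4 * C.
have B0 : 0 <= B by rewrite /B !mulr_ge0 ?exprn_ge0 ?cabs_ge0 // ltW.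
exists (B * expR B + 1) => [|n N].
  by rewrite ltr_wpDl // mulr_ge0 ?expR_ge0.
have n1 : (n.+1%:R ^+ 2)^-1 <= 1 :> R by rewrite invf_le1 ?exprn_gt0 // exprn_ege1 // ler1n.
have n0 : 0 <= (n.+1%:R ^+ 2)^-1 :> R by rewrite invr_ge0 sqr_ge0.
have : \sum_(p < N.*2.+1) cabs (wfactor (u ^+ 2 / row (p%:Z - N%:Z) n ^+ 2) - 1)
    <= B * (n.+1%:R ^+ 2)^-1.
  apply: (@le_trans _ _ (\sum_(p < N.*2.+1) C1 * cabs u ^+ 4
      * (cabs (row (p%:Z - N%:Z) n) ^+ 4)^-1)); last first.
    rewrite -mulr_sumr /B -[leRHS]mulrA; apply: ler_wpM2l; last exact: hC.
    by rewrite mulr_ge0 ?exprn_ge0 ?cabs_ge0 // ltW.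
  apply: ler_sum => p _; apply: le_trans (hC1 _ _) _.
    rewrite cabsM cabsV !cabsX; apply: ler_wpM2l; first exact: sqr_ge0.
    have v0 : 0 < cabs (row (p%:Z - N%:Z) n) by rewrite cabs_gt0 rowpt_neq0.
    rewrite lef_pV2 ?posrE ?exprn_gt0 //.
    by apply: lerXn2r; rewrite ?nnegrE ?cabs_ge0 ?cabs_rowpt_ge // ltW.
  by rewrite cabsM cabsV !cabsX exprMn exprVn -!exprM mulrA.
move=> /cabs_prod_sub1_le h; apply: le_trans h _.
rewrite mulrAC; apply: ler_wpM2r => //.
apply: (@le_trans _ _ (B * expR B)); last by rewrite lerDl.
by apply: ler_wpM2l => //; rewrite ler_expR ler_piMr.
Qed.

End RowLimits.

(** * The series for zeta(omega1) along one row *)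

Section ZetaRows.
Variables (R : realType) (t : R).
Hypothesis t_gt0 : 0 < t.
Implicit Types (u z b v : R[i]) (n N : nat).
Local Notation ipi := ('i * pi%:C : R[i]).
Local Notation row := (rowpt t).

(** Two opposite terms of the series for zeta(omega1), multiplied by omega1, with [v] in units of
    [2 * omega1]; see [zeta_term_pair]. *)
Definition zpair v : R[i] := (1 - 2 * v)^-1 + (1 + 2 * v)^-1 + (2 * v ^+ 2)^-1.

Lemma sqr_le_sqr_1B2 (p : int) : (p%:~R ^+ 2 <= (1 - 2 * p%:~R) ^+ 2 :> R).
Proof.
have [p1|p0] := leP 1 p.
  have : 1 <= p%:~R :> R by rewrite ler1z.
  nra.
have : p%:~R <= 0 :> R by rewrite lerz0 -ltzD1.
nra.
Qed.

Lemma one_plus_2Complex (a b : R) : 1 + 2 * Complex a b = Complex (1 + 2 * a) (2 * b).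
Proof.
rewrite mulr_natl mulr2n; apply/eqP; rewrite eq_complex /=.
by apply/andP; split; apply/eqP; ring.
Qed.

(** The imaginary part doubles in absolute value, and [p ^ 2 <= (1 - 2 p) ^ 2] because [p] is an
    integer. *)
Lemma cabs_rowpt_le_1B2 (p : int) n : cabs (row p n) <= cabs (1 - 2 * row p n).
Proof.
have -> : 1 - 2 * row p n = 1 + 2 * Complex (- p%:~R) (- (t * n.+1%:R)).
  by rewrite -mulrN rowptE; congr (1 + 2 * _); apply/eqP; rewrite eq_complex /= !eqxx.
rewrite one_plus_2Complex.
rewrite -(@ler_pXn2r _ 2) ?nnegrE ?cabs_ge0 // sqr_cabs_rowpt sqr_cabs /=.
have := sqr_le_sqr_1B2 p; have := sqr_ge0 (t * n.+1%:R).
set a := p%:~R; set b := n.+1%:R; lra.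
Qed.

Lemma cabs_rowpt_le_1D2 (p : int) n : cabs (row p n) <= cabs (1 + 2 * row p n).
Proof.
have -> : cabs (row p n) = cabs (row (- p) n).
  by apply/eqP; rewrite -(@eqrXn2 _ 2) ?cabs_ge0 // !sqr_cabs_rowpt mulrNz sqrrN.
apply: le_trans (cabs_rowpt_le_1B2 _ _) _.
have -> : 1 - 2 * row (- p) n = 1 + 2 * Complex p%:~R (- (t * n.+1%:R)).
  rewrite -mulrN rowptE; congr (1 + 2 * _); apply/eqP.
  by rewrite eq_complex /= mulrNz opprK !eqxx.
rewrite rowptE !one_plus_2Complex.
rewrite -(@ler_pXn2r _ 2) ?nnegrE ?cabs_ge0 // !sqr_cabs /=.
by rewrite mulrN sqrrN.
Qed.

(** Over a common denominator the three terms collapse to [1 / (2 v ^ 2 (1 - 2 v) (1 + 2 v))]. *)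
Lemma cabs_zpair_le (p : int) n : cabs (zpair (row p n)) <= (cabs (row p n) ^+ 4)^-1.
Proof.
have v0 : 0 < cabs (row p n) by rewrite cabs_gt0 rowpt_neq0.
have hB := cabs_rowpt_le_1B2 p n; have hD := cabs_rowpt_le_1D2 p n.
have B0 : 1 - 2 * row p n != 0 by rewrite -cabs_gt0 (lt_le_trans v0).
have D0 : 1 + 2 * row p n != 0 by rewrite -cabs_gt0 (lt_le_trans v0).
have -> : zpair (row p n) = (2 * row p n ^+ 2 * ((1 - 2 * row p n) * (1 + 2 * row p n)))^-1.
  rewrite /zpair; have := rowpt_neq0 t_gt0 p n.
  move: (row p n) B0 D0 => v B0 D0 vn.
  by field; rewrite vn B0 D0.
have d0 : 0 < cabs (row p n) ^+ 2 * (cabs (row p n) * cabs (row p n)).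
  by rewrite !mulr_gt0.
rewrite cabsV !cabsM cabs_nat.
have -> : cabs (row p n) ^+ 4 = cabs (row p n) ^+ 2 * (cabs (row p n) * cabs (row p n)).
  by ring.
have le1 : cabs (row p n) ^+ 2 * (cabs (row p n) * cabs (row p n)) <=
    2 * (cabs (row p n) * cabs (row p n)) * (cabs (1 - 2 * row p n) * cabs (1 + 2 * row p n)).
  apply: ler_pM; rewrite ?mulr_ge0 ?cabs_ge0 //; last by apply: ler_pM; rewrite ?cabs_ge0.
  by rewrite expr2; apply: ler_peMl; rewrite ?mulr_ge0 ?cabs_ge0 // ler1n.
by rewrite lef_pV2 // posrE // (lt_le_trans d0).
Qed.

Definition zetarow n N : R[i] := \sum_(p < N.*2.+1) zpair (row (p%:Z - N%:Z) n).

Lemma zetarow_le : exists2 C : R, 0 < C & forall n N, cabs (zetarow n N) <= C * (n.+1%:R ^+ 2)^-1.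
Proof.
have [C C0 hC] := row_majorant t_gt0; exists C => // n N.
apply: le_trans (cabs_sum _ _ _) _; apply: le_trans (hC n N).
by apply: ler_sum => p _; exact: cabs_zpair_le.
Qed.

(** For [s = 1] and [s = -1] these are the boundary terms of the telescoping in [zetarow_cvg]. *)
Lemma ccvg_inv_shift (s : R[i]) (b : R) : s ^+ 2 = 1 -> complex.Im s = 0 ->
  ccvg (fun N => (s * N.*2.+1%:R + 2 * Complex 0 b)^-1) 0.
Proof.
case: s => a c /= s2 c0; rewrite {}c0 in s2 *.
apply: (@ccvg_majorant _ (fun N => N.+1%:R^-1)) => [N|]; last exact: cvg_harmonic.
rewrite subr0 cabsV -[N.*2.+1%:R](rmorph_nat (real_complex R)).
have a1 : `|a| = 1.
  apply/eqP; rewrite -(@eqrXn2 _ 2) // expr1n real_normK ?num_real //.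
  by move: s2 => /eqP; rewrite eq_complex /= mulr0 subr0 => /andP[+ _]; rewrite -expr2.
have h : N.*2.+1%:R <= cabs (Complex a 0 * (N.*2.+1%:R)%:C + 2 * Complex 0 b).
  have -> : Complex a 0 * (N.*2.+1%:R)%:C + 2 * Complex 0 b = Complex (a * N.*2.+1%:R) (2 * b).
    rewrite [2 * Complex _ _]mulr_natl mulr2n; apply/eqP; rewrite eq_complex /=.
    by apply/andP; split; apply/eqP; ring.
  by apply: le_trans (cabs_ge_Re _); rewrite normrM a1 mul1r normr_nat.
have n0 : (0 : R) < N.*2.+1%:R by rewrite ltr0n.
rewrite lef_pV2 ?posrE ?ltr0n // ?(lt_le_trans n0) //.
by apply: le_trans h; rewrite ler_nat ltnS -addnn leq_addr.
Qed.

(** Only the quadratic term of [zpair] survives in the limit; this is what identifies eta1 with an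
    Eisenstein sum. *)
Lemma zetarow_cvg n : ccvg (zetarow n) (2^-1 * rowsum_lim t n).
Proof.
pose b : R[i] := 'i * t%:C * n.+1%:R.
have bE : b = Complex 0 (t * n.+1%:R).
  by have := rowptE t 0 n; rewrite /rowpt !mulr0z add0r.
(* The two nonquadratic terms of [zpair] telescope along the row. *)
pose a (p : int) := (1 + 2 * (p%:~R + b))^-1.
have E N : zetarow n N = (a N%:Z - a (- (N.+1)%:Z)) + 2^-1 * rowsum t n N.
  rewrite /zetarow big_split /= /rowsum mulr_sumr; congr (_ + _); last first.
    by apply: eq_bigr => p _; rewrite invfM.
  pose f k := a (k%:Z - (N.+1)%:Z).
  rewrite (eq_bigr (fun p : 'I_N.*2.+1 => f p.+1 - f p)) => [|p _].
    rewrite -(big_mkord xpredT (fun p => f p.+1 - f p)) telescope_sumr // /f.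
    by congr (a _ - a _); lia.
  rewrite addrC /f /a /rowpt -/b; congr (_^-1 + _).
    by congr (1 + 2 * (_%:~R + _)); lia.
  rewrite -invrN; congr (_^-1).
  have -> : p%:Z - N.+1%:Z = (p%:Z - N%:Z) - 1 by lia.
  by rewrite [(_ - 1)%:~R]intrB; ring.
have h1 : ccvg (fun N => a N%:Z) 0.
  apply: (ccvg_eq _ (@ccvg_inv_shift 1 (t * n.+1%:R) _ _)); rewrite ?expr1n // => N.
  by rewrite /a -bE -addnn -natr1 natrD; congr (_^-1); rewrite -pmulrn; ring.
have h2 : ccvg (fun N => a (- (N.+1)%:Z)) 0.
  apply: (ccvg_eq _ (@ccvg_inv_shift (-1) (t * n.+1%:R) _ _));
    rewrite ?sqrrN ?expr1n ?oppr0 //=; last first.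
    by rewrite oppr0.
  move=> N.
  by rewrite /a -bE -addnn -natr1 natrD mulrNz -pmulrn -natr1; congr (_^-1); ring.
have -> : 2^-1 * rowsum_lim t n = (0 - 0) + 2^-1 * rowsum_lim t n by ring.
by apply: (ccvg_eq _ (ccvgD (ccvgB h1 h2) (ccvgZ 2^-1 (rowsumP t_gt0 n)))) => N; rewrite E.
Qed.

End ZetaRows.

(** * Assembling the rows *)

Section SigmaProduct.
Variables (R : realType) (omega1 y : R).
Hypotheses (omega1_gt0 : 0 < omega1) (y_gt0 : 0 < y).
Implicit Types (u z v l : R[i]) (n N : nat).
Local Notation ipi := ('i * pi%:C : R[i]).
Local Notation omega3 := ('i * y%:C : R[i]).
Local Notation w1 := (omega1%:C : R[i]).
Let t : R := y / omega1.
Let t_gt0 : 0 < t. Proof. by rewrite divr_gt0. Qed.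

Let w1_neq0 : w1 != 0.
Proof. by rewrite -cabs_gt0 cabs_real normr_gt0 gt_eqF. Qed.

Lemma lattice_ptE (p q : int) :
  lattice_pt w1 omega3 p q = 2 * w1 * (p%:~R + 'i * t%:C * q%:~R).
Proof. by rewrite /lattice_pt /t rmorphM fmorphV /=; field. Qed.

Lemma lattice_pt_eq0 (p q : int) :
  (lattice_pt w1 omega3 p q != 0) = (p != 0) || (q != 0).
Proof.
rewrite lattice_ptE !mulf_eq0 pnatr_eq0 (negbTE w1_neq0) /= -negb_and; congr (~~ _).
rewrite -[p%:~R](rmorph_int (real_complex R)) -[q%:~R](rmorph_int (real_complex R)).
have -> : (p%:~R)%:C + 'i * t%:C * (q%:~R)%:C = Complex p%:~R (t * q%:~R) :> R[i].
  by apply/eqP; rewrite eq_complex /=; apply/andP; split; apply/eqP; ring.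
by rewrite eq_complex /= mulf_eq0 !intr_eq0 (gt_eqF t_gt0).
Qed.

(** Between opposite points the linear exponents [z / l] cancel and the quadratic ones add up. *)
Lemma sigma_factor_pair z v :
  sigma_factor z (2 * w1 * v) * sigma_factor z (- (2 * w1 * v))
  = wfactor ((z / (2 * w1)) ^+ 2 / v ^+ 2).
Proof.
have -> : (z / (2 * w1)) ^+ 2 / v ^+ 2 = z ^+ 2 / (2 * w1 * v) ^+ 2.
  have -> : (2 * w1 * v) ^+ 2 = (2 * w1) ^+ 2 * v ^+ 2 by ring.
  by rewrite expr_div_n [in RHS]invfM mulrA.
move: (2 * w1 * v) => l.
rewrite /sigma_factor /wfactor mulrACA -cexpD; congr (_ * cexp _).
  by rewrite !invrN -exprVn; ring.
by rewrite sqrrN !invrN ![(2 * _)^-1]invfM -!exprVn; move: l^-1 => L; field.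
Qed.

Lemma zeta_term_pair v :
  zeta_term w1 (2 * w1 * v) + zeta_term w1 (- (2 * w1 * v)) = w1^-1 * zpair v.
Proof.
rewrite /zeta_term /zpair sqrrN invrN.
have -> : w1 - 2 * w1 * v = w1 * (1 - 2 * v) by ring.
have -> : w1 - - (2 * w1 * v) = w1 * (1 + 2 * v) by ring.
have -> : (2 * w1 * v) ^+ 2 = (2 * w1) ^+ 2 * v ^+ 2 by rewrite exprMn.
rewrite ![(_ * v ^+ 2)^-1]invfM -[(v ^+ 2)^-1]exprVn ![(w1 * (_ + _))^-1]invfM.
move: v^-1 (1 - 2 * v)^-1 (1 + 2 * v)^-1 (2 * w1 * v)^-1 => V V1 V2 L.
by field; exact: w1_neq0.
Qed.

Lemma big_box_pt (T : Type) (idx : T) (op : Monoid.com_law idx) N (F : R[i] -> T) :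
  \big[op/idx]_(p < N.*2.+1) \big[op/idx]_(q < N.*2.+1 | box_pt w1 omega3 N p q != 0)
    F (box_pt w1 omega3 N p q)
  = op (\big[op/idx]_(k < N) op (F (2 * w1 * k.+1%:R)) (F (- (2 * w1 * k.+1%:R))))
       (\big[op/idx]_(n < N) \big[op/idx]_(p < N.*2.+1)
          op (F (2 * w1 * rowpt t (p%:Z - N%:Z) n))
             (F (- (2 * w1 * rowpt t (p%:Z - N%:Z) n)))).
Proof.
pose g p q := F (lattice_pt w1 omega3 p q).
rewrite (eq_bigr (fun p : 'I_N.*2.+1 => \big[op/idx]_(q < N.*2.+1 |
    (p%:Z - N%:Z != 0) || (q%:Z - N%:Z != 0)) g (p%:Z - N%:Z) (q%:Z - N%:Z))); last first.
  by move=> p _; apply: eq_bigl => q; rewrite /box_pt lattice_pt_eq0.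
rewrite (big_box _ g); congr (op _ _).
  apply: eq_bigr => k _; rewrite /g !lattice_ptE !mulr0z mulr0 !addr0 mulrNz mulrN.
  by rewrite -pmulrn.
apply: eq_bigr => n _; apply: eq_bigr => p _; rewrite /g !lattice_ptE.
rewrite /rowpt !pmulrn; congr (op _ (F _)).
by rewrite !mulrNz; ring.
Qed.

(* [e0 + eL] is half the Eisenstein sum (row by row) of [1 / (p + i t n) ^ 2]
   over all [(p, n) <> (0, 0)]. *)
Let e0 : R[i] := climit (fun N => \sum_(k < N) (k.+1%:R ^+ 2)^-1).

Let e0P : ccvg (fun N => \sum_(k < N) (k.+1%:R ^+ 2)^-1) e0.
Proof.
apply: climitP; apply: (@ccvg_series R (fun k => (k.+1%:R ^+ 2)^-1)
    (fun k => (k.+1%:R ^+ 2)^-1)); last exact: cvg_series_inv_sqr.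
by move=> k; rewrite cabsV cabsX cabs_nat.
Qed.

Let eL : R[i] := climit (fun N => \sum_(n < N) rowsum_lim t n).

Let eLP : ccvg (fun N => \sum_(n < N) rowsum_lim t n) eL.
Proof.
(* The terms of a row sum are only of order |v|^-2; its decay in [n] is inherited from the zeta
   rows, whose limit is half of it. *)
have [C C0 hC] := zetarow_le t_gt0.
apply: climitP; apply: (@ccvg_series R (rowsum_lim t)
    (fun k => (2 * C) * (k.+1%:R ^+ 2)^-1)); last first.
  by apply: is_cvg_series_scale; exact: cvg_series_inv_sqr.
move=> k.
have -> : rowsum_lim t k = 2 * (2^-1 * rowsum_lim t k) by rewrite mulVKf // pnatr_eq0.
rewrite cabsM cabs_nat -mulrA ler_wpM2l //.
by apply: (ccvg_le (zetarow_cvg t_gt0 k)); apply: nearW => n; exact: hC.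
Qed.

(** The row through 0 telescopes to [1 / (2 N + 1) - 1], apart from its quadratic terms, and the
    [-1] cancels the pole term [w1^-1]. *)
Lemma eta1E : eta1 w1 omega3 = (e0 + eL) / (2 * w1).
Proof.
rewrite /eta1 /weierstrass_zeta; set s := (fun N => _).
suff hs : ccvg s (w1^-1 * (2^-1 * (e0 + eL) - 1)).
  by rewrite -[lim _]/(climit s) (ccvg_climit hs); field.
have sE N : s N = w1^-1 * ((N.*2.+1%:R^-1 - 1 + 2^-1 * \sum_(k < N) (k.+1%:R ^+ 2)^-1)
     + \sum_(n < N) zetarow t n N).
  rewrite /s (big_box_pt _ N (zeta_term w1)) /= mulrDr; congr (_ + _); last first.
    rewrite mulr_sumr; apply: eq_bigr => n _; rewrite mulr_sumr; apply: eq_bigr => p _.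
    exact: zeta_term_pair.
  rewrite (eq_bigr _ (fun k _ => zeta_term_pair _)) -mulr_sumr; congr (_ * _).
  rewrite /zpair big_split /=; congr (_ + _); last first.
    by rewrite mulr_sumr; apply: eq_bigr => k _; rewrite invfM.
  pose f k : R[i] := k.*2.+1%:R^-1.
  rewrite (eq_bigr (fun k : 'I_N => f k.+1 - f k)) => [|k _].
    rewrite -(big_mkord xpredT (fun p => f p.+1 - f p)) telescope_sumr //.
    by rewrite /f invr1.
  rewrite /f addrC -invrN; congr (_^-1 + _^-1).
    by rewrite -[_.*2]addnn -[(_ + _).+1%:R]natr1 natrD; ring.
  by rewrite -[_.*2]addnn -[(_ + _).+1%:R]natr1 natrD -[k.+1%:R]natr1; ring.
have [C C0 hC] := zetarow_le t_gt0.
have hrows : ccvg (fun N => \sum_(n < N) zetarow t n N) (2^-1 * eL).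
  apply: (@ccvg_tannery _ (fun N n => zetarow t n N) (fun n => 2^-1 * rowsum_lim t n)
      (fun n => C * (n.+1%:R ^+ 2)^-1)).
  - by move=> N n _; exact: hC.
  - by apply: is_cvg_series_scale; exact: cvg_series_inv_sqr.
  - by move=> n; exact: zetarow_cvg.
  - by apply: (ccvg_eq _ (ccvgZ 2^-1 eLP)) => N; rewrite mulr_sumr.
have -> : w1^-1 * (2^-1 * (e0 + eL) - 1) = w1^-1 * ((0 - 1 + 2^-1 * e0) + 2^-1 * eL).
  by ring.
apply: (ccvg_eq (fun N => esym (sE N))); apply: ccvgZ; apply: ccvgD => //.
apply: ccvgD; last exact: ccvgZ.
apply: ccvgB (ccvg_cst 1).
by apply: (ccvg_eq _ (ccvg_inv_odd 1)) => N; rewrite mul1r.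
Qed.

Local Notation q := (nomesq t).

Let rows_cvg u (x := cexp (- (2 * (ipi * u)))) :
  ccvg (fun N => \prod_(n < N) rowprod t u n N)
    (qpoch q x * qpoch q x^-1 / qpoch q 1 ^+ 2 * cexp (u ^+ 2 * eL)).
Proof.
have [C C0 hC] := rowprod_sub1_le t_gt0 u.
have q0 := nomesq_neq0 t; have q1 := nomesq_lt1 t_gt0.
pose V n := (1 - x * q ^+ n.+1) * (1 - x^-1 * q ^+ n.+1) / (1 - q ^+ n.+1) ^+ 2
     * cexp (u ^+ 2 * rowsum_lim t n).
have hV : ccvg (fun N => \prod_(n < N) V n)
    (qpoch q x * qpoch q x^-1 / qpoch q 1 ^+ 2 * cexp (u ^+ 2 * eL)).
  have qp1 := qpochP q1 1; have qp1_0 := qpoch1_neq0 q1.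
  have h := ccvgM (ccvgM (ccvgM (qpochP q1 x) (qpochP q1 x^-1))
    (ccvgM (ccvgV qp1 qp1_0) (ccvgV qp1 qp1_0))) (ccvg_cexp (ccvgZ (u ^+ 2) eLP)).
  rewrite [qpoch q 1 ^+ 2]expr2 [(qpoch q 1 * _)^-1]invfM; apply: (ccvg_eq _ h) => N.
  rewrite mulr_sumr cexp_sum -!prodfV -!big_split; apply: eq_bigr => n _ /=.
  by rewrite /V mul1r [(1 - q ^+ _) ^+ 2]expr2 [((1 - q ^+ _) * _)^-1]invfM.
have := @ccvg_prod_tannery R (fun N n => rowprod t u n N - 1) (fun n => V n - 1)
  (fun n => C * (n.+1%:R ^+ 2)^-1) _ (fun N n _ => hC n N) _ _ _.
move=> /(_ (qpoch q x * qpoch q x^-1 / qpoch q 1 ^+ 2 * cexp (u ^+ 2 * eL))).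
move=> H; apply: (ccvg_eq _ (H _ _ _)) => [N||n|].
- by apply: eq_bigr => n _; rewrite addrC subrK.
- by apply: is_cvg_series_scale; exact: cvg_series_inv_sqr.
- by apply: ccvgB (ccvg_cst 1); exact: ccvg_rowprod.
- by apply: (ccvg_eq _ hV) => N; apply: eq_bigr => n _; rewrite addrC subrK.
Qed.

(** The row through 0 gives [sinpi u], whose exponential form supplies [exp(i pi u)] and the factor
    [1 - x] of theta; the other rows give the q-products. The quadratic exponents add up to
    [u ^ 2 (e0 + eL)], which [eta1E] expresses by eta1. *)
Lemma weierstrass_sigmaE z (u := z / (2 * w1)) (x := cexp (- (2 * (ipi * u)))) :
  weierstrass_sigma w1 omega3 z
  = cexp (z ^+ 2 * (eta1 w1 omega3 / (2 * w1)) + ipi * u) * (w1 / ipi) * theta q x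
    / qpoch q 1 ^+ 2.
Proof.
have [l hl] : exists l, ccvg (fun N => \prod_(k < N) (1 - u ^+ 2 / k.+1%:R ^+ 2)) l.
  have [||l hl] := @ccvg_inf_prod R (fun k => - (u ^+ 2 / k.+1%:R ^+ 2))
    (fun k => cabs u ^+ 2 * (k.+1%:R ^+ 2)^-1).
  - by move=> k; rewrite cabsN cabsM cabsV !cabsX cabs_nat.
  - by apply: is_cvg_series_scale; exact: cvg_series_inv_sqr.
  by exists l.
have ul : u * l = sinpi u by exact: ccvg_unique (ccvgZ u hl) (sine_product u).
rewrite /weierstrass_sigma; set s := (fun N => _).
have sE N : s N = (\prod_(k < N) (1 - u ^+ 2 / k.+1%:R ^+ 2)
      * cexp (u ^+ 2 * \sum_(k < N) (k.+1%:R ^+ 2)^-1)) * \prod_(n < N) rowprod t u n N.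
  rewrite /s (big_box_pt _ N (sigma_factor z)) /=; congr (_ * _); last first.
    by apply: eq_bigr => n _; apply: eq_bigr => p _; exact: sigma_factor_pair.
  rewrite mulr_sumr cexp_sum -big_split; apply: eq_bigr => k _ /=.
  by rewrite sigma_factor_pair.
have hs : ccvg s (l * cexp (u ^+ 2 * e0)
    * (qpoch q x * qpoch q x^-1 / qpoch q 1 ^+ 2 * cexp (u ^+ 2 * eL))).
  apply: (ccvg_eq (fun N => esym (sE N))); apply: ccvgM; last exact: rows_cvg.
  by apply: ccvgM => //; apply: ccvg_cexp; exact: ccvgZ.
rewrite -[lim _]/(climit s) (ccvg_climit hs).
have zu : z = 2 * w1 * u by rewrite /u mulrC divfK // mulf_neq0 ?pnatr_eq0.
have -> : z ^+ 2 * (eta1 w1 omega3 / (2 * w1)) = u ^+ 2 * e0 + u ^+ 2 * eL.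
  by rewrite eta1E zu; field; exact: w1_neq0.
rewrite !cexpD /theta; rewrite {1}zu.
have := sinpiE u; rewrite -/x -ul => hul.
have I0 := @ipi_neq0 R.
have -> : 2 * w1 * u * (l * cexp (u ^+ 2 * e0)
    * (qpoch q x * qpoch q x^-1 / qpoch q 1 ^+ 2 * cexp (u ^+ 2 * eL)))
  = 2 * w1 * (u * l) * (cexp (u ^+ 2 * e0)
    * (qpoch q x * qpoch q x^-1 / qpoch q 1 ^+ 2 * cexp (u ^+ 2 * eL))) by ring.
rewrite hul invfM.
move: (qpoch q 1 ^+ 2)^-1 (ipi) I0 => Qi J J0.
by field.
Qed.

End SigmaProduct.

(** * Moments *)

Section Moments.
Variables (R : realType) (omega1 y : R).
Hypotheses (omega1_gt0 : 0 < omega1) (y_gt0 : 0 < y).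
Local Notation ipi := ('i * pi%:C : R[i]).
Local Notation omega3 := ('i * y%:C : R[i]).
Local Notation w1 := (omega1%:C : R[i]).
Local Notation eta := (eta1 w1 omega3).
Local Notation sigma := (weierstrass_sigma w1 omega3).
Local Notation q := (nomesq (y / omega1)).
Implicit Types (z x : R[i]).

Let t_gt0 : 0 < y / omega1. Proof. by rewrite divr_gt0. Qed.
Let q_neq0 := nomesq_neq0 (y / omega1).
Let q_lt1 := nomesq_lt1 t_gt0.

Let w1_neq0 : w1 != 0.
Proof. by rewrite -cabs_gt0 cabs_real normr_gt0 gt_eqF. Qed.

Definition expw z : R[i] := cexp (- (ipi * z / w1)).

Lemma expwD z1 z2 : expw (z1 + z2) = expw z1 * expw z2.
Proof. by rewrite /expw -cexpD; congr cexp; field; exact: w1_neq0. Qed.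

Lemma expw_neq0 z : expw z != 0. Proof. exact: cexp_neq0. Qed.

Lemma sigmaE z : sigma z
  = cexp (z ^+ 2 * (eta / (2 * w1)) + ipi * z / (2 * w1)) * (w1 / ipi)
    * theta q (expw z) / qpoch q 1 ^+ 2.
Proof.
rewrite weierstrass_sigmaE //.
have -> : cexp (- (2 * (ipi * (z / (2 * w1))))) = expw z.
  by congr (cexp (- _)); field; exact: w1_neq0.
by rewrite [ipi * (z / _)]mulrA.
Qed.

Lemma cexp_eq1 z : cexp z = 1 -> exists n : int, z = 2 * ipi * n%:~R.
Proof.
move=> h; have := cabs_cexp z; rewrite h cabs1 -expR0 => /expR_inj re0.
have zE : z = 'i * (complex.Im z)%:C.
  by rewrite [LHS]complexE -re0 add0r.
move: h; rewrite zE => /cexp_i_eq1 [n hn]; exists n.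
by rewrite hn !rmorphM /= rmorph_nat rmorph_int; ring.
Qed.

(** By the kernel of the exponential, an equality would exhibit [z] as the lattice point of
    coordinates [- k] and [n]. *)
Lemma expw_lattice z : ~ lattice w1 omega3 z -> forall n : int, expw z * q ^ n != 1.
Proof.
move=> hz n; apply/eqP => h; apply: hz.
have : cexp (- (ipi * z / w1) + 2 * (ipi * ('i * (y / omega1)%:C)) * n%:~R) = 1.
  by rewrite cexpD cexpMz.
move=> /cexp_eq1 [k hk]; exists (- k), n; rewrite /lattice_pt.
have I0 := @ipi_neq0 R.
have -> : z = w1 / ipi * (2 * (ipi * ('i * (y / omega1)%:C)) * n%:~R
    - (- (ipi * z / w1) + 2 * (ipi * ('i * (y / omega1)%:C)) * n%:~R)).
  by move: ('i * _%:C) (ipi) I0 => Y J J0; field; rewrite w1_neq0 J0.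
rewrite hk rmorphM fmorphV /= mulrNz; move: (ipi) I0 => J J0.
by field; rewrite w1_neq0 J0.
Qed.

Lemma sigma_neq0 z : ~ lattice w1 omega3 z -> sigma z != 0.
Proof.
move=> hz; rewrite sigmaE; apply: mulf_neq0.
  apply: mulf_neq0; last first.
    by apply: theta_neq0; [exact: q_lt1|exact: expw_neq0|exact: expw_lattice].
  apply: mulf_neq0; first exact: cexp_neq0.
  by apply: mulf_neq0; [exact: w1_neq0|rewrite invr_eq0 ipi_neq0].
by rewrite invr_eq0 expf_neq0 // qpoch1_neq0.
Qed.

(** [expw] has period [2 * w1], so theta is unchanged and the multiplier comes from the Gaussian
    factor alone; the sign is [exp(i pi)]. *)
Lemma sigma_period z : sigma (z + 2 * w1) = - cexp (2 * eta * (z + w1)) * sigma z.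
Proof.
have I0 := @ipi_neq0 R.
have -> : - cexp (2 * eta * (z + w1)) = cexp (2 * eta * (z + w1) + ipi) :> R[i].
  by rewrite cexpD cexp_ipi mulrN1.
have h1 : expw (2 * w1) = 1.
  rewrite /expw; have -> : ipi * (2 * w1) / w1 = 2 * ipi by field; exact: w1_neq0.
  by rewrite cexpN cexp_2ipi invr1.
rewrite !sigmaE expwD h1 mulr1.
have -> : cexp ((z + 2 * w1) ^+ 2 * (eta / (2 * w1)) + ipi * (z + 2 * w1) / (2 * w1))
    = cexp (2 * eta * (z + w1) + ipi) * cexp (z ^+ 2 * (eta / (2 * w1)) + ipi * z / (2 * w1)).
  by rewrite -cexpD; congr cexp; field; exact: w1_neq0.
by rewrite -!mulrA.
Qed.

(* The left-hand side is the Kronecker function; for [a] in the strip the two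
   series together are its Fourier series. *)
Lemma sigma_quotient a b : expR (- (2 * pi * (y / omega1))) < cabs (expw a) < 1 ->
  ~ lattice w1 omega3 b -> exists G1 G2,
    [/\ ccvg (fun n => \sum_(k < n) expw a ^+ k / (1 - expw b * q ^+ k)) G1,
        ccvg (fun n => \sum_(k < n) expw a ^- k.+1 / (1 - expw b * q ^- k.+1)) G2 &
        sigma (a + b) / (sigma a * sigma b) = cexp (a * b * eta / w1) * (ipi / w1) * (G1 + G2)].
Proof.
move=> ha hb.
have qE : cabs q = expR (- (2 * pi * (y / omega1))).
  by rewrite nomesqE cabs_real ger0_norm // expR_ge0.
have ha' : cabs q < cabs (expw a) < 1 by rewrite qE.
have [G1 [G2 [h1 h2 E]]] := theta_partial_fractions q_neq0 q_lt1 ha'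
  (expw_neq0 b) (expw_lattice hb).
exists G1, G2; split => //.
have tb0 : theta q (expw b) != 0.
  by apply: theta_neq0; [exact: q_lt1|exact: expw_neq0|exact: expw_lattice].
have ta0 : theta q (expw a) != 0.
  apply: theta_neq0; [exact: q_lt1|exact: expw_neq0|].
  exact: annulus_neq1 ha'.
have p0 : qpoch q 1 != 0 by exact: qpoch1_neq0.
have {}E : theta q (expw (a + b))
    = theta q (expw b) * theta q (expw a) * (G1 + G2) / qpoch q 1 ^+ 2.
  by rewrite -E mulfK ?expf_neq0 // expwD.
rewrite !sigmaE E.
have -> : cexp ((a + b) ^+ 2 * (eta / (2 * w1)) + ipi * (a + b) / (2 * w1))
    = cexp (a * b * eta / w1) * cexp (a ^+ 2 * (eta / (2 * w1)) + ipi * a / (2 * w1))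
      * cexp (b ^+ 2 * (eta / (2 * w1)) + ipi * b / (2 * w1)).
  by rewrite -!cexpD; congr cexp; field; exact: w1_neq0.
set A := cexp (a ^+ 2 * (eta / (2 * w1)) + ipi * a / (2 * w1)).
set B := cexp (b ^+ 2 * (eta / (2 * w1)) + ipi * b / (2 * w1)).
set D := cexp (a * b * eta / w1).
have A0 : A != 0 by exact: cexp_neq0.
have B0 : B != 0 by exact: cexp_neq0.
have J0 := @ipi_neq0 R.
move: A B D A0 B0 => A B D A0 B0; move: (ipi) J0 => J J0.
move: (theta q (expw b)) (theta q (expw a)) (qpoch q 1) tb0 ta0 p0 => T1 T2 p T10 T20 p0.
by field; rewrite J0 T10 T20 p0 A0 B0 w1_neq0.
Qed.

End Moments.

(** * Moments as sums over the masses *)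

Section MomentExpansion.
Variables (R : realType) (omega1 y w alpha0 nu : R) (alpha beta gamma : R[i]) (j m : int).
Local Notation ipi := ('i * pi%:C : R[i]).
Local Notation omega3 := ('i * y%:C : R[i]).
Local Notation w1 := (omega1%:C : R[i]).
Local Notation eta := (eta1 w1 omega3).
Local Notation sigma := (weierstrass_sigma w1 omega3).
Local Notation q := (nomesq (y / omega1)).
Hypotheses (omega1_gt0 : 0 < omega1) (y_gt0 : 0 < y).
Hypotheses (alphaE : alpha = - alpha0%:C - 2 * nu%:C * omega3).
Hypotheses (nu_bounds : 0 < nu < 1) (beta_lattice : ~ lattice w1 omega3 beta).
Hypotheses (j_ge1 : 1 <= j)
  (period_cond : j%:~R * (w1 * gamma + eta * beta) = ipi * m%:~R).

Let w1_neq0 : w1 != 0.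
Proof. by rewrite -cabs_gt0 cabs_real normr_gt0 gt_eqF. Qed.

Let j_neq0 : j%:~R != 0 :> R[i].
Proof. by rewrite intr_eq0 gt_eqF // (lt_le_trans _ j_ge1). Qed.

Let h := nome omega1 omega3.

Lemma nomeE : h = expR (- (pi * (y / omega1))).
Proof.
rewrite /h /nome.
have -> : ipi * omega3 / w1 = (- (pi * (y / omega1)))%:C.
  have -> : ipi * omega3 / w1 = 'i ^+ 2 * (pi%:C * (y%:C / w1)) by ring.
  by rewrite sqr_i mulN1r rmorphN !rmorphM fmorphV.
by rewrite cexp_real.
Qed.

Lemma nomeC : h%:C = cexp (ipi * omega3 / w1).
Proof.
rewrite nomeE -cexp_real; congr cexp.
have -> : ipi * omega3 / w1 = 'i ^+ 2 * (pi%:C * (y%:C / w1)) by ring.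
by rewrite sqr_i mulN1r rmorphN !rmorphM fmorphV.
Qed.

Lemma nome_powR (r : R) : (h `^ r)%:C = cexp (r%:C * (ipi * omega3 / w1)).
Proof.
rewrite /powR nomeE gt_eqF ?expR_gt0 // expRK -cexp_real; congr cexp.
rewrite rmorphM; congr (_ * _).
have -> : ipi * omega3 / w1 = 'i ^+ 2 * (pi%:C * (y%:C / w1)) by ring.
by rewrite sqr_i mulN1r rmorphN !rmorphM fmorphV.
Qed.

Lemma nome_exprz (k : int) : (h ^ (- (2 * k)))%:C = q ^ (- k).
Proof.
have h0 : h != 0 by rewrite nomeE gt_eqF ?expR_gt0.
rewrite rmorphXz ?unitfE //= nomeC -cexpMz /nomesq -cexpMz; congr cexp.
rewrite !mulrNz intrM rmorphM fmorphV /=; ring.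
Qed.

Definition mass_term (k n : int) : R[i] :=
  mass_at omega1 omega3 alpha0 nu alpha beta gamma k * mass_pt omega1 w j (m + j * k) ^ n.

(** With [gamma] eliminated by the period condition, [exp((gamma + eta1 beta / omega1) w n)] is
    [exp(i pi m w n / (j omega1))], which joins [exp(i pi k w n / omega1)] into the n-th power of
    the point of index [m + j k]. The mass of index [k] is the term of index [- k] of the Kronecker
    series. *)
Lemma mass_termE (k n : int) (a := w%:C * n%:~R + alpha) :
  mass_term k n = cexp (gamma * a + a * beta * eta / w1) * (ipi / w1)
    * (expw omega1 a ^ (- k) / (1 - expw omega1 beta * q ^ (- k))).
Proof.
have sb : sigma beta != 0 by exact: sigma_neq0.
rewrite /mass_term /mass_at /mass_R0 /kappa -/h nome_exprz nome_powR divfK //.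
have -> : mass_pt omega1 w j (m + j * k) ^ n
    = cexp (ipi * (m%:~R + j%:~R * k%:~R) * w%:C / (j%:~R * w1) * n%:~R).
  by rewrite /mass_pt -cexpMz intrD intrM.
have -> : expw omega1 a ^ (- k) = cexp (ipi * a / w1 * k%:~R).
  by rewrite /expw -cexpMz mulrNz mulrNN.
rewrite -/(expw omega1 beta).
move: (1 - _)^-1 => D.
have E : cexp (gamma * alpha) * cexp (alpha * beta * eta / w1)
    * cexp (- (ipi * alpha0%:C * k%:~R / w1))
    * cexp ((- (2 * nu * k%:~R))%:C * (ipi * omega3 / w1))
    * cexp (ipi * (m%:~R + j%:~R * k%:~R) * w%:C / (j%:~R * w1) * n%:~R)
  = cexp (gamma * a + a * beta * eta / w1) * cexp (ipi * a / w1 * k%:~R).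
  rewrite -!cexpD; congr cexp.
  have -> : gamma = (ipi * m%:~R / j%:~R - eta * beta) / w1.
    by rewrite -period_cond; field; rewrite w1_neq0 j_neq0.
  rewrite /a alphaE rmorphN !rmorphM /= rmorph_int rmorph_nat.
  move: (ipi) (omega3) (eta1 _ _) => J O H; field.
  by rewrite w1_neq0 j_neq0.
rewrite [RHS](_ : _ = cexp (gamma * a + a * beta * eta / w1) * cexp (ipi * a / w1 * k%:~R)
  * (ipi / w1) * D); last by ring.
rewrite -E.
move: (cexp _) (cexp _) (cexp _) (cexp _) (cexp _) => A1 A2 A3 A4 A5.
by field; exact: w1_neq0.
Qed.

(** For real [x] only the imaginary part of alpha counts; the value is [h ^ (2 nu)]. *)
Lemma cabs_expw_strip (x : R) :
  cabs (expw omega1 (x%:C + alpha)) = expR (- (2 * pi * (nu * (y / omega1)))).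
Proof.
rewrite /expw.
have -> : - (ipi * (x%:C + alpha) / w1) = Complex (- (2 * pi * (nu * (y / omega1))))
    (- (pi * (x - alpha0) / omega1)).
  have -> : - (ipi * (x%:C + alpha) / w1)
      = 2 * pi%:C * (nu%:C * (y%:C / w1)) * 'i ^+ 2 - 'i * (pi%:C * (x%:C - alpha0%:C) / w1).
    by rewrite alphaE; ring.
  rewrite sqr_i -[2](rmorph_nat (real_complex R)) -fmorphV -rmorphB -!rmorphM /=.
  by apply/eqP; rewrite eq_complex /=; apply/andP; split; apply/eqP; ring.
by rewrite cabs_cexp.
Qed.

Lemma strip_bounds (x : R) :
  expR (- (2 * pi * (y / omega1))) < cabs (expw omega1 (x%:C + alpha)) < 1.
Proof.
have t0 : 0 < 2 * pi * (y / omega1) by rewrite !mulr_gt0 ?pi_gt0 ?invr_gt0.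
case/andP: nu_bounds => n0 n1.
rewrite cabs_expw_strip -[X in _ && (_ < X)]expR0 !ltr_expR ltrN2 oppr_lt0.
have -> : 2 * pi * (nu * (y / omega1)) = nu * (2 * pi * (y / omega1)) by ring.
by rewrite gtr_pMl // n1 mulr_gt0.
Qed.

Let wC (n : int) : w%:C * n%:~R = (w * n%:~R)%:C :> R[i].
Proof. by rewrite rmorphM /= rmorph_int. Qed.

Lemma moment_expansion (n : int) : exists S1 S2,
  [/\ ccvg (fun N => \sum_(k < N) mass_term (- k%:Z) n) S1,
      ccvg (fun N => \sum_(k < N) mass_term (k.+1)%:Z n) S2 &
      elliptic_moment omega1 omega3 alpha beta gamma w n = S1 + S2].
Proof.
pose a := w%:C * n%:~R + alpha.
have ha : expR (- (2 * pi * (y / omega1))) < cabs (expw omega1 a) < 1.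
  by rewrite /a wC strip_bounds.
have [G1 [G2 [h1 h2 E]]] := sigma_quotient omega1_gt0 y_gt0 ha beta_lattice.
pose K := cexp (gamma * a + a * beta * eta / w1) * (ipi / w1).
exists (K * G1), (K * G2); split.
- apply: (ccvg_eq _ (ccvgZ K h1)) => N; rewrite mulr_sumr; apply: eq_bigr => k _.
  by rewrite mass_termE !opprK.
- apply: (ccvg_eq _ (ccvgZ K h2)) => N; rewrite mulr_sumr; apply: eq_bigr => k _.
  by rewrite mass_termE -!exprnN.
have sb : sigma beta != 0 by exact: sigma_neq0.
rewrite -mulrDr /elliptic_moment /elliptic_f /kappa -/a.
have -> : cexp (gamma * alpha) / sigma beta * (sigma (a + beta) / sigma a)
    * cexp (gamma * (w%:C * n%:~R))
  = cexp (gamma * alpha) * cexp (gamma * (w%:C * n%:~R))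
    * (sigma (a + beta) / (sigma a * sigma beta)).
  by rewrite [(sigma a * sigma beta)^-1]invfM; ring.
rewrite E /K cexpD -cexpD -mulrDr [alpha + _]addrC -/a; ring.
Qed.

Lemma mass_at_term (k : int) :
  mass_at omega1 omega3 alpha0 nu alpha beta gamma k = mass_term k 0.
Proof. by rewrite /mass_term expr0z mulr1. Qed.

Lemma mass_at_neq0 (k : int) : mass_at omega1 omega3 alpha0 nu alpha beta gamma k != 0.
Proof.
rewrite mass_at_term mass_termE; apply: mulf_neq0; last first.
  apply: mulf_neq0; first by rewrite expfz_neq0 // expw_neq0.
  by rewrite invr_eq0 subr_eq0 eq_sym expw_lattice.
apply: mulf_neq0; first exact: cexp_neq0.
by apply: mulf_neq0; rewrite ?invr_eq0 ?ipi_neq0 ?w1_neq0.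
Qed.

(** The masses are the terms of the expansion at [n = 0], where [theta_terms_le] gives geometric
    bounds. *)
Lemma mass_at_le : exists C r : R, 0 <= r < 1 /\ forall k : nat,
  cabs (mass_at omega1 omega3 alpha0 nu alpha beta gamma (- k%:Z)) <= C * r ^+ k /\
  cabs (mass_at omega1 omega3 alpha0 nu alpha beta gamma (k.+1)%:Z) <= C * r ^+ k.
Proof.
pose a := w%:C * (0 : int)%:~R + alpha.
have t0 : 0 < y / omega1 by rewrite divr_gt0.
have ha : cabs q < cabs (expw omega1 a) < 1.
  rewrite nomesqE cabs_real ger0_norm ?expR_ge0 // /a wC; exact: strip_bounds.
have [C [r [r01 hC]]] := theta_terms_le (nomesq_neq0 _) (nomesq_lt1 t0) ha
  (expw_neq0 omega1 beta) (expw_lattice omega1_gt0 beta_lattice).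
pose K := cexp (gamma * a + a * beta * eta / w1) * (ipi / w1).
exists (cabs K * C), r; split => // k; have [h1 h2] := hC k; split.
  rewrite mass_at_term mass_termE -/a -/K !opprK -!exprnP cabsM -mulrA.
  by apply: ler_wpM2l; rewrite ?cabs_ge0.
rewrite mass_at_term mass_termE -/a -/K -!exprnN cabsM -mulrA.
by apply: ler_wpM2l; rewrite ?cabs_ge0.
Qed.

End MomentExpansion.

(** * Biorthogonality *)

Section Biorthogonality.
Variables (F : fieldType) (c : int -> F).

Lemma toeplitz_det_opp n : toeplitz_det (fun k => c (- k)) n = toeplitz_det c n.
Proof.
rewrite /toeplitz_det -det_tr; congr (\det _).
by apply/matrixP => i k; rewrite !mxE opprB.
Qed.

(** This transfers every property of [lbp] to the partners; the Toeplitz matrix is merely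
    transposed. *)
Lemma lbp_partnerE n : lbp_partner c n = lbp (fun k => c (- k)) n.
Proof.
rewrite /lbp_partner /lbp toeplitz_det_opp; congr (_ *: \det _).
by apply/matrixP => i k; rewrite !mxE opprB.
Qed.

(** The matrix behind [lbp] with a scalar last row; the cofactors of that row do not depend on
    it. *)
Definition border_mx n (g : 'I_n.+1 -> F) : 'M[F]_n.+1 :=
  \matrix_(i < n.+1, k < n.+1) if (i < n)%N then c (k%:Z - i%:Z) else g k.

Lemma lift_max_lt n (i : 'I_n) : (lift ord_max i < n)%N.
Proof. by rewrite lift_max. Qed.

Lemma cofactor_border_mx n (g g' : 'I_n.+1 -> F) k :
  cofactor (border_mx g) ord_max k = cofactor (border_mx g') ord_max k.
Proof.
rewrite /cofactor; congr (_ * \det _).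
by apply/matrixP => i l; rewrite !mxE lift_max_lt.
Qed.

Lemma lbp_expand n : lbp c n = \sum_(k < n.+1)
  ((toeplitz_det c n)^-1 * cofactor (border_mx (fun=> 0)) ord_max k) *: 'X^k.
Proof.
rewrite /lbp (expand_det_row _ ord_max) scaler_sumr; apply: eq_bigr => k _.
rewrite mxE /= ltnn -scalerA; congr (_ *: _); rewrite mulrC -mul_polyC; congr (_ * _).
rewrite /cofactor rmorphM rmorphXn rmorphN rmorph1 -det_map_mx; congr (_ * \det _).
by apply/matrixP => i l; rewrite !mxE lift_max_lt.
Qed.

Lemma coef_lbp n (k : 'I_n.+1) :
  (lbp c n)`_k = (toeplitz_det c n)^-1 * cofactor (border_mx (fun=> 0)) ord_max k.
Proof.
rewrite lbp_expand coef_sum (bigD1 k) //= coefZ coefXn eqxx mulr1.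
rewrite big1 ?addr0 // => l lk; rewrite coefZ coefXn.
by rewrite (_ : (k == l :> nat) = false) ?mulr0 // eq_sym; exact: negbTE.
Qed.

Lemma size_lbp n : (size (lbp c n) <= n.+1)%N.
Proof.
rewrite lbp_expand (leq_trans (size_sum _ _ _)) //; apply/bigmax_leqP => k _.
by rewrite (leq_trans (size_scale_leq _ _)) // size_polyXn ltn_ord.
Qed.

(** A linear functional sending ['X^k] to [g k] acts inside the determinant, on its last row.
    Orthogonality then means two equal rows, and the norm is the next Toeplitz determinant. *)
Lemma lbp_functional n (g : nat -> F) : \sum_(k < n.+1) (lbp c n)`_k * g k
  = (toeplitz_det c n)^-1 * \det (border_mx (fun k : 'I_n.+1 => g k)).
Proof.
rewrite (expand_det_row _ ord_max) mulr_sumr; apply: eq_bigr => k _.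
rewrite coef_lbp mxE /= ltnn (cofactor_border_mx _ (fun=> 0)); ring.
Qed.

Lemma lbp_orthogonal n (i : nat) : (i < n)%N ->
  \sum_(k < n.+1) (lbp c n)`_k * c (k%:Z - i%:Z) = 0.
Proof.
move=> ilt; rewrite (lbp_functional n (fun k => c (k%:Z - i%:Z))).
have il : (i < n.+1)%N by exact: leqW.
rewrite (@determinant_alternate _ _ _ (Ordinal il) ord_max) ?mulr0 //.
  by rewrite -val_eqE /= ltn_eqF.
by move=> k; rewrite !mxE /= ilt ltnn.
Qed.

Lemma lbp_norm n : \sum_(k < n.+1) (lbp c n)`_k * c (k%:Z - n%:Z)
  = toeplitz_det c n.+1 / toeplitz_det c n.
Proof.
rewrite (lbp_functional n (fun k => c (k%:Z - n%:Z))) mulrC; congr (\det _ / _).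
apply/matrixP => i k; rewrite !mxE; case: ltnP => // h.
by congr (c (_ - _)); congr Posz; apply/eqP; rewrite eqn_leq h -ltnS ltn_ord.
Qed.

(** Left unsimplified so as to cover a vanishing determinant. *)
Lemma lead_lbp n : (lbp c n)`_n = (toeplitz_det c n)^-1 * toeplitz_det c n.
Proof.
rewrite (coef_lbp (@ord_max n)) /cofactor /= addnn -signr_odd odd_double expr0 mul1r.
congr (_ * \det _).
apply/matrixP => i k; rewrite !mxE lift_max_lt /=; congr (c (_ - _)); congr Posz;
  exact: lift_max.
Qed.

End Biorthogonality.

(* No determinant has to be nonzero: if [toeplitz_det c n = 0] then both sides
   vanish, since [0^-1 = 0]. *)
Lemma lbp_biorthogonal (F : fieldType) (c : int -> F) (n m : nat) :
  \sum_(k < n.+1) \sum_(l < m.+1)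
    (lbp c n)`_k * (lbp_partner c m)`_l * c (k%:Z - l%:Z)
  = (toeplitz_det c n.+1 / toeplitz_det c n) * (n == m)%:R.
Proof.
pose c' := fun k => c (- k); rewrite lbp_partnerE -/c'.
case: (ltngtP n m) => [nm|mn|<-]; rewrite ?mulr0 ?mulr1.
- rewrite big1 // => k _.
  have := @lbp_orthogonal _ c' m k; move=> /(_ (leq_trans (ltn_ord k) nm)) h.
  under eq_bigr do rewrite -mulrA.
  rewrite -mulr_sumr (eq_bigr (fun l : 'I_m.+1 => (lbp c' m)`_l * c' (l%:Z - k%:Z))).
    by rewrite h mulr0.
  by move=> l _; rewrite /c' opprB.
- rewrite exchange_big big1 // => l _ /=.
  have := @lbp_orthogonal _ c n l; move=> /(_ (leq_trans (ltn_ord l) mn)) h.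
  under eq_bigr do rewrite mulrAC.
  by rewrite -mulr_suml h mul0r.
(* All lower coefficients of the partner pair to 0 with [lbp c n]; the top one gives the norm. *)
- rewrite exchange_big big_ord_recr /= big1 ?add0r => [|l _].
    under eq_bigr do rewrite mulrAC.
    rewrite -mulr_suml lbp_norm lead_lbp toeplitz_det_opp.
    have [->|d0] := eqVneq (toeplitz_det c n) 0; first by rewrite invr0 !mulr0 ?mul0r.
    by rewrite mulVf // mulr1.
  under eq_bigr do rewrite mulrAC.
  by rewrite -mulr_suml (lbp_orthogonal _ (ltn_ord l)) mul0r.
Qed.

(** * Bilateral sums *)

Section SparseSums.
Variables (V : zmodType) (j m : int).
Implicit Types (a b F : int -> V).

(** The discrete primitive of [b] vanishing at 0: partial sums on either side become differences of
    its values, so a sparse sum is reindexed by composing primitives. *)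
Definition antidiff b (x : int) : V := match x with
  | Posz n => \sum_(k < n) b k%:Z
  | Negz n => - \sum_(k < n.+1) b (- (k.+1)%:Z)
  end.

Lemma antidiffS b x : antidiff b (x + 1) = antidiff b x + b x.
Proof.
case: x => [n|[|n]]; first by rewrite /= addn1 big_ord_recr.
  by rewrite /= big_ord0 big_ord_recr big_ord0 /= add0r addNr.
have -> : Negz n.+1 + 1 = Negz n by rewrite !NegzE; lia.
by rewrite /= [in RHS]big_ord_recr /= opprD -addrA addNr addr0.
Qed.

Lemma antidiff_opp b n : antidiff b (- n%:Z) = - \sum_(k < n) b (- (k.+1)%:Z).
Proof. by case: n => [|n]; rewrite ?big_ord0 ?oppr0 //= big_ord0. Qed.

Lemma sum_antidiff a F : (forall x, F (x + 1) = F x + a x) -> forall n,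
  \sum_(k < n) a k%:Z = F n%:Z - F 0 /\ \sum_(k < n) a (- (k.+1)%:Z) = F 0 - F (- n%:Z).
Proof.
move=> FS; elim=> [|n [IH1 IH2]]; first by rewrite !big_ord0 oppr0 subrr.
rewrite !big_ord_recr /= IH1 IH2; split.
  by rewrite addrAC -FS; congr (F _ - _); lia.
have := FS (- (n.+1)%:Z); have -> : - (n.+1)%:Z + 1 = - n%:Z by lia.
by move=> ->; rewrite opprD addrA subrK.
Qed.

(** Shaped like [mass], so that the masses are a [spread] by conversion. *)
Definition spread b (s : int) : V := if (s == m %[mod j])%Z then b ((s - m) %/ j)%Z else 0.

(* The ceiling of [(x - m) / j], so that [antidiff b \o cdiv] is a discrete
   primitive of [spread b]. *)
Let cdiv (x : int) : int := ((x - m + j - 1) %/ j)%Z.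

Hypothesis j_ge1 : 1 <= j.

(** The ceiling grows by 1 from [x] to [x + 1] exactly when [j] divides [x - m], and then passes the
    index [(x - m) / j]. *)
Lemma spread_antidiff b x : antidiff b (cdiv (x + 1)) = antidiff b (cdiv x) + spread b x.
Proof.
have j0 : j != 0 by rewrite gt_eqF // (lt_le_trans _ j_ge1).
have jgt0 : 0 < j by rewrite (lt_le_trans _ j_ge1).
rewrite /spread eqz_mod_dvd /cdiv; set d := x - m.
have -> : x + 1 - m + j - 1 = 1 * j + d by rewrite /d; ring.
rewrite divzMDl //; case: ifP => [/dvdzP[k dk]|nd].
  have -> : (d %/ j)%Z = k by rewrite dk mulzK.
  rewrite [1 + k]addrC antidiffS; congr (antidiff b _ + _).
  have -> : d + j - 1 = k * j + (j - 1) by rewrite dk; ring.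
  rewrite divzMDl // divz_small ?addr0 //.
  by rewrite gtz0_abs // subr_ge0 j_ge1 /= gtrBl.
rewrite addr0; congr antidiff.
have r0 := modz_ge0 d j0; have rj := ltz_pmod d jgt0.
have rn0 : (d %% j)%Z != 0 by apply: contraFN nd => /eqP/dvdz_mod0P.
have r1 : 1 <= (d %% j)%Z by rewrite -gtz0_ge1 lt_def rn0.
have -> : d + j - 1 = (1 + (d %/ j)%Z) * j + ((d %% j)%Z - 1).
  by rewrite {1}(divz_eq d j); ring.
have small : (((d %% j)%Z - 1) %/ j)%Z = 0.
  apply: divz_small; rewrite gtz0_abs // subr_ge0 r1 /=.
  by rewrite ltrBlDr (lt_trans rj) // ltrDl.
by rewrite divzMDl // small addr0.
Qed.

Lemma cdiv_ge (A : nat) : exists N0 : nat, forall n : nat, (N0 <= n)%N ->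
  A%:Z <= cdiv n%:Z /\ cdiv (- n%:Z) <= - A%:Z.
Proof.
have jgt0 : 0 < j by rewrite (lt_le_trans _ j_ge1).
exists (`|m| + `|j| * A.+1)%N => n hn.
have {}hn : `|m|%N%:Z + j * (A%:Z + 1) <= n%:Z.
  have := hn; rewrite -lez_nat PoszD PoszM (gtz0_abs jgt0) //.
  by rewrite -[A.+1]addn1 PoszD.
have m1 : m <= `|m|%N%:Z by lia.
have m2 : - m <= `|m|%N%:Z by lia.
rewrite mulrDr mulr1 in hn; rewrite /cdiv; split.
  by rewrite lez_divRL // mulrC; move: (j * A%:Z) hn => p hn; lia.
rewrite -ltzD1 ltz_divLR // mulrDl mulNr mul1r [A%:Z * j]mulrC.
move: (j * A%:Z) hn => p hn; lia.
Qed.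

End SparseSums.

Section BilateralSums.
Variables (R : realType) (j m : int).
Hypothesis j_ge1 : 1 <= j.
Implicit Types (a b : int -> R[i]) (l : R[i]).

(** Two one-sided limits, stable under finite linear combinations; they give the independence of the
    two cutoffs in [is_bilateral_sum]. *)
Definition bilateral a l : Prop := exists l1 l2,
  [/\ ccvg (fun n => \sum_(k < n) a (- (k.+1)%:Z)) l1,
      ccvg (fun n => \sum_(k < n) a k%:Z) l2 & l = l1 + l2].

Lemma is_bilateral_sumP a l : bilateral a l -> is_bilateral_sum a l.
Proof.
move=> [l1 [l2 [/ccvgP h1 /ccvgP h2 ->]]].
apply/(@cvgrPdist_lt R[i] R[i]^o) => e; rewrite ltcE /= => /andP[/eqP ei er].
have e2 : 0 < complex.Re e / 2 by rewrite divr_gt0.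
exists ([set n | cabs (\sum_(k < n) a (- (k.+1)%:Z) - l1) < complex.Re e / 2],
        [set n | cabs (\sum_(k < n) a k%:Z - l2) < complex.Re e / 2]).
  by split; [exact: h1|exact: h2].
move=> [M N] /= [hM hN]; rewrite -normrN opprB cabsE ltcE /= ei eqxx /=.
rewrite !big_mkord opprD addrACA; apply: le_lt_trans (cabsD _ _) _; lra.
Qed.

Lemma bilateral_eq a a' l : a =1 a' -> bilateral a l -> bilateral a' l.
Proof. by move=> /funext ->. Qed.

Lemma bilateralZ a l (c : R[i]) : bilateral a l -> bilateral (fun s => c * a s) (c * l).
Proof.
move=> [l1 [l2 [h1 h2 ->]]]; exists (c * l1), (c * l2); split; last by rewrite mulrDr.
  by apply: (ccvg_eq _ (ccvgZ c h1)) => n; rewrite mulr_sumr.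
by apply: (ccvg_eq _ (ccvgZ c h2)) => n; rewrite mulr_sumr.
Qed.

Lemma bilateral_sum n (a : 'I_n -> int -> R[i]) (l : 'I_n -> R[i]) :
  (forall i, bilateral (a i) (l i)) ->
  bilateral (fun s => \sum_i a i s) (\sum_i l i).
Proof.
move=> /choice[l1 /choice[l2 h]]; exists (\sum_i l1 i), (\sum_i l2 i); split.
- apply: (ccvg_eq (u := fun N => \sum_i \sum_(k < N) a i (- (k.+1)%:Z))).
    by move=> N; rewrite exchange_big.
  by apply: ccvg_sum => i; have [] := h i.
- apply: (ccvg_eq (u := fun N => \sum_i \sum_(k < N) a i k%:Z)).
    by move=> N; rewrite exchange_big.
  by apply: ccvg_sum => i; have [] := h i.
- by rewrite -big_split; apply: eq_bigr => i _; have [] := h i.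
Qed.

(** Partial sums are differences of values of [F], which has the same limits at both ends as the
    primitive of [b]. The cutoff 0 in [s] need not be the cutoff 0 in the index of [b]: each half is
    shifted by [F 0], which cancels in the total. *)
Lemma bilateral_spread b l : bilateral b l -> bilateral (spread j m b) l.
Proof.
move=> [l1 [l2 [h1 h2 ->]]].
pose F x := antidiff b (((x - m + j - 1) %/ j)%Z).
have FS x : F (x + 1) = F x + spread j m b x by exact: spread_antidiff.
have [N0 hN0] := cdiv_ge m j_ge1 0.
have cvgF : ccvg (fun n => F n%:Z) l2.
  apply: (@ccvg_near _ (fun n => \sum_(k < absz ((n%:Z - m + j - 1) %/ j)%Z) b k%:Z)).
    exists N0 => // n /= /hN0 [h _]; rewrite /F.
    by case: (_ %/ _)%Z h.
  apply: ccvg_comp h2 _; apply/cvgnyPge => A.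
  have [N hN] := cdiv_ge m j_ge1 A; exists N => // n /= /hN [h _]; lia.
have cvgF' : ccvg (fun n => F (- n%:Z)) (- l1).
  apply: (@ccvg_near _ (fun n => - \sum_(k < absz ((- n%:Z - m + j - 1) %/ j)%Z) b (- (k.+1)%:Z))).
    exists N0 => // n /= /hN0 [_ h]; rewrite /F -antidiff_opp; congr antidiff; lia.
  apply: ccvgN; apply: ccvg_comp h1 _; apply/cvgnyPge => A.
  have [N hN] := cdiv_ge m j_ge1 A; exists N => // n /= /hN [_ h]; lia.
exists (F 0 - - l1), (l2 - F 0); split; last by ring.
- apply: (ccvg_eq _ (ccvgB (ccvg_cst (F 0)) cvgF')) => n.
  by rewrite (sum_antidiff FS n).2.
- apply: (ccvg_eq _ (ccvgB cvgF (ccvg_cst (F 0)))) => n.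
  by rewrite (sum_antidiff FS n).1.
Qed.

End BilateralSums.

(** * Absolute summability *)

Section Summability.
Variable R : realType.
Implicit Types (a b : int -> R) (K : R).

Lemma summable_int a K : (forall s, 0 <= a s) ->
  (forall n, \sum_(k < n) a k%:Z <= K) -> (forall n, \sum_(k < n) a (- (k.+1)%:Z) <= K) ->
  summable [set: int] (fun s => (a s)%:E).
Proof.
move=> a0 hp hn.
have a0' s : (0 <= `|(a s)%:E|)%E by exact: abse_ge0.
have bound (e : nat -> int) : set_inj [set: nat] e -> (forall n, \sum_(k < n) a (e k) <= K) ->
    (\esum_(s in e @` [set: nat]) `|(a s)%:E| <= K%:E)%E.
  move=> einj h; rewrite (esum_image setT e) // -nneseries_esumT //.
  apply: lime_le; first exact: is_cvg_nneseries.
  apply: nearW => n; rewrite big_mkord.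
  rewrite (eq_bigr (fun k : 'I_n => (a (e k))%:E)) => [|k _]; last by rewrite /= ger0_norm.
  by rewrite sumEFin lee_fin; exact: h.
rewrite /summable (esumID (Posz @` [set: nat])) // !setTI.
have -> : ~` (Posz @` [set: nat]) = Negz @` [set: nat].
  apply/seteqP; split => [[n|n] /= h|_ [n _ <-] [k _]//]; last by exists n.
  by case: h; exists n.
apply: (@le_lt_trans _ _ (K%:E + K%:E)%E); last by rewrite -EFinD ltry.
by apply: leeD; apply: bound => // n k _ _ [].
Qed.

Lemma antidiff_bounded b K : (forall k, 0 <= b k) ->
  (forall n, \sum_(k < n) b k%:Z <= K) -> (forall n, \sum_(k < n) b (- (k.+1)%:Z) <= K) ->
  forall x, - K <= antidiff b x <= K.
Proof.
move=> b0 hp hn x.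
have K0 : 0 <= K by have := hp 0%N; rewrite big_ord0.
have K0' : - K <= 0 by rewrite oppr_le0.
case: x => n /=; apply/andP; split; rewrite ?lerN2; [|exact: hp|exact: hn|].
  by apply: (le_trans K0'); exact: sumr_ge0.
by apply: le_trans K0; rewrite oppr_le0; exact: sumr_ge0.
Qed.

(** Partial sums are differences of two values of the primitive, each in [[- K, K]]; hence the bound
    [K + K]. *)
Lemma summable_spread (j m : int) b K : 1 <= j -> (forall k, 0 <= b k) ->
  (forall n, \sum_(k < n) b k%:Z <= K) -> (forall n, \sum_(k < n) b (- (k.+1)%:Z) <= K) ->
  summable [set: int] (fun s => (spread j m b s)%:E).
Proof.
move=> j1 b0 hp hn; have hb := antidiff_bounded b0 hp hn.
have sm := sum_antidiff (fun x => spread_antidiff m j1 b x).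
apply: (@summable_int _ (K + K)) => [s|n|n].
- by rewrite /spread; case: ifP.
- rewrite (sm n).1; have := hb (((n%:Z - m + j - 1) %/ j)%Z).
  have := hb (((0 - m + j - 1) %/ j)%Z); lra.
- rewrite (sm n).2; have := hb (((- n%:Z - m + j - 1) %/ j)%Z).
  have := hb (((0 - m + j - 1) %/ j)%Z); lra.
Qed.

End Summability.

(** * Density *)

Section Density.
Variable R : realType.
Implicit Types (a b c x e : R).

(** A nonzero subgroup of the reals without arbitrarily small positive elements is cyclic, which
    would make [a] and [b] commensurable. *)
Lemma dense_subgroup a b : b != 0 ->
  (forall p r : int, (p, r) <> (0, 0) -> a * p%:~R <> b * r%:~R) ->
  forall c e, 0 < e -> exists k n : int, `|a * k%:~R + b * n%:~R - c| < e.
Proof.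
move=> b0 indep c e e0.
pose G x := exists k n : int, x = a * k%:~R + b * n%:~R.
have GZ x (n : int) : G x -> G (n%:~R * x).
  by move=> [k [l ->]]; exists (n * k), (n * l); rewrite !intrM; ring.
have GB x z : G x -> G z -> G (x - z).
  by move=> [k [l ->]] [k' [l' ->]]; exists (k - k'), (l - l'); rewrite !intrB; ring.
have Ga : G a by exists 1, 0; rewrite mulr1 mulr0 addr0.
have Gb : G b by exists 0, 1; rewrite mulr1 mulr0 add0r.
pose S := [set x | 0 < x /\ G x].
have frac x z : 0 < x -> 0 <= z - (Num.floor (z / x))%:~R * x < x.
  move=> x0; have := floor_le (z / x); have := floorD1_gt (z / x).
  rewrite intrD ltr_pdivrMr // ler_pdivlMr //; lra.
(* Otherwise an [x] in [S] below 3/2 of the infimum divides every element,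
   since a nonzero remainder [r] would make [x - r] too small. *)
have small : exists2 x, S x & x < e.
  apply: contrapT => hno.
  have Slb x : S x -> e <= x.
    by move=> Sx; rewrite leNgt; apply/negP => xe; apply: hno; exists x.
  have S0 : S !=set0.
    exists `|b|; split; first by rewrite normr_gt0.
    have [_|_] := ger0P b => //; by have := GZ _ (-1) Gb; rewrite mulN1r.
  have infS : has_inf S by split => //; exists e.
  have g0 : e <= inf S by apply: lb_le_inf.
  have [x [x0 Gx] xg] := inf_adherent (divr_gt0 (lt_le_trans e0 g0) (ltr0n R 2)) infS.
  have gle z : S z -> inf S <= z by move=> Sz; apply: ge_inf => //; exists e.
  have mult z : G z -> exists n : int, z = n%:~R * x.
    move=> Gz; exists (Num.floor (z / x)); apply/eqP; rewrite -subr_eq0; apply/eqP.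
    have /andP[r0 rx] := frac x z x0.
    set r := z - _ in r0 rx *.
    have Gr : G r by apply: GB => //; exact: GZ.
    apply/eqP; rewrite eq_le r0 andbT leNgt; apply/negP => rpos.
    have h1 := gle r (conj rpos Gr).
    have h2 : S (x - r) by split; [rewrite subr_gt0|exact: GB].
    have := gle _ h2; lra.
  have [p ap] := mult a Ga; have [r br] := mult b Gb.
  have r0 : r != 0 by apply: contra b0 => /eqP r0; rewrite br r0 mul0r.
  apply: (indep r p); first by case=> r00; rewrite r00 eqxx in r0.
  by rewrite [in LHS]ap [in RHS]br mulrAC [RHS]mulrAC [r%:~R * _]mulrC.
have [x [x0 Gx] xe] := small.
(* The largest multiple of [x] not above [c] is within [x < e] of it. *)
have [k [n E]] := GZ _ (Num.floor (c / x)) Gx.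
exists k, n; rewrite -E distrC; have /andP[h1 h2] := frac x c x0.
by rewrite ger0_norm // (lt_trans h2).
Qed.

Lemma cabs_cexp_i_sub (s t : R) :
  cabs (cexp ('i * s%:C) - cexp ('i * t%:C)) <= `|s - t| + (s - t) ^+ 2 / 2.
Proof.
have -> : cexp ('i * s%:C) - cexp ('i * t%:C)
    = cexp ('i * t%:C) * (cexp ('i * (s - t)%:C) - 1).
  by rewrite mulrBr mulr1 -cexpD -mulrDr -rmorphD /= [t + _]addrC subrK.
have h x : cabs (cexp ('i * x%:C)) = 1.
  by rewrite cexp_i /cabs /= cos2Dsin2 sqrtr1.
rewrite cabsM h mul1r cexp_i; move: (s - t) => d.
apply: le_trans (cabs_le_ReIm _) _; rewrite /= oppr0 addr0 addrC; apply: lerD.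
  exact: normr_sin_le.
have /andP[h1 h2] := one_sub_cos_le d.
by rewrite distrC ger0_norm.
Qed.

Lemma cabs_eq1_cexp (x : R[i]) : cabs x = 1 -> exists t : R, x = cexp ('i * t%:C).
Proof.
case: x => p r h.
have pr : p ^+ 2 + r ^+ 2 = 1 by have := sqr_cabs (Complex p r); rewrite h expr1n.
have p1 : -1 <= p <= 1.
  rewrite -ler_norml -(@ler_pXn2r _ 2) ?nnegrE // expr1n real_normK ?num_real //.
  by rewrite -pr lerDl sqr_ge0.
have sr : Num.sqrt (1 - p ^+ 2) = `|r| by rewrite -pr addrC addKr sqrtr_sqr.
have [r0|r0] := leP 0 r.
  exists (acos p); rewrite cexp_i acosK ?in_itv //= sin_acos // sr ger0_norm //.
exists (- acos p); rewrite cexp_i cosN sinN acosK ?in_itv //= sin_acos // sr.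
by rewrite ltr0_norm // opprK.
Qed.

End Density.

(** * Quasi-periodicity of f *)

Section EllipticFunction.
Variables (R : realType) (omega1 y : R) (alpha beta gamma : R[i]).
Local Notation omega3 := ('i * y%:C : R[i]).
Local Notation w1 := (omega1%:C : R[i]).
Local Notation eta := (eta1 w1 omega3).
Local Notation f := (elliptic_f omega1 omega3 alpha beta gamma).
Hypotheses (omega1_gt0 : 0 < omega1) (y_gt0 : 0 < y).

(** The multipliers of the two sigma factors have quotient [exp(2 eta1 beta)], their signs cancel,
    and [exp(gamma z)] supplies the rest. *)
Lemma elliptic_f_shift z :
  f (z + 2 * w1) = cexp (2 * (w1 * gamma + eta * beta)) * f z.
Proof.
have S := sigma_period omega1_gt0 y_gt0.
rewrite /elliptic_f.
have -> : z + 2 * w1 + alpha + beta = z + alpha + beta + 2 * w1 by ring.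
have -> : z + 2 * w1 + alpha = z + alpha + 2 * w1 by ring.
rewrite !S.
set s1 := weierstrass_sigma _ _ _; set s2 := weierstrass_sigma _ _ _.
set e1 := cexp (2 * eta * (z + alpha + beta + w1)).
set e2 := cexp (2 * eta * (z + alpha + w1)).
have E : e1 / e2 * cexp (gamma * (z + 2 * w1))
    = cexp (2 * (w1 * gamma + eta * beta)) * cexp (gamma * z).
  by rewrite /e1 /e2 -cexpB -!cexpD; congr cexp; ring.
have e20 : e2 != 0 by exact: cexp_neq0.
have -> : - e1 * s1 / (- e2 * s2) = e1 / e2 * (s1 / s2).
  by rewrite -mulf_div invrN mulrNN.
have -> : cexp (2 * (w1 * gamma + eta * beta)) * (kappa omega1 omega3 alpha beta gamma
    * (s1 / s2) * cexp (gamma * z)) = kappa omega1 omega3 alpha beta gamma * (s1 / s2)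
    * (cexp (2 * (w1 * gamma + eta * beta)) * cexp (gamma * z)) by ring.
by rewrite -E; ring.
Qed.

Lemma elliptic_f_period (j m : int) z : 1 <= j ->
  j%:~R * (w1 * gamma + eta * beta) = 'i * pi%:C * m%:~R ->
  f (z + 2 * w1 * j%:~R) = f z.
Proof.
case: j => // n _ hj; rewrite -pmulrn in hj *.
have shift k : f (z + 2 * w1 * k%:R) = cexp (2 * (w1 * gamma + eta * beta)) ^+ k * f z.
  elim: k => [|k IH]; first by rewrite mulr0 addr0 mul1r.
  by rewrite -[k.+1%:R]natr1 mulrDr mulr1 addrA elliptic_f_shift IH exprS mulrA.
rewrite shift -cexpMn.
have -> : 2 * (w1 * gamma + eta * beta) * n%:R = 2 * ('i * pi%:C) * m%:~R.
  by rewrite -[RHS]mulrA -hj; ring.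
by rewrite cexp_2ipiMz mul1r.
Qed.

End EllipticFunction.

(** * From moments to the measure *)

Lemma bilateral_poly (R : realType) (A z : int -> R[i]) (c : int -> R[i])
    (p r : {poly R[i]}) n k :
  (forall s, z s != 0) -> (size p <= n)%N -> (size r <= k)%N ->
  (forall d, bilateral (fun s => A s * z s ^ d) (c d)) ->
  bilateral (fun s => A s * p.[z s] * r.[(z s)^-1])
    (\sum_(i < n) \sum_(l < k) p`_i * r`_l * c (i%:Z - l%:Z)).
Proof.
move=> z0 sp sr hA.
apply: (bilateral_eq (a := fun s =>
    \sum_(i < n) \sum_(l < k) p`_i * r`_l * (A s * z s ^ (i%:Z - l%:Z)))).
  move=> s; rewrite (horner_coef_wide _ sp) (horner_coef_wide _ sr).
  rewrite -[RHS]mulrA mulr_suml [RHS]mulr_sumr; apply: eq_bigr => i _.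
  rewrite [in RHS]mulr_sumr [RHS]mulr_sumr; apply: eq_bigr => l _.
  rewrite expfzDr // -exprnN exprVn -exprnP; ring.
by apply: bilateral_sum => i; apply: bilateral_sum => l; exact: bilateralZ.
Qed.

Theorem proposition2 (R : realType) (omega1 : R) (omega3 : R[i])
    (w alpha0 nu : R) (alpha beta gamma : R[i]) (j m : int)
  (omega1_gt0 : 0 < omega1)
  (omega3_imag : exists2 y : R, 0 < y & omega3 = 'i * y%:C)
  (w_generic : forall N1 N2 : int, (N1, N2) <> (0, 0) ->
     w * N1%:~R <> omega1 * N2%:~R)
  (alphaE : alpha = - alpha0%:C - 2 * nu%:C * omega3)
  (alpha0_bounds : 0 <= alpha0 < 2 * omega1)
  (nu_bounds : 0 < nu < 1)
  (beta_nondeg : forall n : nat,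
     ~ lattice omega1%:C omega3 (beta + n%:R * alpha))
  (beta_nondeg' : forall n : nat,
     ~ lattice omega1%:C omega3 (beta + n%:R * (alpha + w%:C)))
  (j_ge1 : 1 <= j) (coprime_jm : coprimez j m)
  (period_cond : j%:~R * (omega1%:C * gamma + eta1 omega1%:C omega3 * beta)
                 = 'i * pi%:C * m%:~R) :
  let f := elliptic_f omega1 omega3 alpha beta gamma in
  let c := elliptic_moment omega1 omega3 alpha beta gamma w in
  let P := lbp c in
  let Q := lbp_partner c in
  let Delta := toeplitz_det c in
  let z := mass_pt omega1 w j in
  let A := mass omega1 omega3 alpha0 nu alpha beta gamma j m in
  [/\ (* f has period 2 omega1 j (away from its poles) *)
      forall x : R[i], ~ lattice omega1%:C omega3 (x + alpha) ->
        f (x + 2 * omega1%:C * j%:~R) = f x,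
      (* the masses A_s define a finite complex measure on the unit circle *)
      (forall s : int, `|z s| = 1) /\
        summable [set: int] (fun s => (complex.Re `|A s|)%:E),
      (* biorthogonality *)
      forall n m' : nat,
        is_bilateral_sum (fun s : int => A s * (P n).[z s] * (Q m').[(z s)^-1])
          ((Delta n.+1 / Delta n) * (n == m')%:R),
      (* the points carrying nonzero mass are pairwise distinct *)
      forall s t : int, A s != 0 -> A t != 0 -> z s = z t -> s = t
    & (* and dense in the unit circle *)
      [set x : R[i]^o | `|x| = 1]
        `<=` closure [set (z s : R[i]^o) | s in [set s : int | A s != 0]] ].
Proof.
have [y y_gt0 omega3E] := omega3_imag.
rewrite {}omega3E {omega3_imag} in alphaE beta_nondeg beta_nondeg' period_cond *.
have beta_lattice : ~ lattice omega1%:C ('i * y%:C) beta.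
  by have := beta_nondeg 0%N; rewrite mul0r addr0.
have w1_neq0 : omega1%:C != 0 :> R[i].
  by rewrite -cabs_gt0 cabs_real normr_gt0 gt_eqF.
have j_gt0 : 0 < j by exact: lt_le_trans j_ge1.
have j_neq0 : j%:~R != 0 :> R by rewrite intr_eq0 gt_eqF.
move=> f c P Q Delta z A.
pose th (s : int) : R := pi * s%:~R * w / (j%:~R * omega1).
have zE s : z s = cexp ('i * (th s)%:C).
  rewrite /z /mass_pt; congr cexp.
  by rewrite /th rmorphM fmorphV !rmorphM /= !rmorph_int; ring.
have z_norm s : cabs (z s) = 1 by rewrite zE cexp_i /cabs /= cos2Dsin2 sqrtr1.
have z_neq0 s : z s != 0 by rewrite -cabs_gt0 z_norm.
pose mu := mass_at omega1 ('i * y%:C) alpha0 nu alpha beta gamma.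
have AE : A = spread j m mu by [].
have AS k : A (m + j * k) = mu k.
  rewrite AE /spread eqz_mod_dvd addrC addKr dvdz_mulr // mulKz //.
  by rewrite gt_eqF.
have A_supp s : A s != 0 -> exists k, s = m + j * k.
  rewrite AE /spread; case: ifP => [|_]; last by rewrite eqxx.
  rewrite eqz_mod_dvd => /dvdzP[k hk] _; exists k; rewrite mulrC -hk; ring.
have term_spread d s : A s * z s ^ d = spread j m
    (fun k => mass_term omega1 y w alpha0 nu alpha beta gamma j m k d) s.
  rewrite AE /spread; case: ifP => [|_]; last by rewrite mul0r.
  rewrite eqz_mod_dvd => /dvdzP[k hk].
  have -> : s = m + j * k by rewrite mulrC -hk; ring.
  by rewrite addrC addKr mulKz ?gt_eqF // addrC.
have moments d : bilateral (fun s => A s * z s ^ d) (c d).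
  apply: (bilateral_eq (fun s => esym (term_spread d s))).
  apply: bilateral_spread => //.
  have [S1 [S2 [h1 h2 cE]]] := moment_expansion w omega1_gt0 y_gt0 alphaE nu_bounds
    beta_lattice j_ge1 period_cond d.
  set T := fun k => mass_term _ _ _ _ _ _ _ _ _ _ k d.
  (* The expansion counts index 0 with the nonpositive half, [bilateral] with the nonnegative
     one. *)
  exists (S1 - T 0), (T 0 + S2); split; last by rewrite [LHS]cE; ring.
    apply: (ccvg_eq _ (ccvgB (ccvg_subseq h1 leqnSn) (ccvg_cst (T 0)))) => n.
    by rewrite big_ord_recl /= addrC addKr.
  apply: (ccvg_near _ (ccvgD (ccvg_cst (T 0)) (ccvg_shift 1 h2))).
  exists 1%N => // n /= n0; rewrite -[in RHS](prednK n0) subn1.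
  by rewrite [RHS]big_ord_recl.
split.
- by move=> x _; apply: elliptic_f_period period_cond.
- split=> [s|]; first by rewrite cabsE z_norm.
  have [C [r [/andP[r0 r1] hC]]] := mass_at_le w omega1_gt0 y_gt0 alphaE nu_bounds
    beta_lattice j_ge1 period_cond.
  pose b k := cabs (mu k).
  have b0 k : 0 <= b k by exact: cabs_ge0.
  have C0 : 0 <= C.
    by have := (hC 0%N).1; rewrite expr0 mulr1; apply: le_trans; exact: cabs_ge0.
  pose L := limn (series (fun k => C * r ^+ k)).
  have hL n : \sum_(k < n) C * r ^+ k <= L.
    apply: series_le_sup => [k|]; first by rewrite mulr_ge0 // exprn_ge0.
    by apply: cvg_series_geom; rewrite r0 r1.
  have L0 : 0 <= L by have := hL 0%N; rewrite big_ord0.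
  have -> : (fun s => (complex.Re `|A s|)%:E) = (fun s => (spread j m b s)%:E).
    apply/funext => s; congr (_%:E); rewrite cabsE AE /spread /b.
    by case: ifP => _; [|exact: cabs0].
  (* The bounds at hand cover the indices [- k] and [k + 1]; in the nonnegative half the mass of
     index 0 is added separately. *)
  apply: (@summable_spread _ _ _ _ (b 0 + L)) => // n.
    case: n => [|n]; first by rewrite big_ord0 addr_ge0.
    rewrite big_ord_recl /= lerD2l; apply: le_trans (hL n).
    by apply: ler_sum => k _; exact: (hC k).2.
  apply: (@le_trans _ _ L); last by rewrite lerDr.
  apply: le_trans (hL n); apply: ler_sum => k _.
  apply: le_trans (hC k.+1).1 _; apply: ler_wpM2l => //.
  by rewrite exprS ler_piMl ?exprn_ge0 // ltW.
- move=> n k; apply: is_bilateral_sumP; rewrite -lbp_biorthogonal.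
  apply: (bilateral_poly z_neq0 _ _ moments); first exact: size_lbp.
  by rewrite /Q lbp_partnerE; exact: size_lbp.
- move=> s t _ _; rewrite !zE => h.
  have [n hn] : exists n : int, th s - th t = 2 * pi * n%:~R.
    by apply: cexp_i_eq1; rewrite rmorphB mulrBr cexpB h divff ?cexp_neq0.
  apply/eqP; rewrite -subr_eq0; apply/eqP; apply: contrapT => st.
  (* Equality of the arguments modulo 2 pi reads [w (s - t) = omega1 (2 j n)]. *)
  apply: (w_generic (s - t) (2 * j * n)); first by case.
  have pi0 : pi != 0 :> R by rewrite gt_eqF ?pi_gt0.
  have w0 : omega1 != 0 by rewrite gt_eqF.
  have -> : w * (s - t)%:~R = (th s - th t) * (j%:~R * omega1) / pi.
    by rewrite /th intrB; move: (@pi R) pi0 => p p0; field; rewrite p0 j_neq0 w0.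
  by rewrite hn !intrM; move: (@pi R) pi0 => p p0; field.
move=> x /= x1 B /nbhs_ballP[e e0 hB].
have [t xt] : exists t : R, x = cexp ('i * t%:C).
  by apply: cabs_eq1_cexp; move: x1; rewrite cabsE => /complexI.
have : (0 : R[i]) < e by exact: e0.
rewrite ltcE /= => /andP[/eqP ei er].
(* For angles at distance [v < d <= 1] the chord is at most [v + v ^ 2 / 2 < 2 d <= Re e]. *)
pose d := Num.min 1 (complex.Re e / 2).
have d0 : 0 < d by rewrite lt_min ltr01 divr_gt0.
have dp : 0 < d * omega1 / pi by rewrite divr_gt0 ?mulr_gt0 ?pi_gt0.
have pi0 : pi != 0 :> R by rewrite gt_eqF ?pi_gt0.
have w0 : omega1 != 0 by rewrite gt_eqF.
(* Stepping by [j] cancels the [j] in the denominator of [th]: the argument of the point [m + j k],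
   increased by [2 pi n], is [th m + (pi / omega1) (w k + 2 omega1 n)]. *)
have [|p r pr E|k [n hkn]] := @dense_subgroup R w (2 * omega1) _ _
  ((t - th m) * omega1 / pi) _ dp.
- by rewrite mulf_neq0.
- apply: (w_generic p (2 * r)); last by rewrite E intrM; ring.
  case=> p0 r0; apply: pr; rewrite p0; congr (_, _).
  by apply: (mulfI (isT : (2 : int) != 0)); rewrite r0 mulr0.
exists (z (m + j * k)); split.
  by exists (m + j * k) => //=; rewrite AS;
    exact: (mass_at_neq0 w omega1_gt0 y_gt0 alphaE beta_lattice j_ge1 period_cond).
apply: hB; rewrite /ball /= cabsE ltcE /= ei eqxx /=.
pose s := th (m + j * k) + 2 * pi * n%:~R.
have -> : z (m + j * k) = cexp ('i * s%:C).
  rewrite zE /s rmorphD mulrDr cexpD.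
  have -> : 'i * (2 * pi * n%:~R)%:C = 2 * ('i * pi%:C) * n%:~R :> R[i].
    by rewrite !rmorphM /= rmorph_int rmorph_nat; ring.
  by rewrite cexp_2ipiMz mulr1.
rewrite xt cabsBC; apply: le_lt_trans (cabs_cexp_i_sub _ _) _.
have st : `|s - t| < d.
  have -> : s - t = (w * k%:~R + 2 * omega1 * n%:~R - (t - th m) * omega1 / pi)
      * (pi / omega1).
    by rewrite /s /th intrD intrM; move: (@pi R) pi0 => p p0; field; rewrite p0 j_neq0 w0.
  rewrite normrM [`|pi / _|]ger0_norm ?divr_ge0 ?pi_ge0 ?(ltW omega1_gt0) //.
  by rewrite -ltr_pdivlMr ?divr_gt0 ?pi_gt0 // invf_div mulrA.
have d1 : d <= 1 by rewrite ge_min lexx.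
have de : d <= complex.Re e / 2 by rewrite ge_min lexx orbT.
have := real_normK (num_real (s - t)); have := normr_ge0 (s - t).
move: `|s - t| st => v vd v0 <-; nra.
Qed.
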